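(* Fix $\alpha>1$. Let $\varphi\ge0$, $\varphi\not\equiv0$, be an even function in $S_0^\alpha$, vanishing for $|x|\ge a$ (some $a>0$), normalized so that $\int_{-\infty}^\infty\varphi(x)\,dx=1$. Let $b>\max(1,a)$, put $\Phi(x)=\int_{x-b}^{x+b}\varphi(u)\,du$ and $f(x)=\int_{-\infty}^\infty\Phi(u)e^{-2\pi ixu}\,du$. Let $\varepsilon>0$, $0<\delta<2\pi(b-a)$, $G=\delta/\log(T/2\pi)$, $L=(\log T)^{1/2+\varepsilon}$, $(\log T)^{\varepsilon}\le V\le T^{1/4}/\log T$. Then for $|t-T|\le VL$ and any fixed $N\ge1$, $$M_{Z,f}(t)=G\big(Z(t)+O(T^{-N})\big).$$
   Context: $Z(t)=e^{i\theta(t)}\zeta(\tfrac12+it)$ with $\theta(t)=\operatorname{Im}\log\Gamma(\tfrac14+\tfrac{it}{2})-\tfrac t2\log\pi$ is Hardy's function (real for real $t$, $|Z(t)|=|\zeta(\tfrac12+it)|$). For $\alpha,\beta\ge0$, $S_\alpha^\beta$ is the set of $C^\infty$ functions $g$ on $\mathbb R$ for which there exist constants $A,B,C>0$ with $|x^kg^{(q)}(x)|\le CA^kB^qk^{k\alpha}q^{q\beta}$ for all real $x$ and integers $k,q\ge0$ ($0^0=1$). For $G>0$, $M_{Z,f}(t)=\int_{-\infty}^\infty Z(t+x)f(x/G)\,dx$. $T$ is large; the $O$-constant may depend on $N,\varepsilon,\varphi,a,b,\delta$. *)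

(* Defs.v *)
From Stdlib Require Import Reals Lra Lia.
From Coquelicot Require Import Coquelicot.

Open Scope R_scope.

Definition Cexp (z : C) : C :=
  (exp (Re z) * cos (Im z), exp (Re z) * sin (Im z)).

(* x^s, for x > 0 only *)
Definition Rcpow (x : R) (s : C) : C := Cexp (s * RtoC (ln x))%C.

Definition zeta_seq (s : C) (N : nat) : C :=
  (sum_n (fun n => Rcpow (INR (S n)) (- s)) N
   + Rcpow (INR (S N)) (1 - s) / (s - 1))%C.

(* Riemann's zeta function on Re s > 0, s <> 1, as
   lim_N (sum_{n <= N} n^{-s} + N^{1-s}/(s-1)).  That this is the analytic
   continuation of sum_n n^{-s} is proved below: ZetaFacts.zeta_Dirichlet
   (equality for Re s > 1) and ZetaFacts.zeta_holomorphic. *)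
Definition zeta (s : C) : C :=
  (real (Lim_seq (fun N => Re (zeta_seq s N))),
   real (Lim_seq (fun N => Im (zeta_seq s N)))).

(* Euler's integral, for Re z > 0 *)
Definition Gamma (z : C) : C :=
  @RInt_gen C_R_CompleteNormedModule
    (fun x : R => (Rcpow x (z - 1) * RtoC (exp (- x)))%C)
    (at_right 0) (Rbar_locally p_infty).

(* The branch of log Gamma on the half-plane Re z > 0 that is real on the
   positive axis; these conditions determine it there. *)
Definition is_logGamma (lG : C -> C) : Prop :=
  (forall z : C, 0 < Re z -> continuous lG z) /\
  (forall z : C, 0 < Re z -> Cexp (lG z) = Gamma z) /\
  (forall x : R, 0 < x -> Im (lG (RtoC x)) = 0).

Definition theta (lG : C -> C) (t : R) : R :=
  Im (lG ((1 / 4)%R, (t / 2)%R)) - t / 2 * ln PI.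

Definition HardyZ (lG : C -> C) (t : R) : C :=
  (Cexp (0, theta lG t) * zeta ((1 / 2)%R, t))%C.

(* The space S_al^be.  Rpower 0 0 = 1, so the convention 0^0 = 1 holds. *)
Definition gelfand_shilov (al be : R) (g : R -> R) : Prop :=
  (forall (q : nat) (x : R), ex_derive_n g q x) /\
  exists A B K : R, 0 < A /\ 0 < B /\ 0 < K /\
    forall (k q : nat) (x : R),
      Rabs (x ^ k * Derive_n g q x)
      <= K * A ^ k * B ^ q
         * Rpower (INR k) (INR k * al) * Rpower (INR q) (INR q * be).

Definition window (phi : R -> R) (b x : R) : R := RInt phi (x - b) (x + b).

Definition fourier (g : R -> R) (x : R) : C :=
  @RInt_gen C_R_CompleteNormedModule
    (fun u : R => (RtoC (g u) * Cexp (0, (- (2 * PI * x * u))%R))%C)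
    (Rbar_locally m_infty) (Rbar_locally p_infty).

Definition MZ_integrand (lG : C -> C) (f : R -> C) (G t x : R) : C :=
  (HardyZ lG (t + x)%R * f (x / G)%R)%C.

Definition MZ (lG : C -> C) (f : R -> C) (G t : R) : C :=
  @RInt_gen C_R_CompleteNormedModule (MZ_integrand lG f G t)
    (Rbar_locally m_infty) (Rbar_locally p_infty).

Module ZetaFacts.

Lemma Cmod_Cexp (z : C) : Cmod (Cexp z) = exp (Re z).
Proof.
unfold Cmod, Cexp; simpl fst; simpl snd.
replace (_ + _) with (Rsqr (exp (Re z))).
- rewrite sqrt_Rsqr; [reflexivity | left; apply exp_pos].
- generalize (sin2_cos2 (Im z)); unfold Rsqr; intros H.
  transitivity (exp (Re z) * exp (Re z) * 1); [ring | rewrite <- H; ring].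
Qed.

Lemma Cexp_plus (z w : C) : Cexp (z + w) = (Cexp z * Cexp w)%C.
Proof.
destruct z as [a b], w as [c d]; unfold Cexp, Cplus, Cmult; simpl.
rewrite exp_plus, cos_plus, sin_plus; f_equal; ring.
Qed.

Lemma Rcpow_plus (x : R) (s w : C) : Rcpow x (s + w) = (Rcpow x s * Rcpow x w)%C.
Proof. unfold Rcpow; rewrite <- Cexp_plus; f_equal; ring. Qed.

Lemma Rcpow_1 (x : R) : 0 < x -> Rcpow x 1 = RtoC x.
Proof.
intros Hx; unfold Rcpow, Cexp, RtoC, Cmult; simpl.
replace (1 * ln x - 0 * 0) with (ln x) by ring.
replace (1 * 0 + 0 * ln x) with 0 by ring.
rewrite exp_ln, cos_0, sin_0; trivial; f_equal; ring.
Qed.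

Lemma Cmod_Rcpow (x : R) (s : C) : Cmod (Rcpow x s) = exp (Re s * ln x).
Proof.
unfold Rcpow; rewrite Cmod_Cexp; f_equal; destruct s; simpl; ring.
Qed.

Definition cderiv (f : R -> C) (x : R) (l : C) : Prop :=
  is_derive (fun y => Re (f y)) x (Re l) /\ is_derive (fun y => Im (f y)) x (Im l).

Lemma cderiv_const c x : cderiv (fun _ => c) x 0.
Proof. split; apply is_derive_Reals, derivable_pt_lim_const. Qed.

Lemma cderiv_plus f g x a b :
  cderiv f x a -> cderiv g x b -> cderiv (fun y => f y + g y)%C x (a + b)%C.
Proof.
intros [H1 H2] [H3 H4]; split; simpl.
- apply (is_derive_plus (fun y => Re (f y)) (fun y => Re (g y))); assumption.
- apply (is_derive_plus (fun y => Im (f y)) (fun y => Im (g y))); assumption.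
Qed.

Lemma cderiv_mult f g x a b :
  cderiv f x a -> cderiv g x b -> cderiv (fun y => f y * g y)%C x (a * g x + f x * b)%C.
Proof.
intros [H1 H2] [H3 H4]; split; apply is_derive_Reals in H1, H2, H3, H4;
apply is_derive_Reals; simpl.
- replace (_ + _) with ((Re a * Re (g x) + Re (f x) * Re b)
    - (Im a * Im (g x) + Im (f x) * Im b)) by (unfold Re, Im; ring).
  apply (derivable_pt_lim_minus (fun y => Re (f y) * Re (g y)) (fun y => Im (f y) * Im (g y)));
  apply (derivable_pt_lim_mult (fun y => _ (f y)) (fun y => _ (g y))); assumption.
- replace (_ + _) with ((Re a * Im (g x) + Re (f x) * Im b)
    + (Im a * Re (g x) + Im (f x) * Re b)) by (unfold Re, Im; ring).
  apply (derivable_pt_lim_plus (fun y => Re (f y) * Im (g y)) (fun y => Im (f y) * Re (g y)));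
  apply (derivable_pt_lim_mult (fun y => _ (f y)) (fun y => _ (g y))); assumption.
Qed.

Lemma cderiv_RtoC f x a : is_derive f x a -> cderiv (fun y => RtoC (f y)) x (RtoC a).
Proof.
intros H; split; simpl; [exact H | apply is_derive_Reals, derivable_pt_lim_const].
Qed.

Lemma cderiv_eq f x a b : cderiv f x a -> a = b -> cderiv f x b.
Proof. now intros H <-. Qed.

Lemma cderiv_Cexp (w : C) (y : R) :
  cderiv (fun y => Cexp (w * RtoC y)) y (w * Cexp (w * RtoC y))%C.
Proof.
destruct w as [a b]; split; unfold Cexp, Cmult, Re, Im, RtoC; cbn [fst snd]; auto_derive; trivial; unfold Rminus; (ring).
Qed.

Lemma cderiv_Rcpow (w : C) (x : R) :
  0 < x -> cderiv (fun y => Rcpow y w) x (w * Rcpow x w / RtoC x)%C.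
Proof.
intros Hx; unfold Rcpow.
assert (Hx' : x <> 0) by lra.
unfold Cdiv; rewrite <- RtoC_inv by exact Hx'.
destruct w as [a b]; split; unfold Cexp, Cmult, Re, Im, RtoC; cbn [fst snd]; auto_derive; trivial; unfold Rminus; first [tauto | exact Hx' | field; exact Hx'].
Qed.

Lemma incr_le (u v u' v' : R -> R) (a b : R) :
  a <= b ->
  (forall x, a <= x <= b -> is_derive u x (u' x)) ->
  (forall x, a <= x <= b -> is_derive v x (v' x)) ->
  (forall x, a <= x <= b -> u' x <= v' x) ->
  u b - u a <= v b - v a.
Proof.
intros Hab Hu Hv Hl.
assert (Hd : forall x, a <= x <= b -> is_derive (fun y => v y - u y) x (v' x - u' x)).
{ intros x Hx; apply (is_derive_minus v u); auto. }
destruct (MVT_gen (fun y => v y - u y) a b (fun x => v' x - u' x)) as [c [Hc He]].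
- intros x Hx; apply Hd; rewrite Rmin_left, Rmax_right in Hx; lra.
- intros x Hx; apply continuity_pt_filterlim.
  apply (ex_derive_continuous (fun y => v y - u y)).
  exists (v' x - u' x); apply Hd; rewrite Rmin_left, Rmax_right in Hx; lra.
- rewrite Rmin_left, Rmax_right in Hc by lra.
  generalize (Hl c Hc); intros Hl'.
  assert (0 <= (v' c - u' c) * (b - a)) by (apply Rmult_le_pos; lra).
  lra.
Qed.

Lemma Cmod_le_2 (z : C) (m : R) : Rabs (Re z) <= m -> Rabs (Im z) <= m -> Cmod z <= 2 * m.
Proof.
intros H1 H2.
replace z with (RtoC (Re z) + Ci * RtoC (Im z))%C.
- eapply Rle_trans; [apply Cmod_triangle|].
  rewrite Cmod_mult, !Cmod_R.
  replace (Cmod Ci) with 1; [lra|].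
  unfold Cmod; simpl; symmetry; replace (_ + _) with 1 by ring; apply sqrt_1.
- destruct z; unfold RtoC, Ci, Cplus, Cmult; simpl; f_equal; ring.
Qed.

Lemma cincr_le (f f' : R -> C) (v v' : R -> R) (a b : R) :
  a <= b ->
  (forall x, a <= x <= b -> cderiv f x (f' x)) ->
  (forall x, a <= x <= b -> is_derive v x (v' x)) ->
  (forall x, a <= x <= b -> Cmod (f' x) <= v' x) ->
  Cmod (f b - f a) <= 2 * (v b - v a).
Proof.
intros Hab Hf Hv Hl.
assert (Hre : forall z, Rabs (Re z) <= Cmod z) by apply re_le_Cmod.
assert (Him : forall z, Rabs (Im z) <= Cmod z).
{ intros z; eapply Rle_trans; [apply Rmax_r | apply Rmax_Cmod]. }
apply Cmod_le_2; apply Rabs_le; simpl; split.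
- enough (- (Re (f b)) - - (Re (f a)) <= v b - v a) by (unfold Re in *; lra).
  apply (incr_le (fun x => - Re (f x)) v (fun x => - Re (f' x)) v'); trivial.
  + intros x Hx; apply (is_derive_opp (fun y => Re (f y))), Hf, Hx.
  + intros x Hx; generalize (Hl x Hx) (Hre (f' x)) (Rle_abs (- Re (f' x))).
    rewrite Rabs_Ropp; lra.
- apply (incr_le (fun x => Re (f x)) v (fun x => Re (f' x)) v'); trivial.
  + intros x Hx; apply Hf, Hx.
  + intros x Hx; generalize (Hl x Hx) (Hre (f' x)) (Rle_abs (Re (f' x))); lra.
- enough (- (Im (f b)) - - (Im (f a)) <= v b - v a) by (unfold Im in *; lra).
  apply (incr_le (fun x => - Im (f x)) v (fun x => - Im (f' x)) v'); trivial.
  + intros x Hx; apply (is_derive_opp (fun y => Im (f y))), Hf, Hx.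
  + intros x Hx; generalize (Hl x Hx) (Him (f' x)) (Rle_abs (- Im (f' x))).
    rewrite Rabs_Ropp; lra.
- apply (incr_le (fun x => Im (f x)) v (fun x => Im (f' x)) v'); trivial.
  + intros x Hx; apply Hf, Hx.
  + intros x Hx; generalize (Hl x Hx) (Him (f' x)) (Rle_abs (Im (f' x))); lra.
Qed.

Lemma Cexp_0 : Cexp 0 = 1.
Proof. unfold Cexp; simpl; rewrite exp_0, cos_0, sin_0; unfold RtoC; f_equal; ring. Qed.

Lemma exp_le x y : x <= y -> exp x <= exp y.
Proof. intros [H| ->]; [left; apply exp_increasing; trivial | right; trivial]. Qed.

Lemma Cexp_bound1 (w : C) : Cmod (Cexp w - 1) <= 2 * (Cmod w * exp (Cmod w)).
Proof.
replace (Cexp w - 1)%C with (Cexp (w * RtoC 1) - Cexp (w * RtoC 0))%C.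
2:{ rewrite Cmult_1_r, Cmult_0_r, Cexp_0; trivial. }
eapply Rle_trans.
- apply (cincr_le (fun y => Cexp (w * RtoC y)) (fun y => w * Cexp (w * RtoC y))%C
   (fun y => Cmod w * exp (Cmod w) * y) (fun _ => Cmod w * exp (Cmod w)) 0 1); [lra|..].
  + intros; apply cderiv_Cexp.
  + intros; auto_derive; trivial; ring.
  + intros x Hx; rewrite Cmod_mult, Cmod_Cexp.
    apply Rmult_le_compat_l; [apply Cmod_ge_0|]. apply exp_le.
    eapply Rle_trans; [apply Rle_abs | eapply Rle_trans; [apply re_le_Cmod|]].
    rewrite Cmod_mult, Cmod_R, Rabs_pos_eq by lra.
    generalize (Cmod_ge_0 w); intros; nra.
- lra.
Qed.

Lemma Cexp_bound2 (w : C) : Cmod (Cexp w - 1 - w) <= 4 * (Cmod w ^ 2 * exp (Cmod w)).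
Proof.
set (f := fun y => (Cexp (w * RtoC y) + (-1 - w * RtoC y))%C).
replace (Cexp w - 1 - w)%C with (f 1 - f 0)%C.
2:{ unfold f; rewrite !Cmult_1_r, !Cmult_0_r, Cexp_0; ring. }
generalize (Cmod_ge_0 w) (exp_pos (Cmod w)); intros Hw He.
eapply Rle_trans.
- apply (cincr_le f (fun y => w * Cexp (w * RtoC y) + (- w))%C
   (fun y => 2 * (Cmod w ^ 2 * exp (Cmod w)) * y)
   (fun _ => 2 * (Cmod w ^ 2 * exp (Cmod w))) 0 1); [lra|..].
  + intros; apply cderiv_plus; [apply cderiv_Cexp|].
    destruct w as [a b]; split; unfold RtoC; simpl; auto_derive; trivial; ring.
  + intros; auto_derive; trivial; ring.
  + intros x Hx.
    replace (w * Cexp (w * x) + - w)%C with (w * (Cexp (w * x) - 1))%C by ring.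
    rewrite Cmod_mult.
    replace (2 * (Cmod w ^ 2 * exp (Cmod w)))
      with (Cmod w * (2 * (Cmod w * exp (Cmod w)))) by ring.
    apply Rmult_le_compat_l; [trivial|].
    eapply Rle_trans; [apply Cexp_bound1|].
    assert (Cmod (w * x) <= Cmod w).
    { rewrite Cmod_mult, Cmod_R, Rabs_pos_eq by lra. nra. }
    apply Rmult_le_compat_l; [lra|].
    apply Rmult_le_compat; trivial; [apply Cmod_ge_0 | left; apply exp_pos | apply exp_le; trivial].
- lra.
Qed.

Definition phis (n : R) (s : C) (x : R) : C :=
  (RtoC (x - n) * Rcpow x (- s) + / (s - 1) * Rcpow x (1 - s))%C.
Definition dphis (n : R) (s : C) (x : R) : C :=
  (RtoC (- ln x) * phis n s x + - / ((s - 1) * (s - 1)) * Rcpow x (1 - s))%C.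

Lemma RtoC_neq (x : R) : x <> 0 -> RtoC x <> 0%C.
Proof. intros H E; apply H; now apply RtoC_inj in E. Qed.

Lemma Rcpow_1m (x : R) (s : C) : 0 < x -> Rcpow x (1 - s) = (RtoC x * Rcpow x (- s))%C.
Proof. intros Hx; unfold Cminus; rewrite Rcpow_plus, Rcpow_1; trivial. Qed.

Lemma Cminus_neq (s : C) : s <> 1 -> (s - 1)%C <> 0.
Proof. intros H E; apply H. replace s with (s - 1 + 1)%C by ring. rewrite E; ring. Qed.

Lemma phis_deriv (n : R) (s : C) (x : R) : 0 < x -> s <> 1 ->
  cderiv (phis n s) x (- s * (RtoC (x - n) * Rcpow x (- s) / RtoC x))%C.
Proof.
intros Hx Hs; unfold phis.
eapply cderiv_eq.
- apply cderiv_plus; apply cderiv_mult.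
  + apply (cderiv_RtoC (fun x => x - n) x 1); auto_derive; trivial; ring.
  + apply cderiv_Rcpow; trivial.
  + apply cderiv_const.
  + apply cderiv_Rcpow; trivial.
- rewrite Rcpow_1m by trivial.
  generalize (Rcpow x (- s)); intros E; rewrite RtoC_minus.
  field; split; first [apply Cminus_neq; exact Hs | apply RtoC_neq; lra].
Qed.

Lemma dphis_deriv (n : R) (s : C) (x : R) : 0 < x -> s <> 1 ->
  cderiv (dphis n s) x
   ((s * RtoC (ln x) - 1) * (RtoC (x - n) * Rcpow x (- s) / RtoC x))%C.
Proof.
intros Hx Hs; unfold dphis.
eapply cderiv_eq.
- apply cderiv_plus; apply cderiv_mult.
  + apply (cderiv_RtoC (fun x => - ln x) x (- / x)); auto_derive; trivial; ring.
  + apply phis_deriv; trivial.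
  + apply cderiv_const.
  + apply cderiv_Rcpow; trivial.
- unfold phis; rewrite Rcpow_1m by trivial.
  generalize (Rcpow x (- s)); intros E.
  rewrite !RtoC_opp, RtoC_inv, RtoC_minus by lra.
  field; split; first [apply Cminus_neq; exact Hs | apply RtoC_neq; lra].
Qed.

Definition dzeta_seq (s : C) (N : nat) : C :=
  (sum_n (fun n => RtoC (- ln (INR (S n))) * Rcpow (INR (S n)) (- s))%C N
   + (RtoC (- ln (INR (S N))) * (/ (s - 1) * Rcpow (INR (S N)) (1 - s))
      + - / ((s - 1) * (s - 1)) * Rcpow (INR (S N)) (1 - s)))%C.

Lemma zeta_seq_incr (s : C) (N : nat) :
  (zeta_seq s (S N) - zeta_seq s N)%C
  = (phis (INR (S N)) s (INR (S (S N))) - phis (INR (S N)) s (INR (S N)))%C.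
Proof.
unfold zeta_seq, phis; rewrite sum_Sn.
change (@plus _ ?a ?b) with (a + b)%C.
replace (INR (S (S N)) - INR (S N)) with 1 by (rewrite (S_INR (S N)); ring).
replace (INR (S N) - INR (S N)) with 0 by ring.
unfold Cdiv; ring.
Qed.

Lemma dzeta_seq_incr (s : C) (N : nat) :
  (dzeta_seq s (S N) - dzeta_seq s N)%C
  = (dphis (INR (S N)) s (INR (S (S N))) - dphis (INR (S N)) s (INR (S N)))%C.
Proof.
unfold dzeta_seq, dphis, phis; rewrite sum_Sn.
change (@plus _ ?a ?b) with (a + b)%C.
replace (INR (S (S N)) - INR (S N)) with 1 by (rewrite (S_INR (S N)); ring).
replace (INR (S N) - INR (S N)) with 0 by ring.
ring.
Qed.

Definition Vt (tau x : R) := - exp (- tau * ln x) / tau.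

Lemma Vt_deriv tau c x : 0 < tau -> 0 < x ->
  is_derive (fun x => c * Vt tau x) x (c * exp (- (1 + tau) * ln x)).
Proof.
intros Ht Hx; unfold Vt; auto_derive; trivial.
replace (- (1 + tau) * ln x) with (- tau * ln x + - ln x) by ring.
rewrite exp_plus, exp_Ropp, exp_ln by trivial. field; lra.
Qed.

Lemma telescope (u : nat -> C) (tau c : R) : 0 < tau -> 0 <= c ->
  (forall N, Cmod (u (S N) - u N) <= 2 * (c * Vt tau (INR (S (S N))) - c * Vt tau (INR (S N)))) ->
  forall N k, Cmod (u (N + k)%nat - u N) <= 2 * c / tau * exp (- tau * ln (INR (S N))).
Proof.
intros Ht Hc H N k.
assert (Hk : Cmod (u (N + k)%nat - u N)
  <= 2 * (c * Vt tau (INR (S (N + k))) - c * Vt tau (INR (S N)))).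
{ induction k as [|k IH].
  - rewrite Nat.add_0_r; replace (u N - u N)%C with (RtoC 0) by ring.
    rewrite Cmod_0; lra.
  - rewrite Nat.add_succ_r.
    replace (u (S (N + k)) - u N)%C
      with ((u (S (N + k)) - u (N + k)%nat) + (u (N + k)%nat - u N))%C by ring.
    eapply Rle_trans; [apply Cmod_triangle|].
    generalize (H (N + k)%nat); lra. }
eapply Rle_trans; [exact Hk|]. unfold Vt.
generalize (exp_pos (- tau * ln (INR (S (N + k))))).
intros He.
assert (0 <= c * (exp (- tau * ln (INR (S (N + k)))) / tau)).
{ apply Rmult_le_pos; trivial. left; apply Rdiv_lt_0_compat; trivial. }
unfold Rdiv in *; lra.
Qed.

Definition is_clim (u : nat -> C) (l : C) :=
  forall eps : posreal, exists N, forall n, (N <= n)%nat -> Cmod (u n - l) < eps.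

Lemma is_clim_seq u l : is_clim u l <->
  is_lim_seq (fun n => Re (u n)) (Re l) /\ is_lim_seq (fun n => Im (u n)) (Im l).
Proof.
split.
- intros H; split; apply is_lim_seq_spec; intros eps; destruct (H eps) as [N HN];
  exists N; intros n Hn; eapply Rle_lt_trans; [|apply (HN n Hn)| |apply (HN n Hn)].
  + apply (re_le_Cmod (u n - l)).
  + eapply Rle_trans; [|apply Rmax_Cmod]; apply (Rmax_r _ (Rabs (Im (u n - l)))).
- intros [H1 H2] eps; apply is_lim_seq_spec in H1, H2.
  assert (He : 0 < eps / 4) by (generalize (cond_pos eps); lra).
  destruct (H1 (mkposreal _ He)) as [N1 HN1]; destruct (H2 (mkposreal _ He)) as [N2 HN2].
  exists (max N1 N2); intros n Hn.
  eapply Rle_lt_trans; [apply (Cmod_le_2 _ (eps / 4))|].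
  + left; apply (HN1 n); lia.
  + left; apply (HN2 n); lia.
  + generalize (cond_pos eps); lra.
Qed.

Lemma is_clim_minus u v a b : is_clim u a -> is_clim v b ->
  is_clim (fun n => u n - v n)%C (a - b)%C.
Proof.
rewrite !is_clim_seq; intros [H1 H2] [H3 H4]; split; simpl;
apply (is_lim_seq_minus' (fun n => _ (u n)) (fun n => _ (v n))); assumption.
Qed.

Lemma is_clim_scal u a c : is_clim u a -> is_clim (fun n => c * u n)%C (c * a)%C.
Proof.
rewrite !is_clim_seq; intros [H1 H2]; split; simpl.
- apply (is_lim_seq_minus' (fun n => fst c * Re (u n)) (fun n => snd c * Im (u n)));
  [apply (is_lim_seq_scal_l _ (fst c) (Finite (Re a)))
  |apply (is_lim_seq_scal_l _ (snd c) (Finite (Im a)))]; assumption.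
- apply (is_lim_seq_plus' (fun n => fst c * Im (u n)) (fun n => snd c * Re (u n)));
  [apply (is_lim_seq_scal_l _ (fst c) (Finite (Im a)))
  |apply (is_lim_seq_scal_l _ (snd c) (Finite (Re a)))]; assumption.
Qed.

Lemma is_clim_bound u l M : is_clim u l -> (forall n, Cmod (u n) <= M) -> Cmod l <= M.
Proof.
intros H HM; apply Rle_plus_epsilon; intros eps He.
destruct (H (mkposreal _ He)) as [N HN]; generalize (HN N (le_n N)) (HM N); simpl; intros H1 H2.
replace l with (u N + - (u N - l))%C by ring.
eapply Rle_trans; [apply Cmod_triangle|]; rewrite Cmod_opp; lra.
Qed.

Lemma exp_ln_small tau c : 0 < tau -> 0 <= c -> forall eps : posreal,
  exists N, forall n, (N <= n)%nat -> c * exp (- tau * ln (INR (S n))) < eps.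
Proof.
intros Ht Hc eps.
set (d := eps / (c + 1)).
assert (Hd : 0 < d) by (apply Rdiv_lt_0_compat; [apply cond_pos | lra]).
destruct (INR_unbounded (exp (- ln d / tau))) as [N HN].
exists N; intros n Hn.
assert (HX : exp (- ln d / tau) < INR (S n)).
{ eapply Rlt_le_trans; [exact HN | apply le_INR; lia]. }
assert (HL : - ln d / tau < ln (INR (S n))).
{ rewrite <- (ln_exp (- ln d / tau)); apply ln_increasing; trivial; apply exp_pos. }
assert (HE : exp (- tau * ln (INR (S n))) < d).
{ rewrite <- (exp_ln d) at 1 by trivial. apply exp_increasing.
  apply (Rmult_lt_compat_l tau) in HL; trivial.
  replace (tau * (- ln d / tau)) with (- ln d) in HL by (field; lra). lra. }
apply Rle_lt_trans with (c * d); [apply Rmult_le_compat_l; lra|].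
replace (pos eps) with ((c + 1) * d) by (unfold d; field; lra). lra.
Qed.

Lemma cauchy_clim u tau c : 0 < tau -> 0 <= c ->
  (forall N k, Cmod (u (N + k)%nat - u N) <= c * exp (- tau * ln (INR (S N)))) ->
  is_clim u (real (Lim_seq (fun n => Re (u n))), real (Lim_seq (fun n => Im (u n)))).
Proof.
intros Ht Hc H.
assert (HC : forall eps : posreal, exists N, forall n m, (N <= n)%nat -> (N <= m)%nat ->
  Cmod (u n - u m) < eps).
{ intros eps.
  assert (He : 0 < eps / 2) by (generalize (cond_pos eps); lra).
  destruct (exp_ln_small tau c Ht Hc (mkposreal _ He)) as [N HN].
  exists N; intros n m Hn Hm.
  replace (u n - u m)%C with ((u n - u N) + - (u m - u N))%C by ring.
  eapply Rle_lt_trans; [apply Cmod_triangle|]; rewrite Cmod_opp.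
  generalize (H N (n - N)%nat) (H N (m - N)%nat) (HN N (le_n N)); simpl.
  replace (N + (n - N))%nat with n by lia; replace (N + (m - N))%nat with m by lia.
  intros; lra. }
apply is_clim_seq; split; apply Lim_seq_correct', ex_lim_seq_cauchy_corr;
intros eps; destruct (HC eps) as [N HN]; exists N; intros n m Hn Hm;
eapply Rle_lt_trans; [|apply (HN n m Hn Hm)| |apply (HN n m Hn Hm)].
- apply (re_le_Cmod (u n - u m)).
- eapply Rle_trans; [|apply Rmax_Cmod]; apply (Rmax_r _ (Rabs (Im (u n - u m)))).
Qed.

Definition Kc (s : C) := 4 * (Cmod s + 1) * (64 / Re s ^ 2 + 1).

Lemma Kc_bound (s : C) (l B : R) : 0 < Re s -> 0 <= l ->
  B <= 4 * (Cmod s + 1) * (l ^ 2 + 1) ->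
  exp (- (1 + Re s) * l) * (exp (Re s / 4 * l) * B)
  <= Kc s * exp (- (1 + Re s / 2) * l).
Proof.
intros Hs Hl HB; unfold Kc.
set (g := Re s) in *.
assert (Hm : 0 <= Cmod s) by apply Cmod_ge_0.
replace (- (1 + g) * l) with (- (1 + g / 2) * l + - (g / 4 * l) + - (g / 4 * l)) by field.
rewrite 2!exp_plus.
set (y := g / 4 * l) in *.
assert (Hy : 0 <= y) by (unfold y; apply Rmult_le_pos; lra).
assert (Hyy : exp (- y) * exp y = 1) by (rewrite <- exp_plus, Rplus_opp_l; apply exp_0).
assert (Hp : 0 < exp (- y)) by apply exp_pos.
assert (Hy2 : y ^ 2 <= 4 * exp y).
{ replace y with (y / 2 + y / 2) at 2 by field. rewrite exp_plus.
  generalize (exp_ineq1_le (y / 2)); nra. }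
assert (Hl2 : exp (- y) * l ^ 2 <= 64 / g ^ 2).
{ replace (l ^ 2) with (16 / g ^ 2 * y ^ 2) by (unfold y; field; lra).
  assert (Hg : 0 < 16 / g ^ 2) by (apply Rdiv_lt_0_compat; [lra | apply pow_lt; trivial]).
  replace (64 / g ^ 2) with (16 / g ^ 2 * (4 * (exp (- y) * exp y))) by (rewrite Hyy; field; lra).
  rewrite <- Rmult_assoc, (Rmult_comm (exp (- y))), Rmult_assoc.
  apply Rmult_le_compat_l; [lra|].
  replace (4 * (exp (- y) * exp y)) with (exp (- y) * (4 * exp y)) by ring.
  apply Rmult_le_compat_l; lra. }
assert (Hp1 : exp (- y) <= 1) by (rewrite <- exp_0; apply exp_le; lra).
replace (exp (- (1 + g / 2) * l) * exp (- y) * exp (- y) * (exp y * B))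
  with ((exp (- y) * B) * exp (- (1 + g / 2) * l))
  by (transitivity (exp (- (1 + g / 2) * l) * exp (- y) * B * (exp (- y) * exp y));
      [rewrite Hyy|]; ring).
apply Rmult_le_compat_r; [left; apply exp_pos|].
apply Rle_trans with (exp (- y) * (4 * (Cmod s + 1) * (l ^ 2 + 1)));
  [apply Rmult_le_compat_l; lra|].
replace (exp (- y) * (4 * (Cmod s + 1) * (l ^ 2 + 1)))
  with (4 * (Cmod s + 1) * (exp (- y) * l ^ 2 + exp (- y))) by ring.
apply Rmult_le_compat_l; lra.
Qed.

Lemma Kc_pos (s : C) : 0 < Re s -> 0 < Kc s.
Proof.
intros Hs; unfold Kc.
assert (0 < 64 / Re s ^ 2) by (apply Rdiv_lt_0_compat; [lra | apply pow_lt; trivial]).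
generalize (Cmod_ge_0 s); intros; repeat apply Rmult_lt_0_compat; lra.
Qed.

Lemma Cmod_step (n x : R) (s : C) : 1 <= n -> n <= x <= n + 1 ->
  Cmod (RtoC (x - n) * Rcpow x (- s) / RtoC x) <= exp (- (1 + Re s) * ln x).
Proof.
intros Hn Hx.
rewrite Cmod_div, Cmod_mult, Cmod_Rcpow, !Cmod_R, !Rabs_pos_eq
 by (try apply RtoC_neq; lra).
replace (- (1 + Re s) * ln x) with (Re (- s) * ln x + - ln x) by (destruct s; simpl; ring).
rewrite exp_plus, exp_Ropp, exp_ln by lra.
unfold Rdiv; 
apply Rmult_le_compat_r; [left; apply Rinv_0_lt_compat; lra|].
generalize (exp_pos (Re (- s) * ln x)); nra.
Qed.

Lemma ln_ge_0 x : 1 <= x -> 0 <= ln x.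
Proof. intros H; rewrite <- ln_1; apply ln_le; lra. Qed.

Lemma step_bound (f : R -> C) (q : R -> C) (s : C) (c : R) (N : nat) :
  0 < Re s -> 0 <= c ->
  (forall x, 0 < x ->
    cderiv f x (q x * (RtoC (x - INR (S N)) * Rcpow x (- s) / RtoC x))%C) ->
  (forall x, 1 <= x -> Cmod (q x)
     <= c * (exp (Re s / 4 * ln x) * (4 * (Cmod s + 1) * (ln x ^ 2 + 1)))) ->
  Cmod (f (INR (S (S N))) - f (INR (S N)))
  <= 2 * (c * Kc s * Vt (Re s / 2) (INR (S (S N))) - c * Kc s * Vt (Re s / 2) (INR (S N))).
Proof.
intros Hs Hc Hf Hq.
assert (HN : 1 <= INR (S N)) by (rewrite S_INR; generalize (pos_INR N); lra).
rewrite (S_INR (S N)).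
apply (cincr_le f (fun x => q x * (RtoC (x - INR (S N)) * Rcpow x (- s) / RtoC x))%C
  (fun x => c * Kc s * Vt (Re s / 2) x)
  (fun x => c * Kc s * exp (- (1 + Re s / 2) * ln x))); [lra|..].
- intros x Hx; apply Hf; lra.
- intros x Hx; apply Vt_deriv; lra.
- intros x Hx; rewrite Cmod_mult, Rmult_assoc.
  eapply Rle_trans.
  + apply Rmult_le_compat; try apply Cmod_ge_0.
    * apply Hq; lra.
    * apply Cmod_step; lra.
  + rewrite Rmult_assoc; apply Rmult_le_compat_l; trivial.
    rewrite Rmult_comm.
    apply Kc_bound; [trivial | apply ln_ge_0; lra | lra].
Qed.

Lemma exp_ge_1 x : 0 <= x -> 1 <= exp x.
Proof. intros; rewrite <- exp_0; apply exp_le; trivial. Qed.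

Lemma zeta_seq_cauchy (s : C) : 0 < Re s -> s <> 1 -> forall N k,
  Cmod (zeta_seq s (N + k)%nat - zeta_seq s N)
  <= 2 * (1 * Kc s) / (Re s / 2) * exp (- (Re s / 2) * ln (INR (S N))).
Proof.
intros Hs H1; generalize (Kc_pos s Hs); intros HK; apply telescope; [lra | lra |].
intros N; rewrite zeta_seq_incr.
apply (step_bound (phis (INR (S N)) s) (fun _ => - s)%C); trivial; [lra|..].
- intros; apply phis_deriv; trivial.
- intros x Hx; rewrite Cmod_opp.
  generalize (ln_ge_0 x Hx); intros Hl.
  assert (1 <= exp (Re s / 4 * ln x)) by (apply exp_ge_1, Rmult_le_pos; lra).
  generalize (Cmod_ge_0 s) (pow2_ge_0 (ln x)); intros.
  assert (Cmod s <= 4 * (Cmod s + 1) * (ln x ^ 2 + 1)) by nra.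
  nra.
Qed.

Lemma dzeta_seq_cauchy (s : C) : 0 < Re s -> s <> 1 -> forall N k,
  Cmod (dzeta_seq s (N + k)%nat - dzeta_seq s N)
  <= 2 * (1 * Kc s) / (Re s / 2) * exp (- (Re s / 2) * ln (INR (S N))).
Proof.
intros Hs H1; generalize (Kc_pos s Hs); intros HK; apply telescope; [lra | lra |].
intros N; rewrite dzeta_seq_incr.
apply (step_bound (dphis (INR (S N)) s) (fun x => s * RtoC (ln x) - 1)%C); trivial; [lra|..].
- intros; apply dphis_deriv; trivial.
- intros x Hx.
  generalize (ln_ge_0 x Hx); intros Hl.
  assert (1 <= exp (Re s / 4 * ln x)) by (apply exp_ge_1, Rmult_le_pos; lra).
  generalize (Cmod_ge_0 s) (pow2_ge_0 (ln x)); intros.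
  assert (Cmod (s * RtoC (ln x) - 1) <= Cmod s * ln x + 1).
  { unfold Cminus; eapply Rle_trans; [apply Cmod_triangle|].
    rewrite Cmod_opp, Cmod_1, Cmod_mult, Cmod_R, Rabs_pos_eq by trivial. lra. }
  assert (ln x <= ln x ^ 2 + 1) by nra.
  assert (Cmod s * ln x <= Cmod s * (ln x ^ 2 + 1)) by (apply Rmult_le_compat_l; trivial).
  assert (Cmod s * ln x + 1 <= 4 * (Cmod s + 1) * (ln x ^ 2 + 1)) by nra.
  assert (0 <= Cmod s * ln x) by (apply Rmult_le_pos; trivial).
  apply Rle_trans with (Cmod s * ln x + 1); trivial.
  generalize dependent (4 * (Cmod s + 1) * (ln x ^ 2 + 1)); intros Y HY.
  generalize dependent (exp (Re s / 4 * ln x)); intros X HX.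
  assert (1 * Y <= X * Y) by (apply Rmult_le_compat_r; lra). lra.
Qed.

Definition rem_seq (s h : C) (N : nat) : C :=
  (zeta_seq (s + h) N - zeta_seq s N - h * dzeta_seq s N)%C.

Lemma rem_seq_cauchy (s h : C) : 0 < Re s -> s <> 1 -> (s + h)%C <> 1 -> Cmod h <= Re s / 4 ->
  forall N k, Cmod (rem_seq s h (N + k)%nat - rem_seq s h N)
  <= 2 * (Cmod h ^ 2 * Kc s) / (Re s / 2) * exp (- (Re s / 2) * ln (INR (S N))).
Proof.
intros Hs H1 H2 Hh; generalize (Kc_pos s Hs); intros HK; apply telescope; [lra | |].
{ apply Rmult_le_pos; [apply pow2_ge_0 | lra]. }
intros N.
set (n := INR (S N)).
set (f := fun x => (phis n (s + h) x + - (1) * phis n s x + - h * dphis n s x)%C).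
replace (rem_seq s h (S N) - rem_seq s h N)%C with (f (INR (S (S N))) - f (INR (S N)))%C.
2:{ unfold rem_seq, f.
    replace (zeta_seq (s + h) (S N)) with
     (zeta_seq (s + h) N + (zeta_seq (s + h) (S N) - zeta_seq (s + h) N))%C by ring.
    replace (zeta_seq s (S N)) with
     (zeta_seq s N + (zeta_seq s (S N) - zeta_seq s N))%C by ring.
    replace (dzeta_seq s (S N)) with
     (dzeta_seq s N + (dzeta_seq s (S N) - dzeta_seq s N))%C by ring.
    rewrite !zeta_seq_incr, dzeta_seq_incr; fold n; ring. }
apply (step_bound f (fun x => - s * (Cexp (- h * RtoC (ln x)) - 1 - (- h * RtoC (ln x)))
   - h * (Cexp (- h * RtoC (ln x)) - 1))%C); trivial; [apply pow2_ge_0|..].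
- intros x Hx; unfold f. fold n.
  eapply cderiv_eq.
  + apply cderiv_plus; [apply cderiv_plus|].
    * apply phis_deriv; trivial.
    * apply cderiv_mult; [apply cderiv_const | apply phis_deriv; trivial].
    * apply cderiv_mult; [apply cderiv_const | apply dphis_deriv; trivial].
  + replace (Rcpow x (- (s + h))) with (Rcpow x (- s) * Cexp (- h * RtoC (ln x)))%C.
    2:{ replace (- (s + h))%C with (- s + - h)%C by ring. now rewrite Rcpow_plus. }
    unfold Cdiv; ring.
- intros x Hx.
  generalize (ln_ge_0 x Hx); intros Hl.
  set (w := (- h * RtoC (ln x))%C).
  assert (Hw : Cmod w = Cmod h * ln x).
  { unfold w; rewrite Cmod_mult, Cmod_opp, Cmod_R, Rabs_pos_eq; trivial. }
  generalize (Cmod_ge_0 s) (Cmod_ge_0 h) (pow2_ge_0 (ln x)); intros Hs0 Hh0 Hl2.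
  assert (He : exp (Cmod w) <= exp (Re s / 4 * ln x)).
  { apply exp_le; rewrite Hw; apply Rmult_le_compat_r; trivial. }
  assert (B1 := Cexp_bound1 w). assert (B2 := Cexp_bound2 w).
  generalize dependent (exp (Re s / 4 * ln x)); intros X HX.
  assert (Hp := exp_pos (Cmod w)).
  unfold Cminus at 1; eapply Rle_trans; [apply Cmod_triangle|].
  rewrite Cmod_opp, !Cmod_mult, Cmod_opp.
  assert (B1' : Cmod (Cexp w - 1) <= 2 * (Cmod h * ln x * X)).
  { eapply Rle_trans; [exact B1|]. rewrite Hw at 1. apply Rmult_le_compat_l; [lra|].
    apply Rmult_le_compat_l; trivial. apply Rmult_le_pos; trivial. }
  assert (B2' : Cmod (Cexp w - 1 - w) <= 4 * ((Cmod h * ln x) ^ 2 * X)).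
  { eapply Rle_trans; [exact B2|]. rewrite Hw at 1. apply Rmult_le_compat_l; [lra|].
    apply Rmult_le_compat_l; trivial. apply pow2_ge_0. }
  apply Rle_trans with (Cmod s * (4 * ((Cmod h * ln x) ^ 2 * X)) + Cmod h * (2 * (Cmod h * ln x * X))).
  { apply Rplus_le_compat; apply Rmult_le_compat_l; trivial. }
  replace (Cmod s * (4 * ((Cmod h * ln x) ^ 2 * X)) + Cmod h * (2 * (Cmod h * ln x * X)))
   with (Cmod h ^ 2 * (X * (4 * Cmod s * ln x ^ 2 + 2 * ln x))) by ring.
  apply Rmult_le_compat_l; [apply pow2_ge_0|].
  apply Rmult_le_compat_l; [lra|]. nra.
Qed.

Lemma zeta_lim (s : C) : 0 < Re s -> s <> 1 -> is_clim (zeta_seq s) (zeta s).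
Proof.
intros Hs H1; eapply cauchy_clim; [| |apply zeta_seq_cauchy; trivial]; [lra|].
generalize (Kc_pos s Hs); intros; apply Rmult_le_pos; [lra | left; apply Rinv_0_lt_compat; lra].
Qed.

Lemma rem_seq_0 (s h : C) : s <> 1 -> Cmod h <= Cmod (s - 1) / 2 ->
  Cmod (rem_seq s h 0) <= 2 / Cmod (s - 1) ^ 3 * Cmod h ^ 2.
Proof.
intros H1 Hh.
assert (Hs := Cminus_neq s H1); assert (Hp := proj1 (Cmod_gt_0 _) Hs).
assert (Hq : Cmod (s - 1) / 2 <= Cmod (s + h - 1)).
{ assert (Cmod (s - 1) <= Cmod (s + h - 1) + Cmod h); [|lra].
  rewrite <- (Cmod_opp h).
  replace (s - 1)%C with ((s + h - 1) + - h)%C at 1 by ring. apply Cmod_triangle. }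
assert (Hs' : (s + h - 1)%C <> 0) by (apply Cmod_gt_0; lra).
assert (HR : forall w, Rcpow (INR 1) w = 1).
{ intros w; unfold Rcpow; simpl INR; rewrite ln_1, Cmult_0_r; apply Cexp_0. }
unfold rem_seq, zeta_seq, dzeta_seq; rewrite !sum_O, !HR; simpl INR; rewrite ln_1, Ropp_0.
replace (_ - _)%C with (h * h / ((s - 1) * (s - 1) * (s + h - 1)))%C by (field; split; trivial).
rewrite Cmod_div, !Cmod_mult by (repeat apply Cmult_neq_0; trivial).
set (p := Cmod (s - 1)) in *; set (q := Cmod (s + h - 1)) in *; set (k := Cmod h).
replace (2 / p ^ 3 * k ^ 2) with (k * k * / (p * p * (p / 2))) by (field; lra).
apply Rmult_le_compat_l; [apply Rle_0_sqr|].
apply Rinv_le_contravar; [repeat apply Rmult_lt_0_compat; lra|].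
apply Rmult_le_compat_l; [apply Rle_0_sqr | trivial].
Qed.

Lemma zeta_holomorphic (s : C) : 0 < Re s -> s <> 1 ->
  ex_derive (K := C_AbsRing) (V := C_NormedModule) zeta s.
Proof.
intros Hs H1.
set (d := (real (Lim_seq (fun n => Re (dzeta_seq s n))),
           real (Lim_seq (fun n => Im (dzeta_seq s n)))) : C).
generalize (Kc_pos s Hs); intros HK.
assert (Hd : is_clim (dzeta_seq s) d).
{ eapply cauchy_clim; [| |apply dzeta_seq_cauchy; trivial]; [lra|].
  apply Rmult_le_pos; [lra | left; apply Rinv_0_lt_compat; lra]. }
assert (Hp : 0 < Cmod (s - 1)) by (apply Cmod_gt_0, Cminus_neq; trivial).
set (M := 2 / Cmod (s - 1) ^ 3 + 2 * Kc s / (Re s / 2)).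
assert (HM : 0 < M).
{ apply Rplus_lt_0_compat; apply Rdiv_lt_0_compat; try lra; apply pow_lt; trivial. }
assert (Hb : forall h : C, Cmod h <= Re s / 4 -> Cmod h <= Cmod (s - 1) / 2 ->
  Cmod (zeta (s + h) - zeta s - h * d) <= M * Cmod h ^ 2).
{ intros h Hh1 Hh2.
  assert (H2 : (s + h)%C <> 1).
  { intros E. replace (s - 1)%C with (- h)%C in * by (rewrite <- E; ring).
    rewrite Cmod_opp in *; lra. }
  assert (Hr : 0 < Re (s + h)).
  { generalize (re_le_Cmod h) (Rle_abs (- Re h)); rewrite Rabs_Ropp.
    change (Re (s + h)) with (Re s + Re h). lra. }
  apply (is_clim_bound (rem_seq s h)).
  - apply is_clim_minus; [apply is_clim_minus; apply zeta_lim; trivial|].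
    apply is_clim_scal; trivial.
  - intros n.
    generalize (rem_seq_cauchy s h Hs H1 H2 Hh1 0 n) (rem_seq_0 s h H1 Hh2).
    simpl (0 + n)%nat; simpl INR; rewrite ln_1, Rmult_0_r, exp_0; intros B1 B2.
    replace (rem_seq s h n) with ((rem_seq s h n - rem_seq s h 0) + rem_seq s h 0)%C by ring.
    eapply Rle_trans; [apply Cmod_triangle|]. unfold M.
    replace (2 * (Cmod h ^ 2 * Kc s) / (Re s / 2) * 1)
      with (2 * Kc s / (Re s / 2) * Cmod h ^ 2) in B1 by (field; lra).
    lra. }
exists d; split; [apply is_linear_scal_l|].
intros x Hx eps.
apply (is_filter_lim_locally_unique (K := C_AbsRing) (V := AbsRing_NormedModule C_AbsRing)) in Hx; subst x.
set (r := Rmin (Rmin (Re s / 4) (Cmod (s - 1) / 2)) (eps / M)).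
assert (Hr : 0 < r).
{ repeat apply Rmin_glb_lt; try lra. apply Rdiv_lt_0_compat; [apply cond_pos | trivial]. }
apply (locally_le_locally_norm (K := C_AbsRing) (V := AbsRing_NormedModule C_AbsRing)).
exists (mkposreal r Hr); intros y Hy.
change (Cmod (y - s) < r) in Hy.
change (Cmod (zeta y - zeta s - (y - s) * d) <= eps * Cmod (y - s)).
set (h := (y - s)%C) in *.
replace y with (s + h)%C by (unfold h; ring).
assert (L1 := Rmin_l (Rmin (Re s / 4) (Cmod (s - 1) / 2)) (eps / M)).
assert (L2 := Rmin_r (Rmin (Re s / 4) (Cmod (s - 1) / 2)) (eps / M)).
assert (L3 := Rmin_l (Re s / 4) (Cmod (s - 1) / 2)).
assert (L4 := Rmin_r (Re s / 4) (Cmod (s - 1) / 2)).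
fold r in L1, L2.
eapply Rle_trans; [apply Hb; lra|].
replace (M * Cmod h ^ 2) with (M * Cmod h * Cmod h) by ring.
apply Rmult_le_compat_r; [apply Cmod_ge_0|].
replace (pos eps) with (M * (eps / M)) by (field; lra).
apply Rmult_le_compat_l; lra.
Qed.

Lemma zeta_Dirichlet (s : C) : 1 < Re s ->
  is_series (K := C_AbsRing) (V := C_NormedModule)
    (fun n => Rcpow (INR (S n)) (- s)) (zeta s).
Proof.
intros Hs.
assert (H1 : s <> 1) by (intros ->; simpl in Hs; lra).
assert (Hp : 0 < Cmod (s - 1)) by (apply Cmod_gt_0, Cminus_neq; trivial).
assert (HL : is_clim (sum_n (fun n => Rcpow (INR (S n)) (- s))) (zeta s)).
{ intros eps.
  assert (He : 0 < eps / 2) by (generalize (cond_pos eps); lra).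
  destruct (zeta_lim s ltac:(lra) H1 (mkposreal _ He)) as [N1 HN1].
  destruct (exp_ln_small (Re s - 1) (/ Cmod (s - 1)) ltac:(lra)
    ltac:(left; apply Rinv_0_lt_compat; trivial) (mkposreal _ He)) as [N2 HN2].
  exists (max N1 N2); intros n Hn.
  generalize (HN1 n ltac:(lia)) (HN2 n ltac:(lia)); simpl pos; intros B1 B2.
  set (P := (Rcpow (INR (S n)) (1 - s) / (s - 1))%C).
  replace (sum_n _ n - zeta s)%C with ((zeta_seq s n - zeta s) + - P)%C
    by (unfold zeta_seq, P; ring).
  eapply Rle_lt_trans; [apply Cmod_triangle|].
  rewrite Cmod_opp.
  replace (Cmod P) with (/ Cmod (s - 1) * exp (- (Re s - 1) * ln (INR (S n)))); [lra|].
  unfold P; rewrite Cmod_div, Cmod_Rcpow by (apply Cminus_neq; trivial).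
  unfold Rdiv; rewrite Rmult_comm; f_equal; f_equal. destruct s; simpl; ring. }
intros P HP.
apply (locally_norm_le_locally (K := C_AbsRing) (V := C_NormedModule)) in HP.
destruct HP as [eps HP].
destruct (HL eps) as [N HN]; exists N; intros n Hn; apply HP, (HN n Hn).
Qed.

End ZetaFacts.

(* Main.v *)
(* With Phi the window, f is the Fourier transform of a smooth compactly
   supported function equal to 1 on (a - b, b - a); hence the kernel f(x/G)/G
   reproduces the value at 0 of every p(x) e^{i om x}, p a polynomial,
   |om| < 2 pi (b - a)/G.  As delta < 2 pi (b - a), the right-hand side is at
   least (1 + eta) log T + O(1) for some eta > 0.
   On the other hand x |-> Z(t + x) differs from a sum of such functions, with
   frequencies in that range, by at most K T^{-N} (1 + |x|)^D for all real x:
   zeta(1/2 + i(t + x)) is replaced by its Euler-Maclaurin sum of length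
   T^{1 + eta}, whose frequencies -log n lie in [-(1 + eta) log T, 0], and
   e^{i theta(t + x)} = Gamma/|Gamma| pi^{-i(t+x)/2} is expanded by means of
   Gauss' product, where theta' is about (log T)/2 and the higher derivatives
   are small.  Since f decays faster than any power, integrating the error
   against f(x/G) gives the theorem. *)

(* Z is used on the real line only. A polynomial bound in x for the error, valid for every real x,
   replaces both a truncation of the integral and a shift of contour. Hence the factors
   [(1 + Rabs x) ^ D], and hence remainder estimates that must hold even where t + x is near 0 or
   negative. Gauss' product serves this purpose: it makes the phase an explicit finite sum of
   arctangents, whose Taylor remainders are elementary and uniform.

   Since [lG] is known only through [is_logGamma], its imaginary part is never estimated itself;
   phases are compared modulo 2 pi, through e^{i theta}.

   The frequency budget is lopsided. The approximation to e^{i theta} has a single frequency [om],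
   really about (log T)/2, but bounded below only by a constant. The negative end of the range is
   therefore charged the whole (1 + eta) log T, which the plateau of the window still covers, while
   the positive end needs (log T)/2 only.

   Wherever a factor T is lost (to the growth of zeta, to the size of t, to 1/G), the exponent of
   the previous estimate is raised by one. *)
Require Import Defs.
From Stdlib Require Import Reals Lra Lia Factorial.
From Coquelicot Require Import Coquelicot.
Import ZetaFacts.

(** * Improper integrals of complex-valued functions *)

Notation is_CInt := (@is_RInt C_R_NormedModule).
Notation is_CInt_gen := (@is_RInt_gen C_R_NormedModule).
Notation m_inf := (Rbar_locally m_infty).
Notation p_inf := (Rbar_locally p_infty).

(** By components, so that real continuity lemmas and [auto_derive] apply; [ccont_continuous] and
    [continuous_ccont] translate to and from the normed-module notion that integrals require. *)
Definition ccont (f : R -> C) (x : R) : Prop :=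
  continuous (fun y => Re (f y)) x /\ continuous (fun y => Im (f y)) x.

Lemma im_le_Cmod (z : C) : Rabs (Im z) <= Cmod z.
Proof. eapply Rle_trans; [apply Rmax_r | apply Rmax_Cmod]. Qed.

Lemma norm_Cmod (z : C) : @norm R_AbsRing C_R_NormedModule z = Cmod z.
Proof.
  destruct z as [x y]; unfold Cmod; simpl.
  change (sqrt (Rabs x ^ 2 + Rabs y ^ 2) = sqrt (x ^ 2 + y ^ 2)).
  now rewrite <- !Rsqr_pow2, <- !Rsqr_abs.
Qed.

Lemma filterlim_Cmod {T : Type} (F : (T -> Prop) -> Prop) {FF : Filter F}
  (f : T -> C) (l : C) :
  (forall e : posreal, F (fun x => Cmod (f x - l) < e)) ->
  filterlim f F (@locally C_R_NormedModule l).
Proof.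
  intros H; apply (proj2 (filterlim_locally_ball_norm (U := C_R_NormedModule) f l)); intros e.
  generalize (H e); apply filter_imp; intros x Hx.
  unfold ball_norm; rewrite norm_Cmod; exact Hx.
Qed.

Lemma ccont_continuous (f : R -> C) (x : R) :
  ccont f x -> @continuous R_UniformSpace C_R_NormedModule f x.
Proof.
  intros [H1 H2]; apply filterlim_Cmod; [apply locally_filter|]; intros e.
  assert (He : 0 < e / 3) by (generalize (cond_pos e); lra).
  generalize (proj1 (filterlim_locally _ _) H1 (mkposreal _ He))
    (proj1 (filterlim_locally _ _) H2 (mkposreal _ He)).
  intros K1 K2; generalize (filter_and _ _ K1 K2); apply filter_imp.
  intros y [A B].
  apply Rle_lt_trans with (2 * (e / 3)); [|generalize (cond_pos e); lra].
  apply Cmod_le_2; left; [exact A | exact B].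
Qed.

Lemma continuous_ccont (f : R -> C) (x : R) :
  @continuous R_UniformSpace C_R_NormedModule f x -> ccont f x.
Proof.
  intros H; split; apply (continuous_comp f).
  - exact H.
  - apply (@continuous_fst R_UniformSpace R_UniformSpace).
  - exact H.
  - apply (@continuous_snd R_UniformSpace R_UniformSpace).
Qed.

Lemma ccont_const c x : ccont (fun _ => c) x.
Proof. split; apply continuous_const. Qed.

Lemma ccont_plus f g x : ccont f x -> ccont g x -> ccont (fun y => f y + g y)%C x.
Proof.
  intros [A B] [D E]; split; simpl;
    apply (continuous_plus (V := R_NormedModule) (fun y => _ (f y)) (fun y => _ (g y))); assumption.
Qed.

Lemma ccont_mult f g x : ccont f x -> ccont g x -> ccont (fun y => f y * g y)%C x.
Proof.
  intros [A B] [D E]; split; simpl.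
  - apply (continuous_minus (V := R_NormedModule) (fun y => Re (f y) * Re (g y)) (fun y => Im (f y) * Im (g y)));
    apply (continuous_mult (K := R_AbsRing) (fun y => _ (f y)) (fun y => _ (g y))); assumption.
  - apply (continuous_plus (V := R_NormedModule) (fun y => Re (f y) * Im (g y)) (fun y => Im (f y) * Re (g y)));
    apply (continuous_mult (K := R_AbsRing) (fun y => _ (f y)) (fun y => _ (g y))); assumption.
Qed.

Lemma ccont_RtoC f x : continuous f x -> ccont (fun y => RtoC (f y)) x.
Proof. intros H; split; [exact H | apply continuous_const]. Qed.

Lemma ccont_ext f g x : (forall y, f y = g y) -> ccont f x -> ccont g x.
Proof.
  intros H [A B]; split; [apply continuous_ext with (2 := A) | apply continuous_ext with (2 := B)];
    intros y; now rewrite H.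
Qed.

Lemma cderiv_ccont f x l : cderiv f x l -> ccont f x.
Proof.
  intros [H1 H2]; split;
    [apply (ex_derive_continuous (fun y => Re (f y))) | apply (ex_derive_continuous (fun y => Im (f y)))];
    eexists; eassumption.
Qed.

Lemma cderiv_is_derive f x l :
  cderiv f x l -> @is_derive R_AbsRing C_R_NormedModule f x l.
Proof.
  intros [H1 H2].
  assert (K : is_derive (V := C_R_NormedModule)
    (fun y => (plus (scal (Re (f y)) (RtoC 1 : C_R_NormedModule)) (scal (Im (f y)) (Ci : C_R_NormedModule)))) x
    (plus (scal (Re l) (RtoC 1 : C_R_NormedModule)) (scal (Im l) (Ci : C_R_NormedModule)))).
  { apply (is_derive_plus (V := C_R_NormedModule)); apply (is_derive_scal_l (V := C_R_NormedModule)); assumption. }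
  assert (E : forall z : C, plus (scal (Re z) (RtoC 1 : C_R_NormedModule)) (scal (Im z) (Ci : C_R_NormedModule)) = z).
  { intros [u v]; apply injective_projections; cbv -[Rplus Rmult R0 R1 IZR]; ring. }
  rewrite E in K; apply is_derive_ext with (2 := K); intros t; apply E.
Qed.

Lemma cFTC (F f : R -> C) (a b : R) :
  (forall x, Rmin a b <= x <= Rmax a b -> cderiv F x (f x) /\ ccont f x) ->
  is_CInt f a b (F b - F a)%C.
Proof.
  intros H.
  apply (is_RInt_derive (V := C_R_CompleteNormedModule)).
  - intros x Hx; apply cderiv_is_derive, H, Hx.
  - intros x Hx; apply ccont_continuous, H, Hx.
Qed.

Lemma is_CInt_gen_ext (f g : R -> C) Fa Fb {FFa : Filter Fa} {FFb : Filter Fb} (l l' : C) :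
  (forall x, f x = g x) -> l = l' -> is_CInt_gen f Fa Fb l -> is_CInt_gen g Fa Fb l'.
Proof.
  intros H <-; apply is_RInt_gen_ext; trivial.
  apply filter_forall; intros; apply H.
Qed.

Lemma is_CInt_gen_unique f Fa Fb {FFa : ProperFilter Fa} {FFb : ProperFilter Fb} (l l' : C) :
  is_CInt_gen f Fa Fb l -> is_CInt_gen f Fa Fb l' -> l = l'.
Proof.
  intros H1 H2.
  transitivity (RInt_gen (V := C_R_CompleteNormedModule) f Fa Fb); [symmetry|];
    apply (is_RInt_gen_unique (V := C_R_CompleteNormedModule)); assumption.
Qed.

Lemma is_CInt_gen_plus f g Fa Fb {FFa : Filter Fa} {FFb : Filter Fb} (l m : C) :
  is_CInt_gen f Fa Fb l -> is_CInt_gen g Fa Fb m ->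
  is_CInt_gen (fun x => f x + g x)%C Fa Fb (l + m)%C.
Proof. apply (is_RInt_gen_plus (V := C_R_NormedModule)). Qed.

(** The scalars of [C_R_NormedModule] are real, so linearity of limits and integrals over complex
    constants needs separate proofs, here and in [is_CInt_scal] and [is_CInt_gen_scal]. *)
Lemma filterlim_Cmult_const (T : Type) (F : (T -> Prop) -> Prop) {FF : Filter F} (f : T -> C) (c l : C) :
  filterlim f F (@locally C_R_NormedModule l) ->
  filterlim (fun x => c * f x)%C F (@locally C_R_NormedModule (c * l)%C).
Proof.
  intros H; apply filterlim_Cmod; trivial; intros e.
  assert (He : 0 < e / (Cmod c + 1)).
  { apply Rdiv_lt_0_compat; [apply cond_pos | generalize (Cmod_ge_0 c); lra]. }
  generalize (proj1 (filterlim_locally_ball_norm (U := C_R_NormedModule) f l) H (mkposreal _ He)); apply filter_imp.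
  intros x Hx; unfold ball_norm in Hx; rewrite norm_Cmod in Hx; simpl in Hx.
  change (Cmod (f x - l) < e / (Cmod c + 1)) in Hx.
  replace (c * f x - c * l)%C with (c * (f x - l))%C by ring; rewrite Cmod_mult.
  generalize (Cmod_ge_0 c) (Cmod_ge_0 (f x - l)); intros.
  apply Rle_lt_trans with ((Cmod c + 1) * Cmod (f x - l)); [nra|].
  replace (pos e) with ((Cmod c + 1) * (e / (Cmod c + 1))) by (field; lra).
  apply Rmult_lt_compat_l; lra.
Qed.

Lemma is_CInt_scal f a b (c l : C) :
  is_CInt f a b l -> is_CInt (fun x => c * f x)%C a b (c * l)%C.
Proof.
  intros H.
  assert (K1 := is_RInt_fct_extend_fst f a b l H).
  assert (K2 := is_RInt_fct_extend_snd f a b l H).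
  apply is_RInt_fct_extend_pair; simpl.
  - apply (is_RInt_minus (V := R_NormedModule) (fun t => fst c * fst (f t)) (fun t => snd c * snd (f t)));
      apply (is_RInt_scal (V := R_NormedModule)); assumption.
  - apply (is_RInt_plus (V := R_NormedModule) (fun t => fst c * snd (f t)) (fun t => snd c * fst (f t)));
      apply (is_RInt_scal (V := R_NormedModule)); assumption.
Qed.

Lemma is_CInt_gen_scal f Fa Fb {FFa : Filter Fa} {FFb : Filter Fb} (c l : C) :
  is_CInt_gen f Fa Fb l -> is_CInt_gen (fun x => c * f x)%C Fa Fb (c * l)%C.
Proof.
  intros H P HP.
  assert (K := filterlim_Cmult_const C (@locally C_R_NormedModule l) (fun z => z) c l (fun P H => H) P HP).
  generalize (H _ K); unfold filtermapi; apply filter_imp.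
  intros [a b] [y [Hy Py]]; exists (c * y)%C; split; trivial.
  apply is_CInt_scal; exact Hy.
Qed.

Lemma is_RInt_gen_lim {V : NormedModule R_AbsRing} (f : R -> V) (F : R -> R -> V)
  Fa Fb {FFa : Filter Fa} {FFb : Filter Fb} (l : V) :
  filter_prod Fa Fb (fun ab => is_RInt f (fst ab) (snd ab) (F (fst ab) (snd ab))) ->
  filterlim (fun ab => F (fst ab) (snd ab)) (filter_prod Fa Fb) (locally l) ->
  is_RInt_gen f Fa Fb l.
Proof.
  intros H K P HP.
  assert (K1 : filter_prod Fa Fb (fun ab => P (F (fst ab) (snd ab)))) by exact (K P HP).
  assert (K2 := filter_and _ _ H K1).
  unfold filtermapi; revert K2; apply filter_imp.
  intros ab AB; exists (F (fst ab) (snd ab)); exact AB.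
Qed.

(** One notion for the three ranges of integration used below, the line, (0, oo) and [0, oo): near
    the ends the bounds lie in the convex set D and are in increasing order. *)
Definition dom_filters (D : R -> Prop) (Fa Fb : (R -> Prop) -> Prop) : Prop :=
  (forall x y z, D x -> D y -> x <= z <= y -> D z) /\
  filter_prod Fa Fb (fun ab => fst ab <= snd ab) /\ Fa D /\ Fb D.

Lemma dom_filters_prod D Fa Fb {FFa : Filter Fa} {FFb : Filter Fb} :
  dom_filters D Fa Fb ->
  filter_prod Fa Fb (fun ab => fst ab <= snd ab /\ forall x, fst ab <= x <= snd ab -> D x).
Proof.
  intros [HD [Hle [Ha Hb]]].
  assert (K : filter_prod Fa Fb (fun ab => D (fst ab) /\ D (snd ab))).
  { exists D D; trivial; intros; split; assumption. }
  generalize (filter_and _ _ Hle K); apply filter_imp; intros [a b] [H1 [H2 H3]]; simpl in *.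
  split; trivial; intros x Hx; apply (HD a b); assumption.
Qed.

Lemma dom_filters_line : dom_filters (fun _ => True) m_inf p_inf.
Proof.
  split; [trivial|split; [|split; apply filter_true]].
  exists (fun x => x < 0) (fun x => 0 < x); [exists 0; trivial | exists 0; trivial |].
  intros x y; simpl; lra.
Qed.

Lemma dom_filters_pos : dom_filters (fun x => 0 < x) (at_right 0) p_inf.
Proof.
  split; [|split; [|split]].
  - intros; lra.
  - exists (fun x => x < 1) (fun x => 1 < x).
    + exists (mkposreal 1 Rlt_0_1); intros y Hy _; unfold ball in Hy; simpl in Hy.
      unfold AbsRing_ball, abs, minus, plus, opp in Hy; simpl in Hy; apply Rabs_def2 in Hy; lra.
    + exists 1; trivial.
    + intros; simpl; lra.
  - exists (mkposreal 1 Rlt_0_1); trivial.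
  - exists 0; trivial.
Qed.

Lemma dom_filters_half : dom_filters (fun x => 0 <= x) (at_point 0) p_inf.
Proof.
  split; [|split; [|split]].
  - intros; lra.
  - exists (fun x => x = 0) (fun x => 0 < x).
    + reflexivity.
    + exists 0; trivial.
    + intros; simpl; lra.
  - unfold at_point; lra.
  - exists 0; intros; lra.
Qed.

Lemma filterlim_pair_minus {V : NormedModule R_AbsRing} (F G : R -> V) Fa Fb {FFa : Filter Fa} {FFb : Filter Fb} (la lb : V) :
  filterlim F Fa (locally la) -> filterlim G Fb (locally lb) ->
  filterlim (fun ab => minus (G (snd ab)) (F (fst ab))) (filter_prod Fa Fb) (locally (minus lb la)).
Proof.
  intros Ha Hb.
  assert (K1 : filterlim (fun ab : R * R => G (snd ab)) (filter_prod Fa Fb) (locally lb)).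
  { apply filterlim_comp with (2 := Hb); apply filterlim_snd. }
  assert (K2 : filterlim (fun ab : R * R => opp (F (fst ab))) (filter_prod Fa Fb) (locally (opp la))).
  { apply filterlim_comp with (2 := filterlim_opp la).
    apply filterlim_comp with (2 := Ha); apply filterlim_fst. }
  apply filterlim_comp_2 with (1 := K1) (2 := K2); apply (filterlim_plus lb (opp la)).
Qed.

Lemma cFTC_gen (D : R -> Prop) Fa Fb {FFa : Filter Fa} {FFb : Filter Fb} (F f : R -> C) (la lb : C) :
  dom_filters D Fa Fb ->
  (forall x, D x -> cderiv F x (f x) /\ ccont f x) ->
  filterlim F Fa (@locally C_R_NormedModule la) ->
  filterlim F Fb (@locally C_R_NormedModule lb) ->
  is_CInt_gen f Fa Fb (lb - la)%C.
Proof.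
  intros HD Hd Ha Hb.
  apply (is_RInt_gen_lim (V := C_R_NormedModule) f (fun a b => F b - F a)%C Fa Fb).
  - generalize (dom_filters_prod _ _ _ HD); apply filter_imp; intros [a b] [H1 H2]; simpl in *.
    apply cFTC; intros x Hx; rewrite Rmin_left, Rmax_right in Hx by trivial; apply Hd, H2, Hx.
  - apply (filterlim_pair_minus (V := C_R_NormedModule) F F Fa Fb); assumption.
Qed.

Lemma rFTC_gen (D : R -> Prop) Fa Fb {FFa : Filter Fa} {FFb : Filter Fb} (F f : R -> R) (la lb : R) :
  dom_filters D Fa Fb ->
  (forall x, D x -> is_derive F x (f x) /\ continuous f x) ->
  filterlim F Fa (locally la) -> filterlim F Fb (locally lb) ->
  is_RInt_gen f Fa Fb (lb - la).
Proof.
  intros HD Hd Ha Hb.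
  apply (is_RInt_gen_lim (V := R_NormedModule) f (fun a b => F b - F a) Fa Fb).
  - generalize (dom_filters_prod _ _ _ HD); apply filter_imp; intros [a b] [H1 H2]; simpl in *.
    apply (is_RInt_derive (V := R_CompleteNormedModule));
      intros x Hx; rewrite Rmin_left, Rmax_right in Hx by trivial; apply Hd, H2, Hx.
  - apply (filterlim_pair_minus (V := R_NormedModule) F F Fa Fb); assumption.
Qed.

Lemma cRInt_gen_le Fa Fb {FFa : ProperFilter Fa} {FFb : ProperFilter Fb} (D : R -> Prop) (h : R -> C) (g : R -> R) (l : C) (lg : R) :
  dom_filters D Fa Fb ->
  (forall x, D x -> Cmod (h x) <= g x) ->
  is_CInt_gen h Fa Fb l -> is_RInt_gen g Fa Fb lg -> Cmod l <= lg.
Proof.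
  intros HD Hle Hh Hg; rewrite <- norm_Cmod.
  apply (RInt_gen_norm (V := C_R_CompleteNormedModule) (Fa := Fa) (Fb := Fb) h g l lg); trivial.
  - apply HD.
  - generalize (dom_filters_prod _ _ _ HD); apply filter_imp; intros [a b] [_ H] x Hx.
    rewrite norm_Cmod; apply Hle, H, Hx.
Qed.

Lemma cRInt_abs_le (h : R -> C) (g : R -> R) (D : R -> Prop) (G : R -> R) (a b : R) (l : C) :
  (forall x y z, D x -> D y -> x <= z <= y -> D z) -> D a -> D b ->
  (forall x, D x -> is_derive G x (g x) /\ continuous g x /\ Cmod (h x) <= g x) ->
  is_CInt h a b l -> Cmod l <= Rabs (G b - G a).
Proof.
  intros HD Da Db H Hl.
  assert (E : forall u v k, D u -> D v -> u <= v -> is_CInt h u v k -> Cmod k <= Rabs (G v - G u)).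
  { intros u v k Du Dv Huv Hk.
    apply Rle_trans with (G v - G u); [|apply Rle_abs].
    rewrite <- norm_Cmod.
    apply (norm_RInt_le (V := C_R_NormedModule) h g u v); trivial.
    - intros x Hx; rewrite norm_Cmod; apply H, (HD u v); assumption.
    - apply (is_RInt_derive (V := R_CompleteNormedModule));
      intros x Hx; rewrite Rmin_left, Rmax_right in Hx by trivial; apply H, (HD u v); assumption. }
  destruct (Rle_dec a b) as [Hab|Hab].
  - apply E; assumption.
  - rewrite Rabs_minus_sym, <- Cmod_opp.
    apply E; trivial; [lra|].
    apply (is_RInt_swap (V := C_R_NormedModule)) in Hl; exact Hl.
Qed.

(** Comparison test. The majorant comes with a primitive [G] that has limits at both ends, so the
    Cauchy criterion for the integral of [h] follows from that for [G]: moving an end changes the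
    integral by at most the change of [G]. *)
Lemma cRInt_gen_dom (D : R -> Prop) Fa Fb {FFa : ProperFilter Fa} {FFb : ProperFilter Fb}
  (h : R -> C) (g G : R -> R) (la lb : R) :
  dom_filters D Fa Fb ->
  (forall x, D x -> is_derive G x (g x) /\ continuous g x /\ Cmod (h x) <= g x) ->
  (forall x, D x -> ccont h x) ->
  filterlim G Fa (locally la) -> filterlim G Fb (locally lb) ->
  exists l, is_CInt_gen h Fa Fb l /\ Cmod l <= lb - la.
Proof.
  intros HD Hg Hc Ha Hb; pose proof HD as [Hconv [Hle [Da Db]]].
  assert (Hex : forall a b, D a -> D b -> ex_RInt (V := C_R_CompleteNormedModule) h a b).
  { intros a b A B; apply (ex_RInt_continuous (V := C_R_CompleteNormedModule)); intros x Hx.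
    apply ccont_continuous, Hc.
    unfold Rmin, Rmax in Hx; destruct (Rle_dec a b); [apply (Hconv a b) | apply (Hconv b a)]; assumption. }
  set (I := fun ab : R * R => RInt (V := C_R_CompleteNormedModule) h (fst ab) (snd ab)).
  assert (HI : forall a b, D a -> D b -> is_CInt h a b (I (a, b))).
  { intros a b A B; apply (RInt_correct (V := C_R_CompleteNormedModule)), Hex; assumption. }
  destruct (proj1 (filterlim_locally_cauchy (U := C_R_CompleteNormedModule) (F := filter_prod Fa Fb) I)) as [l Hl].
  { intros e.
    assert (He : 0 < e / 4) by (generalize (cond_pos e); lra).
    assert (Ka := proj1 (filterlim_locally_ball_norm (U := R_NormedModule) G la) Ha (mkposreal _ He)).
    assert (Kb := proj1 (filterlim_locally_ball_norm (U := R_NormedModule) G lb) Hb (mkposreal _ He)).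
    exists (fun ab => (D (fst ab) /\ Rabs (G (fst ab) - la) < e / 4) /\ (D (snd ab) /\ Rabs (G (snd ab) - lb) < e / 4)).
    split.
    - econstructor; [apply (filter_and _ _ Da Ka) | apply (filter_and _ _ Db Kb) |].
      intros x y H1 H2; split; [exact H1 | exact H2].
    - intros [a b] [a' b'] [[A1 A2] [B1 B2]] [[A1' A2'] [B1' B2']]; simpl in *.
      apply (norm_compat1 (V := C_R_NormedModule)).
      rewrite norm_Cmod.
      assert (J1 := HI a' a A1' A1). assert (J2 := HI b b' B1 B1').
      (* The integrals over [a, b] and [a', b'] differ only by the two pieces near the ends. *)
      assert (J : is_CInt h a' b' (I (a', a) + I (a, b) + I (b, b'))%C).
      { apply (is_RInt_Chasles (V := C_R_NormedModule)) with b; [|exact J2].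
        apply (is_RInt_Chasles (V := C_R_NormedModule)) with a; [exact J1 | apply HI; assumption]. }
      change (Cmod (I (a', b') - I (a, b)) < e).
      replace (I (a', b')) with (I (a', a) + I (a, b) + I (b, b'))%C
        by (symmetry; apply (is_RInt_unique (V := C_R_CompleteNormedModule)), J).
      replace (_ - _)%C with (I (a', a) + I (b, b'))%C by ring.
      eapply Rle_lt_trans; [apply Cmod_triangle|].
      apply (cRInt_abs_le h g D G) in J1; trivial.
      apply (cRInt_abs_le h g D G) in J2; trivial.
      revert J1 J2 A2 A2' B2 B2'; unfold Rabs; repeat destruct Rcase_abs; lra. }
  exists l.
  assert (Hgen : is_CInt_gen h Fa Fb l).
  { apply (is_RInt_gen_lim (V := C_R_NormedModule) h (fun a b => I (a, b)) Fa Fb).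
    - generalize (dom_filters_prod _ _ _ HD); apply filter_imp; intros [a b] [H1 H2]; simpl in *.
      apply HI; apply H2; lra.
    - apply filterlim_ext with (2 := Hl); intros [a b]; reflexivity. }
  split; trivial.
  apply (cRInt_gen_le Fa Fb D h g l (lb - la)); trivial; [intros; apply Hg; trivial|].
  apply (rFTC_gen D Fa Fb G g); trivial; intros; split; apply Hg; trivial.
Qed.

(** * Euler's integral for Gamma *)

Lemma atan_le (y : R) : 0 <= y -> atan y <= y.
Proof.
  intros Hy.
  generalize (incr_le atan (fun x => x) (fun x => / (1 + x ^ 2)) (fun _ => 1) 0 y Hy); rewrite atan_0.
  intros H; enough (atan y - 0 <= y - 0) by lra; apply H.
  - intros x _; apply is_derive_Reals, derivable_pt_lim_atan.
  - intros; auto_derive; trivial.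
  - intros x _; rewrite <- Rinv_1; apply Rinv_le_contravar; [lra | generalize (pow2_ge_0 x); lra].
Qed.

Lemma atan_ge_sub_inv (x : R) : 0 < x -> PI / 2 - / x <= atan x.
Proof.
  intros Hx; generalize (atan_inv x Hx) (atan_le (/ x)); intros H1 H2.
  assert (0 < / x) by (apply Rinv_0_lt_compat; trivial). lra.
Qed.

Lemma filterlim_real {T : Type} (F : (T -> Prop) -> Prop) {FF : Filter F} (f : T -> R) (l : R) :
  (forall e : posreal, F (fun x => Rabs (f x - l) < e)) -> filterlim f F (locally l).
Proof.
  intros H; apply (proj2 (filterlim_locally_ball_norm (U := R_NormedModule) f l)); intros e; apply (H e).
Qed.

Lemma filterlim_p_inf_Cmod (f : R -> C) (l : C) (K : R) :
  (forall x, 1 <= x -> Cmod (f x - l) <= K / x) ->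
  filterlim f p_inf (@locally C_R_NormedModule l).
Proof.
  intros H; apply filterlim_Cmod; [apply Rbar_locally_filter|]; intros e.
  exists (Rmax 1 (K / e)); intros x Hx.
  assert (H1 := Rmax_l 1 (K / e)); assert (H2 := Rmax_r 1 (K / e)).
  eapply Rle_lt_trans; [apply H; lra|].
  apply Rmult_lt_reg_r with x; [lra|].
  replace (K / x * x) with (K / e * e) by (field; split; [lra | generalize (cond_pos e); lra]).
  rewrite (Rmult_comm e); apply Rmult_lt_compat_r; [apply cond_pos | lra].
Qed.

Lemma filterlim_p_inf_real (f : R -> R) (l : R) (K : R) :
  (forall x, 1 <= x -> Rabs (f x - l) <= K / x) -> filterlim f p_inf (locally l).
Proof.
  intros H; apply filterlim_real; [apply Rbar_locally_filter|]; intros e.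
  exists (Rmax 1 (K / e)); intros x Hx.
  assert (H1 := Rmax_l 1 (K / e)); assert (H2 := Rmax_r 1 (K / e)).
  eapply Rle_lt_trans; [apply H; lra|].
  apply Rmult_lt_reg_r with x; [lra|].
  replace (K / x * x) with (K / e * e) by (field; split; [lra | generalize (cond_pos e); lra]).
  rewrite (Rmult_comm e); apply Rmult_lt_compat_r; [apply cond_pos | lra].
Qed.

Lemma atan_p_inf (K : R) : 0 <= K -> filterlim (fun x => K * atan x) p_inf (locally (K * (PI / 2))).
Proof.
  intros HK; apply (filterlim_p_inf_real _ _ K); intros x Hx.
  generalize (atan_ge_sub_inv x ltac:(lra)) (atan_bound x); intros H1 H2.
  rewrite <- Rmult_minus_distr_l, Rabs_mult, Rabs_pos_eq by trivial.
  apply Rmult_le_compat_l; trivial; apply Rabs_le; lra.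
Qed.

Lemma atan_m_inf (K : R) : 0 <= K -> filterlim (fun x => K * atan x) m_inf (locally (- (K * (PI / 2)))).
Proof.
  intros HK.
  assert (H : filterlim (fun x => - (K * atan (- x))) m_inf (locally (- (K * (PI / 2))))).
  { apply filterlim_comp with (2 := filterlim_opp (K * (PI / 2))).
    apply (filterlim_comp _ _ _ (fun x => - x) (fun x => K * atan x)) with (2 := atan_p_inf K HK).
    intros P [M HM]; exists (- M); intros x Hx; apply HM; lra. }
  apply filterlim_ext with (2 := H); intros x; rewrite atan_opp; ring.
Qed.

Lemma atan_scal_deriv (K x : R) : is_derive (fun x => K * atan x) x (K / (1 + x ^ 2)).
Proof.
  apply is_derive_Reals; unfold Rdiv; apply derivable_pt_lim_scal, derivable_pt_lim_atan.
Qed.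

Lemma lorentz_continuous (K x : R) : continuous (fun x => K / (1 + x ^ 2)) x.
Proof.
  apply (ex_derive_continuous (fun x => K / (1 + x ^ 2))); auto_derive.
  generalize (pow2_ge_0 x); simpl; lra.
Qed.

(** The standard majorant of the file: its primitive K arctan has limits at both infinities, and its
    total mass is K pi. *)
Lemma lorentz_dom_line (h : R -> C) (K : R) : 0 <= K ->
  (forall x, ccont h x) -> (forall x, Cmod (h x) <= K / (1 + x ^ 2)) ->
  exists l, is_CInt_gen h m_inf p_inf l /\ Cmod l <= K * PI.
Proof.
  intros HK Hc Hb.
  destruct (cRInt_gen_dom (fun _ => True) m_inf p_inf h (fun x => K / (1 + x ^ 2)) (fun x => K * atan x)
    (- (K * (PI / 2))) (K * (PI / 2))) as [l [H1 H2]].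
  - apply dom_filters_line.
  - intros x _; split; [apply atan_scal_deriv | split; [apply lorentz_continuous | apply Hb]].
  - intros; apply Hc.
  - apply atan_m_inf, HK.
  - apply atan_p_inf, HK.
  - exists l; split; trivial; lra.
Qed.

Lemma exp_mult_INR (n : nat) (x : R) : exp (INR n * x) = exp x ^ n.
Proof.
  induction n as [|n IH]; [rewrite Rmult_0_l; apply exp_0|].
  rewrite S_INR, Rmult_plus_distr_r, exp_plus, IH, Rmult_1_l; simpl; ring.
Qed.

(** For m > 0, raise e^{x/m} >= x/m to the power m. *)
Lemma pow_exp_bounded (m : nat) : exists K, 0 < K /\ forall x, 0 <= x -> x ^ m * exp (- x) <= K.
Proof.
  destruct m as [|m].
  - exists 1; split; [lra|]; intros x Hx; simpl.
    assert (exp (- x) <= exp 0) by (apply exp_le; lra). rewrite exp_0 in *; lra.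
  - assert (Hm : 0 < INR (S m)) by (apply lt_0_INR; lia).
    exists (INR (S m) ^ S m); split; [apply pow_lt; trivial|]; intros x Hx.
    assert (E : exp x = exp (x / INR (S m)) ^ S m).
    { rewrite <- exp_mult_INR; f_equal; field; lra. }
    assert (H : (x / INR (S m)) ^ S m <= exp x).
    { rewrite E; apply pow_incr; split; [apply Rdiv_le_0_compat; trivial|].
      generalize (exp_ineq1_le (x / INR (S m))); lra. }
    rewrite exp_Ropp; apply Rmult_le_reg_r with (exp x); [apply exp_pos|].
    rewrite Rmult_assoc, Rinv_l, Rmult_1_r by (generalize (exp_pos x); lra).
    replace (x ^ S m) with (INR (S m) ^ S m * (x / INR (S m)) ^ S m).
    + apply Rmult_le_compat_l; trivial; left; apply pow_lt; trivial.
    + rewrite <- Rpow_mult_distr; f_equal; field; lra.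
Qed.

Definition gamma_integrand (z : C) (x : R) : C := (Rcpow x (z - 1) * RtoC (exp (- x)))%C.

Lemma cderiv_exp_opp (x : R) : cderiv (fun x => RtoC (exp (- x))) x (RtoC (- exp (- x))).
Proof. apply (cderiv_RtoC (fun x => exp (- x))); auto_derive; trivial; ring. Qed.

Lemma gamma_integrand_ccont (z : C) (x : R) : 0 < x -> ccont (gamma_integrand z) x.
Proof.
  intros Hx; eapply cderiv_ccont, cderiv_mult; [apply cderiv_Rcpow; trivial | apply cderiv_exp_opp].
Qed.

Lemma Cmod_gamma_integrand (z : C) (x : R) :
  Cmod (gamma_integrand z x) = exp ((Re z - 1) * ln x) * exp (- x).
Proof.
  unfold gamma_integrand; rewrite Cmod_mult, Cmod_Rcpow, Cmod_R, Rabs_pos_eq by (left; apply exp_pos).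
  f_equal; f_equal; f_equal; simpl; unfold Re; ring.
Qed.

Lemma exp_ln_le_pow (s x : R) (j : nat) : 0 <= s <= INR j -> 0 < x -> exp (s * ln x) <= 1 + x ^ j.
Proof.
  intros Hs Hx; assert (Hj : 0 < x ^ j) by (apply pow_lt; trivial).
  destruct (Rle_dec 1 x) as [H|H].
  - assert (exp (s * ln x) <= x ^ j); [|lra].
    rewrite <- (exp_ln (x ^ j)), ln_pow by trivial; apply exp_le.
    apply Rmult_le_compat_r; [apply ln_ge_0; trivial | lra].
  - assert (exp (s * ln x) <= exp 0); [|rewrite exp_0 in *; lra].
    apply exp_le; assert (ln x <= ln 1) by (apply ln_le; lra); rewrite ln_1 in *; nra.
Qed.

Lemma nat_above (x : R) : exists j : nat, x <= INR j.
Proof. destruct (INR_unbounded x) as [j Hj]; exists j; lra. Qed.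

Lemma at_right_lim_0 : filterlim (fun x : R => x) (at_right 0) (locally 0).
Proof. apply filter_le_within. Qed.

(** For Re z >= 1 the integrand is bounded near 0, so a Lorentzian dominates it on the whole of (0,
    oo). Smaller Re z is reached through [gamma_step]. *)
Lemma gamma_ex_large (z : C) : 1 <= Re z -> exists l, is_CInt_gen (gamma_integrand z) (at_right 0) p_inf l.
Proof.
  intros Hz; destruct (nat_above (Re z - 1)) as [j Hj].
  destruct (pow_exp_bounded 0) as [K0 [P0 H0]]; destruct (pow_exp_bounded 2) as [K2 [P2 H2]];
    destruct (pow_exp_bounded j) as [Kj [Pj Hj1]]; destruct (pow_exp_bounded (j + 2)) as [Kk [Pk Hk]].
  (* One constant for each monomial of (1 + x^j)(1 + x^2), multiplied by e^{-x}. *)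
  set (K := K0 + K2 + Kj + Kk).
  destruct (cRInt_gen_dom (fun x => 0 < x) (at_right 0) p_inf (gamma_integrand z) (fun x => K / (1 + x ^ 2)) (fun x => K * atan x)
    0 (K * (PI / 2))) as [l [E1 E2]].
  - apply dom_filters_pos.
  - intros x Hx; split; [apply atan_scal_deriv | split; [apply lorentz_continuous|]].
    rewrite Cmod_gamma_integrand.
    assert (Hq : 0 < 1 + x ^ 2) by (generalize (pow2_ge_0 x); lra).
    apply Rmult_le_reg_r with (1 + x ^ 2); trivial.
    replace (K / (1 + x ^ 2) * (1 + x ^ 2)) with K by (field; lra).
    apply Rle_trans with ((1 + x ^ j) * exp (- x) * (1 + x ^ 2)).
    + apply Rmult_le_compat_r; [lra|]; apply Rmult_le_compat_r; [left; apply exp_pos|].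
      apply exp_ln_le_pow; lra.
    + generalize (H0 x ltac:(lra)) (H2 x ltac:(lra)) (Hj1 x ltac:(lra)) (Hk x ltac:(lra)).
      rewrite pow_add; unfold K; simpl; lra.
  - intros; apply gamma_integrand_ccont; trivial.
  - replace 0 with (K * atan 0) at 2 by (rewrite atan_0; ring).
    apply filterlim_comp with (1 := at_right_lim_0).
    apply (ex_derive_continuous (fun x => K * atan x)); eexists; apply atan_scal_deriv.
  - apply atan_p_inf; unfold K; lra.
  - exists l; trivial.
Qed.

(** Integration by parts with x^z e^{-x}, which vanishes at both ends. Convergence at z is a
    conclusion drawn from convergence at z + 1; this covers 0 < Re z < 1, where the integrand is
    unbounded at 0. *)
Lemma gamma_step (z l : C) : 0 < Re z ->
  is_CInt_gen (gamma_integrand (z + 1)) (at_right 0) p_inf l ->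
  is_CInt_gen (gamma_integrand z) (at_right 0) p_inf (l / z)%C.
Proof.
  intros Hz Hl.
  assert (Hz0 : z <> 0) by (intros ->; simpl in Hz; lra).
  set (F := fun x => (Rcpow x z * RtoC (exp (- x)))%C).
  assert (HF : forall x, Cmod (F x) = exp (Re z * ln x) * exp (- x)).
  { intros x; unfold F; rewrite Cmod_mult, Cmod_Rcpow, Cmod_R, Rabs_pos_eq by (left; apply exp_pos); trivial. }
  assert (HI : is_CInt_gen (fun x => z * gamma_integrand z x + - (1) * gamma_integrand (z + 1) x)%C (at_right 0) p_inf (0 - 0)%C).
  { apply (cFTC_gen (fun x => 0 < x) _ _ F).
    - apply dom_filters_pos.
    - intros x Hx; split.
      + eapply cderiv_eq; [apply cderiv_mult; [apply cderiv_Rcpow; trivial | apply cderiv_exp_opp]|].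
        unfold gamma_integrand; replace (z + 1 - 1)%C with (z - 1 + 1)%C by ring.
        replace (Rcpow x z) with (Rcpow x (z - 1 + 1)) by (f_equal; ring).
        rewrite Rcpow_plus, Rcpow_1, RtoC_opp by trivial.
        field; apply RtoC_neq; lra.
      + apply ccont_plus; apply ccont_mult; try apply ccont_const; apply gamma_integrand_ccont; trivial.
    - apply filterlim_Cmod; [apply at_right_proper_filter|]; intros e.
      exists (mkposreal (exp (ln e / Re z)) (exp_pos _)); intros x Hx Hx0.
      unfold ball in Hx; simpl in Hx; unfold AbsRing_ball, abs, minus, plus, opp in Hx; simpl in Hx.
      rewrite Ropp_0, Rplus_0_r, Rabs_pos_eq in Hx by lra.
      unfold Cminus; rewrite Copp_0, Cplus_0_r, HF.
      assert (ln x < ln e / Re z) by (rewrite <- (ln_exp (ln e / Re z)); apply ln_increasing; trivial).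
      assert (exp (Re z * ln x) < e).
      { rewrite <- (exp_ln e) by apply cond_pos; apply exp_increasing.
        replace (ln e) with (Re z * (ln e / Re z)) by (field; lra).
        apply Rmult_lt_compat_l; trivial. }
      assert (exp (- x) <= exp 0) by (apply exp_le; lra); rewrite exp_0 in *.
      generalize (exp_pos (Re z * ln x)) (exp_pos (- x)); intros; nra.
    - destruct (nat_above (Re z)) as [j Hj].
      destruct (pow_exp_bounded 1) as [K0 [P0 H0]]; destruct (pow_exp_bounded (S j)) as [Kj [Pj Hj1]].
      apply (filterlim_p_inf_Cmod _ _ (K0 + Kj)); intros x Hx.
      unfold Cminus; rewrite Copp_0, Cplus_0_r, HF.
      apply Rmult_le_reg_r with x; [lra|].
      replace ((K0 + Kj) / x * x) with (K0 + Kj) by (field; lra).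
      apply Rle_trans with ((1 + x ^ j) * exp (- x) * x).
      + apply Rmult_le_compat_r; [lra|]; apply Rmult_le_compat_r; [left; apply exp_pos|].
        apply exp_ln_le_pow; lra.
      + generalize (H0 x ltac:(lra)) (Hj1 x ltac:(lra)); simpl; lra. }
  assert (HJ := is_CInt_gen_plus _ _ _ _ _ _ HI Hl).
  apply (is_CInt_gen_scal _ _ _ (/ z)) in HJ.
  revert HJ; apply is_CInt_gen_ext; try (unfold Cdiv; ring); try typeclasses eauto.
  intros x; field; trivial.
Qed.

Lemma Gamma_correct (z : C) : 0 < Re z -> is_CInt_gen (gamma_integrand z) (at_right 0) p_inf (Gamma z).
Proof.
  intros Hz.
  destruct (gamma_ex_large (z + 1)) as [l Hl]; [simpl; unfold Re in *; lra|].
  assert (H := gamma_step z l Hz Hl).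
  assert (E : Gamma z = (l / z)%C).
  { unfold Gamma; apply (is_RInt_gen_unique (V := C_R_CompleteNormedModule)); exact H. }
  rewrite E; exact H.
Qed.

Lemma Gamma_succ (z : C) : 0 < Re z -> Gamma (z + 1) = (z * Gamma z)%C.
Proof.
  intros Hz.
  assert (H := gamma_step z _ Hz (Gamma_correct (z + 1) ltac:(simpl; unfold Re in *; lra))).
  rewrite (is_CInt_gen_unique _ _ _ _ _ (Gamma_correct z Hz) H).
  field; intros ->; simpl in Hz; lra.
Qed.

Fixpoint rising (z : C) (n : nat) : C :=
  match n with O => 1 | S n => rising z n * (z + RtoC (INR n)) end%C.

Lemma Gamma_rising (z : C) (n : nat) : 0 < Re z -> Gamma (z + RtoC (INR n)) = (rising z n * Gamma z)%C.
Proof.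
  intros Hz; induction n as [|n IH].
  - simpl; rewrite Cplus_0_r; ring.
  - rewrite S_INR, RtoC_plus, Cplus_assoc, Gamma_succ, IH; [simpl; ring|].
    generalize (pos_INR n); simpl; unfold Re in *; lra.
Qed.

(** Supplies the mass and the first two moments of the density in [Gamma_asymptotic]. *)
Lemma fact_integral (n : nat) :
  is_RInt_gen (fun x => x ^ n * exp (- x)) (at_right 0) p_inf (INR (fact n)).
Proof.
  assert (Hlim : forall n, filterlim (fun x => - (x ^ n * exp (- x))) (at_right 0) (locally (- (0 ^ n * exp (- 0))))).
  { intros k; apply (filterlim_comp _ _ _ (fun x => x) (fun x => - (x ^ k * exp (- x)))) with (1 := at_right_lim_0).
    apply (ex_derive_continuous (fun x => - (x ^ k * exp (- x)))); auto_derive; trivial. }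
  assert (Hinf : forall n, filterlim (fun x => - (x ^ n * exp (- x))) p_inf (locally 0)).
  { intros k; destruct (pow_exp_bounded (S k)) as [K [PK HK]].
    apply (filterlim_p_inf_real _ _ K); intros x Hx.
    rewrite Rminus_0_r, Rabs_Ropp, Rabs_pos_eq.
    - apply Rmult_le_reg_r with x; [lra|].
      replace (K / x * x) with K by (field; lra); generalize (HK x ltac:(lra)); simpl; lra.
    - apply Rmult_le_pos; [apply pow_le; lra | left; apply exp_pos]. }
  assert (Hcont : forall (k : nat) (x : R), continuous (fun x => x ^ k * exp (- x)) x).
  { intros k x; apply (ex_derive_continuous (fun x => x ^ k * exp (- x))); auto_derive; trivial. }
  induction n as [|n IH].
  - replace (INR (fact 0)) with (0 - - (0 ^ 0 * exp (- 0))) by (simpl; rewrite Ropp_0, exp_0; ring).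
    apply (rFTC_gen (fun x => 0 < x) _ _ (fun x => - (x ^ 0 * exp (- x)))); trivial.
    + apply dom_filters_pos.
    + intros x _; split; [auto_derive; trivial; simpl; ring | apply Hcont].
  - assert (H : is_RInt_gen (fun x => x ^ S n * exp (- x) - INR (S n) * (x ^ n * exp (- x))) (at_right 0) p_inf (0 - - (0 ^ S n * exp (- 0)))).
    { apply (rFTC_gen (fun x => 0 < x) _ _ (fun x => - (x ^ S n * exp (- x)))); trivial.
      - apply dom_filters_pos.
      - intros x _; split.
        + auto_derive; trivial; cbn [pow Nat.pred]; change (match n with 0%nat => 1 | S _ => INR n + 1 end) with (INR (S n)); ring.
        + apply (continuous_minus (V := R_NormedModule)); [apply Hcont|].
          apply (continuous_scal_r (V := R_NormedModule)); apply Hcont. }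
    assert (H' := is_RInt_gen_plus _ _ _ _ H (is_RInt_gen_scal _ (INR (S n)) _ IH)).
    replace (INR (fact (S n))) with (plus (0 - - (0 ^ S n * exp (- 0))) (scal (INR (S n)) (INR (fact n)))).
    + apply is_RInt_gen_ext with (2 := H').
      apply filter_forall; intros ab x _; unfold plus, scal; simpl; unfold mult; simpl; ring.
    + unfold plus, scal; simpl; unfold mult; simpl.
      rewrite plus_INR, mult_INR; destruct n; simpl; ring.
Qed.

(** The derivative of v^w has modulus |w| v^{Re w - 1}. For v >= 1 this is at most |w|. For v < 1 it
    may be unbounded near 0 but is integrable, with integral (|w| / Re w)(1 - v^{Re w}), at most
    (|w| / Re w)(1 - v) because Re w <= 1. *)
Lemma Rcpow_sub_1 (w : C) (v : R) : 0 < Re w <= 1 -> 0 < v ->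
  Cmod (Rcpow v w - 1) <= 2 / Re w * Cmod w * Rabs (v - 1).
Proof.
  intros [Hw1 Hw2] Hv.
  assert (Hc := Cmod_ge_0 w).
  assert (R1 : Rcpow 1 w = 1) by (unfold Rcpow; rewrite ln_1, Cmult_0_r; apply Cexp_0).
  assert (HM : forall x, 0 < x -> Cmod (w * Rcpow x w / RtoC x) = Cmod w * exp ((Re w - 1) * ln x)).
  { intros x Hx; rewrite Cmod_div, Cmod_mult, Cmod_Rcpow, Cmod_R, Rabs_pos_eq by (try apply RtoC_neq; lra).
    replace ((Re w - 1) * ln x) with (Re w * ln x + - ln x) by ring.
    rewrite exp_plus, exp_Ropp, exp_ln by trivial; unfold Rdiv; ring. }
  assert (H1 : 1 <= / Re w) by (rewrite <- Rinv_1; apply Rinv_le_contravar; lra).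
  destruct (Rle_dec 1 v) as [H|H].
  - rewrite Rabs_pos_eq by lra; rewrite <- R1.
    apply Rle_trans with (2 * (Cmod w * v - Cmod w * 1)).
    + apply (cincr_le (fun x => Rcpow x w) (fun x => w * Rcpow x w / RtoC x)%C (fun x => Cmod w * x) (fun _ => Cmod w)); trivial.
      * intros x Hx; apply cderiv_Rcpow; lra.
      * intros; auto_derive; trivial; ring.
      * intros x Hx; rewrite HM by lra.
        assert (exp ((Re w - 1) * ln x) <= exp 0); [|rewrite exp_0 in *; nra].
        apply exp_le; generalize (ln_ge_0 x ltac:(lra)); nra.
    + replace (2 / Re w * Cmod w * (v - 1)) with (2 * (Cmod w * (v - 1)) * / Re w) by (field; lra).
      assert (0 <= Cmod w * (v - 1)) by (apply Rmult_le_pos; lra). nra.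
  - rewrite Rabs_minus_sym, Rabs_pos_eq by lra; rewrite <- R1.
    replace (Rcpow v w - Rcpow 1 w)%C with (- (Rcpow 1 w - Rcpow v w))%C by ring; rewrite Cmod_opp.
    set (V := fun x => Cmod w / Re w * exp (Re w * ln x)).
    apply Rle_trans with (2 * (V 1 - V v)).
    + apply (cincr_le (fun x => Rcpow x w) (fun x => w * Rcpow x w / RtoC x)%C V (fun x => Cmod w * exp ((Re w - 1) * ln x))); [lra|..].
      * intros x Hx; apply cderiv_Rcpow; lra.
      * intros x Hx; unfold V; auto_derive; [lra|].
        replace ((Re w - 1) * ln x) with (Re w * ln x + - ln x) by ring.
        rewrite exp_plus, exp_Ropp, exp_ln by lra; field; lra.
      * intros x Hx; rewrite HM by lra; lra.
    + unfold V; rewrite ln_1, Rmult_0_r, exp_0.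
      replace (2 / Re w * Cmod w * (1 - v)) with (2 * (Cmod w / Re w * (1 - v))) by (field; lra).
      apply Rmult_le_compat_l; [lra|].
      rewrite <- Rmult_minus_distr_l; apply Rmult_le_compat_l; [apply Rdiv_le_0_compat; lra|].
      assert (exp (ln v) <= exp (Re w * ln v)); [|rewrite exp_ln in *; lra].
      apply exp_le; assert (ln v <= ln 1) by (apply ln_le; lra); rewrite ln_1 in *; nra.
Qed.

Lemma Rcpow_INR (x : R) (n : nat) : 0 < x -> Rcpow x (RtoC (INR n)) = RtoC (x ^ n).
Proof.
  intros Hx; induction n as [|n IH].
  - simpl; unfold Rcpow; rewrite Cmult_0_l; apply Cexp_0.
  - rewrite S_INR, RtoC_plus, Rcpow_plus, IH, Rcpow_1, <- RtoC_mult by trivial; f_equal; simpl; ring.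
Qed.

Lemma Rcpow_mult_base (x y : R) (w : C) : 0 < x -> 0 < y -> Rcpow (x * y) w = (Rcpow x w * Rcpow y w)%C.
Proof.
  intros Hx Hy; unfold Rcpow; rewrite ln_mult, RtoC_plus, <- Cexp_plus by trivial; f_equal; ring.
Qed.

Lemma Re_plus_R (z : C) (r : R) : Re (z + RtoC r) = Re z + r.
Proof. reflexivity. Qed.

Lemma is_CInt_gen_RtoC (g : R -> R) Fa Fb {FFa : Filter Fa} {FFb : Filter Fb} (l : R) :
  is_RInt_gen g Fa Fb l -> is_CInt_gen (fun x => RtoC (g x)) Fa Fb (RtoC l).
Proof.
  intros H P HP.
  assert (K : filterlim RtoC (locally l) (@locally C_R_NormedModule (RtoC l))).
  { apply (ccont_continuous RtoC l), (ccont_RtoC (fun x => x)), continuous_id. }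
  assert (K1 := H _ (K P HP)); unfold filtermapi in *; revert K1; apply filter_imp.
  intros [a b] [y [Hy Py]]; exists (RtoC y); split; [|exact Py].
  apply is_RInt_fct_extend_pair; simpl; [exact Hy|].
  assert (E : scal (b - a) (0 : R_NormedModule) = (0 : R_NormedModule)) by apply Rmult_0_r.
  exact (eq_rect _ (is_RInt (fun _ => 0) a b) (is_RInt_const (V := R_NormedModule) a b 0) _ E).
Qed.

(* A variance bound: under the density u^n e^{-u}/n! with n = m^2, the mean of
   (u/n - 1)^2 is (n + 2)/n^2, so u/n concentrates at 1 with width 1/m. *)
Lemma Gamma_asymptotic (w : C) (m : nat) : 0 < Re w <= 1 -> (1 <= m)%nat ->
  let n := (m * m)%nat in
  Cmod (Gamma (w + RtoC (INR (S n))) - Rcpow (INR n) w * RtoC (INR (fact n)))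
  <= 4 / Re w * Cmod w / INR m * Cmod (Rcpow (INR n) w * RtoC (INR (fact n))).
Proof.
  intros Hw Hm n.
  assert (Hm' : 1 <= INR m) by (apply (le_INR 1); trivial).
  assert (Hn : INR n = INR m * INR m) by apply mult_INR.
  assert (Hn1 : 1 <= INR n) by (rewrite Hn; nra).
  clearbody n.
  assert (Hf : 0 < INR (fact n)) by apply INR_fact_lt_0.
  assert (HG := Gamma_correct (w + RtoC (INR (S n))) ltac:(rewrite Re_plus_R; generalize (pos_INR (S n)); lra)).
  set (P := Rcpow (INR n) w) in *.
  assert (HF := is_CInt_gen_scal _ _ _ (- P) _ (is_CInt_gen_RtoC _ _ _ _ (fact_integral n))).
  assert (HD := is_CInt_gen_plus _ _ _ _ _ _ HG HF).
  assert (M0 := fact_integral n). assert (M1 := fact_integral (S n)). assert (M2 := fact_integral (S (S n))).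
  set (A := Cmod P * (2 / Re w * Cmod w)).
  (* By the inequality of the means, |v - 1| <= (1/m + m (v - 1)^2)/2, which replaces the absolute
     value by a quadratic polynomial in x = v n. The constants are A times its coefficients, so
     three factorial integrals suffice; since n = m^2 the result is A n! (1/m + 1/m^3). *)
  set (c0 := A * (/ INR m + INR m) / 2). set (c1 := - (A * INR m / INR n)). set (c2 := A * INR m / (2 * INR n ^ 2)).
  assert (MM := is_RInt_gen_plus _ _ _ _ (is_RInt_gen_scal _ c0 _ M0)
    (is_RInt_gen_plus _ _ _ _ (is_RInt_gen_scal _ c1 _ M1) (is_RInt_gen_scal _ c2 _ M2))).
  replace (_ - _)%C with (Gamma (w + RtoC (INR (S n))) + - P * RtoC (INR (fact n)))%C by ring.
  eapply Rle_trans.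
  - apply (cRInt_gen_le _ _ _ _ _ _ _ dom_filters_pos) with (2 := HD) (3 := MM).
    intros x Hx.
    change (Cmod (gamma_integrand (w + RtoC (INR (S n))) x + - P * RtoC (x ^ n * exp (- x)))
      <= c0 * (x ^ n * exp (- x)) + (c1 * (x ^ S n * exp (- x)) + c2 * (x ^ S (S n) * exp (- x)))).
    set (v := x / INR n).
    assert (Hv : 0 < v) by (apply Rdiv_lt_0_compat; lra).
    assert (Ex : x = v * INR n) by (unfold v; field; lra).
    assert (E : (gamma_integrand (w + RtoC (INR (S n))) x + - P * RtoC (x ^ n * exp (- x)))%C
      = (P * (Rcpow v w - 1) * RtoC (x ^ n * exp (- x)))%C).
    { unfold gamma_integrand.
      replace (w + RtoC (INR (S n)) - 1)%C with (w + RtoC (INR n))%C by (rewrite S_INR, RtoC_plus; ring).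
      rewrite Rcpow_plus, Rcpow_INR by trivial.
      rewrite Ex at 1; rewrite Rcpow_mult_base by lra; fold P; rewrite RtoC_mult; ring. }
    rewrite E; clear E.
    assert (Hp : 0 < x ^ n * exp (- x)) by (apply Rmult_lt_0_compat; [apply pow_lt; trivial | apply exp_pos]).
    rewrite !Cmod_mult, Cmod_R, Rabs_pos_eq by lra.
    assert (HR := Rcpow_sub_1 w v Hw Hv).
    assert (HA : Cmod P * Cmod (Rcpow v w - 1) <= A * Rabs (v - 1)).
    { unfold A; rewrite Rmult_assoc; apply Rmult_le_compat_l; [apply Cmod_ge_0 | exact HR]. }
    assert (HA0 : 0 <= A).
    { unfold A; repeat apply Rmult_le_pos; try apply Cmod_ge_0; [lra | left; apply Rinv_0_lt_compat; lra]. }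
    assert (HAG : Rabs (v - 1) <= (/ INR m + INR m * (v - 1) ^ 2) / 2).
    { assert (Hs := pow2_ge_0 (1 - INR m * Rabs (v - 1))).
      rewrite <- (pow2_abs (v - 1)).
      apply Rmult_le_reg_l with (INR m); [lra|].
      replace (INR m * ((/ INR m + INR m * Rabs (v - 1) ^ 2) / 2)) with ((1 + INR m ^ 2 * Rabs (v - 1) ^ 2) / 2) by (field; lra).
      simpl in *; nra. }
    apply Rle_trans with (A * ((/ INR m + INR m * (v - 1) ^ 2) / 2) * (x ^ n * exp (- x))).
    { apply Rmult_le_compat_r; [lra|]. eapply Rle_trans; [exact HA|]. apply Rmult_le_compat_l; trivial. }
    right; unfold c0, c1, c2, v; simpl pow; field; lra.
  - unfold plus, scal; simpl; unfold mult; simpl.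
    rewrite Cmod_mult, Cmod_R, Rabs_pos_eq by lra.
    replace (INR (fact n + n * fact n)) with ((INR n + 1) * INR (fact n)) by (rewrite plus_INR, mult_INR; ring).
    replace (INR (fact n + n * fact n + (fact n + n * fact n + n * (fact n + n * fact n))))
      with ((INR n + 2) * (INR n + 1) * INR (fact n)) by (rewrite !plus_INR, !mult_INR, !plus_INR, !mult_INR; ring).
    assert (HA0 : 0 <= A).
    { unfold A; repeat apply Rmult_le_pos; try apply Cmod_ge_0; [lra | left; apply Rinv_0_lt_compat; lra]. }
    apply Rle_trans with (A * INR (fact n) * (2 / INR m)).
    + replace (_ + _) with (A * INR (fact n) * (/ INR m + / INR m ^ 3)).
      2:{ unfold c0, c1, c2; rewrite Hn; field; lra. }
      apply Rmult_le_compat_l; [apply Rmult_le_pos; lra|].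
      apply Rmult_le_reg_r with (INR m ^ 3); [apply pow_lt; lra|].
      replace ((/ INR m + / INR m ^ 3) * INR m ^ 3) with (INR m ^ 2 + 1) by (field; lra).
      replace (2 / INR m * INR m ^ 3) with (2 * INR m ^ 2) by (field; lra).
      simpl; nra.
    + right; unfold A; field; lra.
Qed.

(** * Arguments of complex numbers and the phase of Gauss' product *)

(** A relation rather than an argument function, so that arguments add under multiplication without
    any choice of branch. *)
Definition polar (z : C) (a : R) : Prop := z = (RtoC (Cmod z) * Cexp (0, a))%C.

Lemma Cmod_cis (a : R) : Cmod (Cexp (0, a)) = 1.
Proof. rewrite Cmod_Cexp; apply exp_0. Qed.

Lemma cis_plus (a b : R) : Cexp (0, a + b) = (Cexp (0, a) * Cexp (0, b))%C.
Proof. rewrite <- Cexp_plus; f_equal; unfold Cplus; simpl; f_equal; ring. Qed.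

Lemma polar_intro (z : C) (r a : R) : 0 <= r -> z = (RtoC r * Cexp (0, a))%C -> polar z a.
Proof.
  intros Hr ->; unfold polar; rewrite Cmod_mult, Cmod_cis, Cmod_R, Rabs_pos_eq by trivial.
  now rewrite Rmult_1_r.
Qed.

Lemma polar_mult (z w : C) (a b : R) : polar z a -> polar w b -> polar (z * w) (a + b).
Proof.
  unfold polar; intros Hz Hw; rewrite Cmod_mult, RtoC_mult, cis_plus.
  rewrite Hz at 1; rewrite Hw at 1; ring.
Qed.

Lemma polar_Cexp (z : C) : polar (Cexp z) (Im z).
Proof.
  apply (polar_intro _ (exp (Re z))); [left; apply exp_pos|].
  unfold Cexp, RtoC, Cmult; simpl; rewrite exp_0; f_equal; ring.
Qed.

(** In the right half-plane the arctangent is an argument; all factors 1/4 + it/2 + j of the product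
    lie there. *)
Lemma polar_atan (x y : R) : 0 < x -> polar (x, y) (atan (y / x)).
Proof.
  intros Hx; set (a := atan (y / x)).
  assert (Ha := atan_bound (y / x)); fold a in Ha.
  assert (Hc : 0 < cos a) by (apply cos_gt_0; lra).
  assert (Ht : tan a = y / x) by apply tan_atan.
  apply (polar_intro _ (x / cos a)); [left; apply Rdiv_lt_0_compat; trivial|].
  assert (Hs : sin a = y / x * cos a) by (rewrite <- Ht; unfold tan; field; lra).
  unfold Cexp, RtoC, Cmult; simpl; rewrite exp_0, Hs; f_equal; field; lra.
Qed.

(* The phase of n^{it/2} pi^{-it/2} / prod_{j <= n} (1/4 + it/2 + j), which by
   Gauss' product for Gamma tends to theta t modulo 2 pi. *)
Definition gauss_theta (n : nat) (t : R) : R :=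
  t / 2 * (ln (INR n) - ln PI) - sum_f_R0 (fun j => atan (t / 2 / (1 / 4 + INR j))) n.

Lemma polar_rising (t : R) (n : nat) :
  polar (rising ((1 / 4)%R, (t / 2)%R) (S n)) (sum_f_R0 (fun j => atan (t / 2 / (1 / 4 + INR j))) n).
Proof.
  assert (Hj : forall j, polar (((1 / 4)%R, (t / 2)%R) + RtoC (INR j))%C (atan (t / 2 / (1 / 4 + INR j)))).
  { intros j; unfold Cplus, RtoC; simpl fst; simpl snd; rewrite Rplus_0_r.
    apply polar_atan; generalize (pos_INR j); lra. }
  induction n as [|n IH].
  - change (polar (1 * (((1 / 4)%R, (t / 2)%R) + RtoC (INR 0)))%C (atan (t / 2 / (1 / 4 + INR 0)))).
    rewrite Cmult_1_l; apply Hj.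
  - apply (polar_mult (rising _ (S n))); [exact IH | apply Hj].
Qed.

Lemma Cmod_RtoC_pos (r : R) : 0 <= r -> Cmod (RtoC r) = r.
Proof. intros; rewrite Cmod_R; apply Rabs_pos_eq; trivial. Qed.

(** By [Gamma_asymptotic], rising(w, n+1) Gamma(w) is close to n^w n! in relative terms, where w =
    1/4 + it/2. Two numbers R and Q with |R - Q| <= h |Q| have directions at distance at most 2h.
    Comparing directions makes the integer multiple of 2 pi in Im lG irrelevant. *)
Lemma theta_approx (lG : C -> C) (t : R) (m : nat) : is_logGamma lG -> (1 <= m)%nat ->
  Cmod (Cexp (0, theta lG t) - Cexp (0, gauss_theta (m * m) t)) <= 32 * (1 + Rabs t) / INR m.
Proof.
  intros [_ [HlG _]] Hm.
  set (w := ((1 / 4)%R, (t / 2)%R) : C); set (n := (m * m)%nat).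
  set (S0 := sum_f_R0 (fun j => atan (t / 2 / (1 / 4 + INR j))) n).
  assert (Hw : 0 < Re w <= 1) by (simpl; lra).
  assert (Hm' : 1 <= INR m) by (apply (le_INR 1); trivial).
  assert (Hn1 : 1 <= INR n) by (unfold n; rewrite mult_INR; nra).
  assert (HA := Gamma_asymptotic w m Hw Hm); cbv zeta in HA; fold n in HA.
  rewrite Gamma_rising, <- HlG in HA by apply Hw.
  set (Q := (Rcpow (INR n) w * RtoC (INR (fact n)))%C) in *.
  assert (PQ : polar Q (t / 2 * ln (INR n))).
  { replace (t / 2 * ln (INR n)) with (Im (w * RtoC (ln (INR n))) + 0) by (simpl; ring).
    apply polar_mult; [apply polar_Cexp|].
    apply (polar_intro _ (INR (fact n))); [apply pos_INR|].
    change (0, 0) with (RtoC 0); rewrite Cexp_0; ring. }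
  assert (PR := polar_mult _ _ _ _ (polar_rising t n) (polar_Cexp (lG w))).
  fold w S0 in PR; set (Rn := (rising w (S n) * Cexp (lG w))%C) in *.
  assert (HQ : 0 < Cmod Q).
  { unfold Q; rewrite Cmod_mult, Cmod_Rcpow, Cmod_RtoC_pos by apply pos_INR.
    apply Rmult_lt_0_compat; [apply exp_pos | apply INR_fact_lt_0]. }
  assert (Hcw : Cmod w <= 1 + Rabs t).
  { eapply Rle_trans; [apply Cmod_le_2 with (m := 1 / 4 + Rabs t / 2)|]; [..|lra]; simpl.
    - rewrite Rabs_pos_eq by lra; generalize (Rabs_pos t); lra.
    - unfold Rdiv at 1; rewrite Rabs_mult, (Rabs_pos_eq (/ 2)) by lra; lra. }
  unfold theta; fold w.
  set (a := Im (lG w)) in *.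
  (* A common unimodular factor is taken out; what is left are the directions of the two sides of
     Gauss' product. *)
  replace (Cexp (0, (a - t / 2 * ln PI)%R) - Cexp (0, gauss_theta n t))%C
    with (Cexp (0, (- S0 - t / 2 * ln PI)%R) * (Cexp (0, (S0 + a)%R) - Cexp (0, (t / 2 * ln (INR n))%R)))%C.
  2:{ unfold gauss_theta; fold S0; set (u := (- S0 - t / 2 * ln PI)%R).
      replace (a - t / 2 * ln PI) with (u + (S0 + a)) by (unfold u; ring).
      replace (t / 2 * (ln (INR n) - ln PI) - S0) with (u + t / 2 * ln (INR n)) by (unfold u; ring).
      rewrite (cis_plus u (S0 + a)), (cis_plus u (t / 2 * ln (INR n))); ring. }
  rewrite Cmod_mult, Cmod_cis, Rmult_1_l.
  set (ea := Cexp (0, (S0 + a)%R)) in *; set (eb := Cexp (0, (t / 2 * ln (INR n))%R)) in *.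
  unfold polar in PQ, PR; fold eb in PQ; fold ea in PR.
  assert (H1 : Cmod Q * Cmod (ea - eb) <= 2 * Cmod (Rn - Q)).
  { rewrite <- (Cmod_RtoC_pos (Cmod Q)) at 1 by lra; rewrite <- Cmod_mult.
    replace (RtoC (Cmod Q) * (ea - eb))%C with (RtoC (Cmod Q - Cmod Rn) * ea + (Rn - Q))%C.
    2:{ rewrite PR at 2; rewrite PQ at 2; rewrite RtoC_minus; ring. }
    eapply Rle_trans; [apply Cmod_triangle|].
    rewrite Cmod_mult; unfold ea at 1; rewrite Cmod_cis, Cmod_R, Rmult_1_r.
    assert (Rabs (Cmod Q - Cmod Rn) <= Cmod (Rn - Q)); [|lra].
    assert (T1 : Cmod Q <= Cmod Rn + Cmod (Rn - Q)).
    { rewrite <- (Cmod_opp (Rn - Q)); replace Q with (Rn + - (Rn - Q))%C at 1 by ring; apply Cmod_triangle. }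
    assert (T2 : Cmod Rn <= Cmod Q + Cmod (Rn - Q)).
    { replace Rn with (Q + (Rn - Q))%C at 1 by ring; apply Cmod_triangle. }
    apply Rabs_le; lra. }
  apply Rmult_le_reg_l with (Cmod Q); trivial.
  eapply Rle_trans; [exact H1|].
  eapply Rle_trans; [apply Rmult_le_compat_l; [lra | exact HA]|].
  simpl Re.
  replace (2 * (4 / (1 / 4) * Cmod w / INR m * Cmod Q)) with (Cmod Q * (32 * Cmod w / INR m)) by (field; lra).
  apply Rmult_le_compat_l; [lra|]; unfold Rdiv; apply Rmult_le_compat_r; [left; apply Rinv_0_lt_compat; lra | lra].
Qed.

(** * The phase theta *)

(** Polynomials as functions, without coefficient lists. Closure under pointwise equality takes the
    place of functional extensionality. *)
Inductive cpoly : (R -> C) -> Prop :=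
| cpoly_const (c : C) : cpoly (fun _ => c)
| cpoly_id : cpoly RtoC
| cpoly_plus (f g : R -> C) : cpoly f -> cpoly g -> cpoly (fun x => f x + g x)%C
| cpoly_mult (f g : R -> C) : cpoly f -> cpoly g -> cpoly (fun x => f x * g x)%C
| cpoly_ext (f g : R -> C) : (forall x, f x = g x) -> cpoly f -> cpoly g.

Lemma cpoly_pow (f : R -> C) (k : nat) : cpoly f -> cpoly (fun x => Cpow (f x) k).
Proof.
  intros Hf; induction k as [|k IH]; simpl; [apply cpoly_const | apply cpoly_mult; trivial].
Qed.

(* Coefficients of y^k in the geometric expansion of
   d/dy atan((tau + y)/q) = Re(1/(w + i y)), w = q + i tau. *)
Definition atan_coef (q tau : R) (k : nat) : R := Re (Cpow (- Ci / (q, tau)) k / (q, tau))%C.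

(** Taylor terms of degrees 2 to m + 1 only: the constant term is a fixed phase and the linear one
    contributes to the frequency. *)
Fixpoint atan_poly (q tau : R) (m : nat) (y : R) : R :=
  match m with
  | O => 0
  | S m => atan_poly q tau m y + atan_coef q tau (S m) / INR (S (S m)) * y ^ S (S m)
  end.

Fixpoint atan_poly' (q tau : R) (m : nat) (y : R) : R :=
  match m with
  | O => 0
  | S m => atan_poly' q tau m y + atan_coef q tau (S m) * y ^ S m
  end.

Lemma atan_poly_deriv q tau m y : is_derive (atan_poly q tau m) y (atan_poly' q tau m y).
Proof.
  induction m as [|m IH].
  - apply is_derive_Reals, derivable_pt_lim_const.
  - apply (is_derive_plus (atan_poly q tau m) (fun y => atan_coef q tau (S m) / INR (S (S m)) * y ^ S (S m))); [exact IH|].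
    assert (0 < INR (S (S m))) by (apply lt_0_INR; lia).
    apply is_derive_Reals.
    replace (atan_coef q tau (S m) * y ^ S m) with (atan_coef q tau (S m) / INR (S (S m)) * (INR (S (S m)) * y ^ S m)).
    + apply derivable_pt_lim_scal, (derivable_pt_lim_pow y (S (S m))).
    + field; lra.
Qed.

Lemma cpoly_atan_poly q tau m (s : R) : cpoly (fun x => RtoC (atan_poly q tau m (s * x))).
Proof.
  induction m as [|m IH]; [apply (cpoly_const (RtoC 0))|].
  apply cpoly_ext with (fun x => RtoC (atan_poly q tau m (s * x))
    + RtoC (atan_coef q tau (S m) / INR (S (S m))) * Cpow (RtoC s * RtoC x) (S (S m)))%C.
  - intros x; cbn [atan_poly]; rewrite RtoC_plus, RtoC_mult, <- RtoC_mult, RtoC_pow; reflexivity.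
  - apply cpoly_plus; trivial; apply cpoly_mult; [apply cpoly_const | apply cpoly_pow, cpoly_mult; [apply cpoly_const | apply cpoly_id]].
Qed.

Lemma atan_poly_0 q tau m : atan_poly q tau m 0 = 0.
Proof.
  induction m as [|m IH]; trivial; cbn [atan_poly]; rewrite IH, pow_ne_zero by lia; ring.
Qed.

Section AtanTaylor.
Variables (q tau : R).
Hypotheses (Hq : 0 < q) (Htau : 1 <= tau).
Let w : C := (q, tau).

Local Lemma w_ge_q y : q <= Cmod (q, y).
Proof. generalize (re_le_Cmod (q, y)) (Rle_abs q); simpl; lra. Qed.

Local Lemma w_ge_tau : tau <= Cmod w.
Proof. generalize (im_le_Cmod w) (Rle_abs tau); simpl; lra. Qed.

Local Lemma w_neq y : (q, y) <> (0 : C).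
Proof. intros E; apply (f_equal fst) in E; simpl in E; lra. Qed.

(** The modulus of the complex coefficient is |w|^{-(k+2)}. Just one factor is bounded by 1/q, so
    that summation over j produces a logarithm, and one by 1/tau, which is the gain of a power of
    T. *)
Lemma atan_coef_le (k : nat) : Rabs (atan_coef q tau (S k)) <= / (q * tau).
Proof.
  unfold atan_coef; eapply Rle_trans; [apply re_le_Cmod|].
  assert (H1 := w_ge_q tau); assert (H2 := w_ge_tau); fold w in H1 |- *.
  rewrite Cmod_div, Cmod_pow, Cmod_div by apply w_neq.
  rewrite Cmod_opp, Cmod_Ci.
  assert (H3 : 0 < / Cmod w <= 1).
  { split; [apply Rinv_0_lt_compat; lra|]. rewrite <- Rinv_1; apply Rinv_le_contravar; lra. }
  assert (H4 : (/ Cmod w) ^ k <= 1) by (rewrite <- (pow1 k); apply pow_incr; lra).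
  assert (H5 : 0 <= (/ Cmod w) ^ k) by (apply pow_le; lra).
  unfold Rdiv; rewrite Rmult_1_l; simpl pow; rewrite Rinv_mult.
  assert (/ Cmod w <= / q) by (apply Rinv_le_contravar; lra).
  assert (/ Cmod w <= / tau) by (apply Rinv_le_contravar; lra).
  replace (/ Cmod w * (/ Cmod w) ^ k * / Cmod w) with (/ Cmod w * (/ Cmod w * (/ Cmod w) ^ k)) by ring.
  apply Rmult_le_compat; try lra; [apply Rmult_le_pos; lra|].
  assert (/ Cmod w * (/ Cmod w) ^ k <= / Cmod w * 1) by (apply Rmult_le_compat_l; lra). lra.
Qed.

Lemma atan_poly_le (m : nat) (y : R) : Rabs (atan_poly q tau m y) <= INR m * (1 + Rabs y) ^ S m / (q * tau).
Proof.
  assert (Hqt : 0 < q * tau) by (apply Rmult_lt_0_compat; lra).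
  assert (Hy := Rabs_pos y).
  induction m as [|m IH].
  - simpl; rewrite Rabs_R0; unfold Rdiv; rewrite 2!Rmult_0_l; lra.
  - cbn [atan_poly]; eapply Rle_trans; [apply Rabs_triang|].
    assert (H1 : (1 + Rabs y) ^ S m <= (1 + Rabs y) ^ S (S m)) by (apply Rle_pow; [lra | lia]).
    assert (H2 : Rabs (atan_coef q tau (S m) / INR (S (S m)) * y ^ S (S m)) <= / (q * tau) * (1 + Rabs y) ^ S (S m)).
    { rewrite Rabs_mult; apply Rmult_le_compat; try apply Rabs_pos.
      - unfold Rdiv; rewrite Rabs_mult.
        assert (0 < / INR (S (S m)) <= 1).
        { split; [apply Rinv_0_lt_compat, lt_0_INR; lia|]. rewrite <- Rinv_1; apply Rinv_le_contravar; [lra|]. apply (le_INR 1); lia. }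
        rewrite (Rabs_pos_eq (/ _)) by lra.
        generalize (atan_coef_le m) (Rabs_pos (atan_coef q tau (S m))); nra.
      - rewrite <- RPow_abs; apply pow_incr; lra. }
    rewrite (S_INR m).
    assert (H3 : INR m * (1 + Rabs y) ^ S m / (q * tau) <= INR m * (1 + Rabs y) ^ S (S m) / (q * tau)).
    { unfold Rdiv; apply Rmult_le_compat_r; [left; apply Rinv_0_lt_compat; trivial|].
      apply Rmult_le_compat_l; [apply pos_INR | trivial]. }
    replace ((INR m + 1) * (1 + Rabs y) ^ S (S m) / (q * tau))
      with (INR m * (1 + Rabs y) ^ S (S m) / (q * tau) + / (q * tau) * (1 + Rabs y) ^ S (S m)) by (field; lra).
    lra.
Qed.

(** The exact remainder of the geometric series for 1/(w + iy), in real parts. It holds for all y,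
    not only inside the disc of convergence. *)
Lemma atan_poly'_spec (m : nat) (y : R) :
  q / (q ^ 2 + (tau + y) ^ 2) - q / (q ^ 2 + tau ^ 2) - atan_poly' q tau m y
  = Re (Cpow (- Ci / w * RtoC y) (S m) / (w + Ci * RtoC y))%C.
Proof.
  assert (E : (w + Ci * RtoC y)%C = (q, tau + y)).
  { unfold w, Ci, RtoC, Cplus, Cmult; simpl; f_equal; ring. }
  assert (Hn : forall u, q / (q ^ 2 + u ^ 2) = Re (/ (q, u))%C) by reflexivity.
  assert (Hw : w <> 0) by apply w_neq.
  assert (Hw' : (w + Ci * RtoC y)%C <> 0) by (rewrite E; apply w_neq).
  induction m as [|m IH].
  - cbn [atan_poly']; rewrite Rminus_0_r, 2!Hn, <- E; fold w.
    change (Re (/ (w + Ci * RtoC y) - / w)%C = Re (Cpow (- Ci / w * RtoC y) 1 / (w + Ci * RtoC y))%C).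
    f_equal; simpl; field; split; trivial.
  - cbn [atan_poly'].
    replace (_ - _ - _) with ((q / (q ^ 2 + (tau + y) ^ 2) - q / (q ^ 2 + tau ^ 2) - atan_poly' q tau m y) - atan_coef q tau (S m) * y ^ S m) by ring.
    rewrite IH; unfold atan_coef; fold w.
    replace (Re (Cpow (- Ci / w) (S m) / w)%C * y ^ S m) with (Re (Cpow (- Ci / w * RtoC y) (S m) / w)%C).
    2:{ rewrite Cpow_mult_l, <- RtoC_pow.
        replace (Cpow (- Ci / w) (S m) * RtoC (y ^ S m) / w)%C with (Cpow (- Ci / w) (S m) / w * RtoC (y ^ S m))%C by (field; trivial).
        generalize (Cpow (- Ci / w) (S m) / w)%C; intros [u v]; simpl; ring. }
    rewrite (Cpow_S _ (S m)); set (P := Cpow (- Ci / w * RtoC y) (S m)).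
    change (Re (P / (w + Ci * RtoC y) - P / w)%C = Re ((- Ci / w * RtoC y) * P / (w + Ci * RtoC y))%C).
    f_equal; field; split; trivial.
Qed.

(** The remainder of [atan_poly'_spec] is integrated from 0 to y. No restriction on y arises,
    because |w + iy| >= q even where tau + y vanishes; all the other factors use |w| >= tau. *)
Lemma atan_taylor (m : nat) (y : R) :
  Rabs (atan ((tau + y) / q) - atan (tau / q) - q / (q ^ 2 + tau ^ 2) * y - atan_poly q tau m y)
  <= (1 + Rabs y) ^ S (S m) / (q * tau ^ S m).
Proof.
  set (f := fun y => atan ((tau + y) / q) - atan (tau / q) - q / (q ^ 2 + tau ^ 2) * y - atan_poly q tau m y).
  set (f' := fun y => q / (q ^ 2 + (tau + y) ^ 2) - q / (q ^ 2 + tau ^ 2) - atan_poly' q tau m y).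
  assert (Hd : forall y, is_derive f y (f' y)).
  { intros x; unfold f, f'.
    apply (is_derive_minus (fun y => atan ((tau + y) / q) - atan (tau / q) - q / (q ^ 2 + tau ^ 2) * y) (atan_poly q tau m)); [|apply atan_poly_deriv].
    auto_derive; [lra|].
    assert (0 < q ^ 2) by (apply pow_lt; trivial).
    assert (H1 := pow2_ge_0 (tau + x)); assert (H2 := pow2_ge_0 tau).
    field; repeat split; try lra; simpl in *; nra. }
  assert (Hf' : forall x, Rabs (f' x) <= Rabs x ^ S m / (q * tau ^ S m)).
  { intros x; unfold f'; rewrite atan_poly'_spec.
    eapply Rle_trans; [apply re_le_Cmod|].
    assert (E : (w + Ci * RtoC x)%C = (q, tau + x)).
    { unfold w, Ci, RtoC, Cplus, Cmult; simpl; f_equal; ring. }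
    rewrite E, Cmod_div, Cmod_pow, Cmod_mult, Cmod_div, Cmod_opp, Cmod_Ci, Cmod_R by apply w_neq.
    assert (H1 := w_ge_q (tau + x)); assert (H2 := w_ge_tau); assert (H3 := Rabs_pos x).
    rewrite Rpow_mult_distr; unfold Rdiv; rewrite Rmult_1_l, Rinv_mult, <- pow_inv.
    assert (H4 : (/ Cmod w) ^ S m <= (/ tau) ^ S m).
    { apply pow_incr; split; [left; apply Rinv_0_lt_compat; lra | apply Rinv_le_contravar; lra]. }
    assert (H5 : / Cmod (q, tau + x) <= / q) by (apply Rinv_le_contravar; lra).
    assert (H6 : 0 <= Rabs x ^ S m) by (apply pow_le; trivial).
    assert (H7 : 0 <= (/ Cmod w) ^ S m) by (apply pow_le; left; apply Rinv_0_lt_compat; lra).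
    assert (H8 : 0 < / Cmod (q, tau + x)) by (apply Rinv_0_lt_compat; lra).
    replace (Rabs x ^ S m * (/ q * (/ tau) ^ S m)) with ((/ tau) ^ S m * Rabs x ^ S m * / q) by ring.
    apply Rmult_le_compat; try lra; [apply Rmult_le_pos; lra | apply Rmult_le_compat_r; lra]. }
  assert (Hf0 : f 0 = 0).
  { unfold f; rewrite atan_poly_0, Rplus_0_r; ring. }
  destruct (MVT_gen f 0 y f') as [c [Hc He]].
  - intros x _; apply Hd.
  - intros x _; apply continuity_pt_filterlim, (ex_derive_continuous f); eexists; apply Hd.
  - rewrite Hf0, 2!Rminus_0_r in He; fold (f y); rewrite He, Rabs_mult.
    assert (Hcy : Rabs c <= Rabs y).
    { revert Hc; unfold Rmin, Rmax; destruct (Rle_dec 0 y); unfold Rabs; repeat destruct Rcase_abs; lra. }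
    assert (Hp : 0 < q * tau ^ S m) by (apply Rmult_lt_0_compat; [lra | apply pow_lt; lra]).
    assert (H1 : Rabs c ^ S m <= (1 + Rabs y) ^ S m) by (apply pow_incr; generalize (Rabs_pos c); lra).
    assert (H2 := Rabs_pos y). assert (H0 := Hf' c).
    apply Rle_trans with ((1 + Rabs y) ^ S m / (q * tau ^ S m) * (1 + Rabs y)).
    + apply Rmult_le_compat; try apply Rabs_pos; [|lra].
      eapply Rle_trans; [exact H0|]; unfold Rdiv; apply Rmult_le_compat_r; trivial; left; apply Rinv_0_lt_compat; trivial.
    + right; cbn [pow]; unfold Rdiv; ring.
Qed.

End AtanTaylor.

(** * Taylor polynomials of the exponential on the imaginary axis *)

Fixpoint exp_poly (J : nat) (w : C) : C :=
  match J with O => 0 | S J => exp_poly J w + Cpow w J / RtoC (INR (fact J)) end%C.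

Lemma cpoly_exp_poly (J : nat) (f : R -> C) : cpoly f -> cpoly (fun x => exp_poly J (f x)).
Proof.
  intros Hf; induction J as [|J IH]; [apply (cpoly_const 0)|].
  apply cpoly_plus; trivial; apply cpoly_mult; [apply cpoly_pow; trivial | apply cpoly_const].
Qed.

Lemma exp_poly_0 (J : nat) : exp_poly (S J) 0 = 1.
Proof.
  induction J as [|J IH].
  - simpl; field.
  - replace (exp_poly (S (S J)) 0) with (exp_poly (S J) 0 + Cpow 0 (S J) / RtoC (INR (fact (S J))))%C by reflexivity.
    rewrite IH, Cpow_S; unfold Cdiv; ring.
Qed.

Lemma fact_neq (J : nat) : RtoC (INR (fact J)) <> 0.
Proof. apply RtoC_neq, INR_fact_neq_0. Qed.

Lemma cderiv_exp_poly (J : nat) (w : C) (y : R) :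
  cderiv (fun y => exp_poly (S J) (w * RtoC y)) y (w * exp_poly J (w * RtoC y))%C.
Proof.
  induction J as [|J IH].
  - eapply cderiv_eq; [|symmetry; apply Cmult_0_r].
    assert (H := cderiv_const (0 + 1 / RtoC (INR (fact 0)))%C y); exact H.
  - assert (HP : cderiv (fun y => Cpow w (S J) / RtoC (INR (fact (S J))) * RtoC (y ^ S J))%C y
      (w * (Cpow (w * RtoC y) J / RtoC (INR (fact J))))%C).
    { eapply cderiv_eq.
      - apply cderiv_mult; [apply cderiv_const|].
        apply (cderiv_RtoC (fun y => y ^ S J) y (INR (S J) * y ^ J)).
        apply is_derive_Reals, (derivable_pt_lim_pow y (S J)).
      - rewrite fact_simpl, mult_INR, !RtoC_mult, (Cpow_S w J), Cpow_mult_l, !RtoC_pow.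
        field; split; [apply fact_neq | apply RtoC_neq, not_0_INR; lia]. }
    assert (H := cderiv_plus _ _ _ _ _ IH HP).
    rewrite <- Cmult_plus_distr_l in H; destruct H as [H1 H2].
    assert (E : forall y, (exp_poly (S J) (w * RtoC y) + Cpow w (S J) / RtoC (INR (fact (S J))) * RtoC (y ^ S J))%C = exp_poly (S (S J)) (w * RtoC y)).
    { intros u; change (exp_poly (S (S J)) (w * RtoC u)) with (exp_poly (S J) (w * RtoC u) + Cpow (w * RtoC u) (S J) / RtoC (INR (fact (S J))))%C.
      rewrite Cpow_mult_l, RtoC_pow; unfold Cdiv; ring. }
    split.
    + apply is_derive_ext with (2 := H1); intros u; now rewrite E.
    + apply is_derive_ext with (2 := H2); intros u; now rewrite E.
Qed.

(** Induction on J by integrating the previous bound; on the imaginary axis the start is |e^{wy}| =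
    1. Each integration through [cincr_le] costs a factor 2, whence (2 |w| y)^J; the gain 1/J! is
    given away. *)
Lemma Cexp_sub_poly_path (J : nat) (w : C) (y : R) : Re w = 0 -> 0 <= y ->
  Cmod (Cexp (w * RtoC y) - exp_poly J (w * RtoC y)) <= (2 * Cmod w * y) ^ J.
Proof.
  intros Hw; revert y; induction J as [|J IH]; intros y Hy.
  - simpl; unfold Cminus; rewrite Copp_0, Cplus_0_r, Cmod_Cexp.
    replace (Re (w * RtoC y)) with 0; [rewrite exp_0; lra|].
    destruct w as [u v]; simpl in *; rewrite Hw; ring.
  - set (f := fun y => (Cexp (w * RtoC y) + - (1) * exp_poly (S J) (w * RtoC y))%C).
    assert (Hc := Cmod_ge_0 w).
    replace (Cexp (w * RtoC y) - exp_poly (S J) (w * RtoC y))%C with (f y - f 0)%C.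
    2:{ unfold f; rewrite Cmult_0_r, Cexp_0, exp_poly_0; ring. }
    assert (HS : 1 <= INR (S J)) by (apply (le_INR 1); lia).
    set (v := fun y => (2 * Cmod w) ^ J * Cmod w / INR (S J) * y ^ S J).
    eapply Rle_trans.
    + apply (cincr_le f (fun y => w * (Cexp (w * RtoC y) - exp_poly J (w * RtoC y)))%C v
        (fun y => (2 * Cmod w) ^ J * Cmod w * y ^ J) 0 y Hy).
      * intros x Hx; eapply cderiv_eq; [apply cderiv_plus; [apply cderiv_Cexp | apply cderiv_mult; [apply cderiv_const | apply cderiv_exp_poly]]|]; cbv beta; ring.
      * intros x Hx; apply is_derive_Reals; unfold v.
        replace ((2 * Cmod w) ^ J * Cmod w * x ^ J) with ((2 * Cmod w) ^ J * Cmod w / INR (S J) * (INR (S J) * x ^ J)) by (field; lra).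
        apply derivable_pt_lim_scal, (derivable_pt_lim_pow x (S J)).
      * intros x Hx; rewrite Cmod_mult.
        generalize (IH x ltac:(lra)); rewrite Rpow_mult_distr; intros H.
        replace ((2 * Cmod w) ^ J * Cmod w * x ^ J) with (Cmod w * ((2 * Cmod w) ^ J * x ^ J)) by ring.
        apply Rmult_le_compat_l; trivial.
    + unfold v; rewrite (pow_ne_zero (S J)), Rmult_0_r, Rminus_0_r by lia.
      replace ((2 * Cmod w * y) ^ S J) with ((2 * Cmod w) ^ J * Cmod w * 2 * y ^ S J) by (rewrite (Rpow_mult_distr (2 * Cmod w) y); simpl; ring).
      assert (0 <= (2 * Cmod w) ^ J * Cmod w * y ^ S J).
      { repeat apply Rmult_le_pos; trivial; apply pow_le; lra. }
      assert (/ INR (S J) <= 1) by (rewrite <- Rinv_1; apply Rinv_le_contravar; lra).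
      unfold Rdiv; nra.
Qed.

Lemma Cexp_sub_poly (J : nat) (y : R) : Cmod (Cexp (0, y) - exp_poly J (0, y)) <= (2 * Rabs y) ^ J.
Proof.
  generalize (Cexp_sub_poly_path J (0, y) 1 eq_refl ltac:(lra)); rewrite Cmult_1_r, Rmult_1_r.
  replace (Cmod (0, y)) with (Rabs y); trivial.
  unfold Cmod; simpl; replace (0 * (0 * 1) + y * (y * 1)) with (Rsqr y) by (unfold Rsqr; ring).
  symmetry; apply sqrt_Rsqr_abs.
Qed.

Lemma cis_lipschitz (a b : R) : Cmod (Cexp (0, a) - Cexp (0, b)) <= 2 * Rabs (a - b).
Proof.
  replace (Cexp (0, a) - Cexp (0, b))%C with (Cexp (0, b) * (Cexp (0, (a - b)%R) - exp_poly 1 (0, (a - b)%R)))%C.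
  - rewrite Cmod_mult, Cmod_cis, Rmult_1_l.
    generalize (Cexp_sub_poly 1 (a - b)); now rewrite pow_1.
  - assert (E : Cexp (0, a) = (Cexp (0, b) * Cexp (0, (a - b)%R))%C).
    { rewrite <- cis_plus; f_equal; f_equal; ring. }
    rewrite E; simpl; field.
Qed.

(** * The derivative of the phase of Gauss' product *)

Definition inv_sum (n : nat) : R := sum_f_R0 (fun j => / (1 / 4 + INR j)) n.

(** The first two terms, 4 + 4/5, account for the 5; each later one is below an increment of the
    logarithm. *)
Lemma inv_sum_le (n : nat) : (1 <= n)%nat -> inv_sum n <= 5 + ln (INR n).
Proof.
  intros Hn; induction n as [|n IH]; [lia|].
  destruct n as [|n].
  - unfold inv_sum; simpl; rewrite ln_1; lra.
  - assert (H := IH ltac:(lia)); unfold inv_sum in *; rewrite tech5.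
    assert (Hp : 1 <= INR (S n)) by (apply (le_INR 1); lia).
    rewrite (S_INR (S n)); set (x := INR (S n)) in *.
    assert (H1 : ln (x / (x + 1)) <= x / (x + 1) - 1).
    { generalize (exp_ineq1_le (ln (x / (x + 1)))); rewrite exp_ln by (apply Rdiv_lt_0_compat; lra); lra. }
    rewrite ln_div in H1 by lra.
    assert (/ (1 / 4 + (x + 1)) <= / (x + 1)) by (apply Rinv_le_contravar; lra).
    replace (x / (x + 1) - 1) with (- / (x + 1)) in H1 by (field; lra). lra.
Qed.

(** The derivative at tau of the sum over j of u -> arctan(u/(1/4 + j)). *)
Definition lorentz_sum (tau : R) (n : nat) : R :=
  sum_f_R0 (fun j => (1 / 4 + INR j) / ((1 / 4 + INR j) ^ 2 + tau ^ 2)) n.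

Lemma lorentz_sum_le (tau : R) (n : nat) : lorentz_sum tau n <= inv_sum n.
Proof.
  apply sum_Rle; intros j _; set (q := 1 / 4 + INR j).
  assert (Hq : 0 < q) by (unfold q; generalize (pos_INR j); lra).
  assert (H := pow2_ge_0 tau).
  apply Rmult_le_reg_r with (q ^ 2 + tau ^ 2); [nra|].
  replace (q / (q ^ 2 + tau ^ 2) * (q ^ 2 + tau ^ 2)) with q by (field; nra).
  apply Rmult_le_reg_l with q; trivial.
  replace (q * (/ q * (q ^ 2 + tau ^ 2))) with (q ^ 2 + tau ^ 2) by (field; lra). nra.
Qed.

(** Up to 1/(2 q^2), a term is at least half the increment of log(q^2 + tau^2) from q to q + 1. For
    q > 1, 1/q^2 is bounded by the telescoping 1/(q - 1/2) - 1/(q + 1/2). The 20 has room for the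
    first term, q = 1/4, where 1/q^2 = 16, and for the initial value 4/3 of the telescoping part. *)
Lemma lorentz_sum_ge (tau : R) (n : nat) :
  ln ((5 / 4 + INR n) ^ 2 + tau ^ 2) / 2 - ln ((1 / 4) ^ 2 + tau ^ 2) / 2 - (20 - / (INR n + 3 / 4)) / 2
  <= lorentz_sum tau n.
Proof.
  assert (Ht := pow2_ge_0 tau).
  assert (Hstep : forall q, 0 < q ->
    ln ((1 + q) ^ 2 + tau ^ 2) / 2 - ln (q ^ 2 + tau ^ 2) / 2 <= q / (q ^ 2 + tau ^ 2) + / q ^ 2 / 2).
  { intros q Hq.
    assert (H1 : 0 < q ^ 2) by (apply pow_lt; trivial).
    assert (H2 : 0 < (1 + q) ^ 2) by (apply pow_lt; lra).
    set (A := (1 + q) ^ 2 + tau ^ 2); set (B := q ^ 2 + tau ^ 2).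
    assert (HA : 0 < A) by (unfold A; lra). assert (HB : 0 < B) by (unfold B; lra).
    assert (H3 : ln (A / B) <= A / B - 1).
    { generalize (exp_ineq1_le (ln (A / B))); rewrite exp_ln by (apply Rdiv_lt_0_compat; lra); lra. }
    rewrite ln_div in H3 by lra.
    assert (H4 : A / B - 1 = (2 * q + 1) / B) by (replace A with (B + (2 * q + 1)) by (unfold A, B; ring); field; lra).
    assert (H5 : / B <= / q ^ 2) by (apply Rinv_le_contravar; unfold B; lra).
    unfold Rdiv in *; nra. }
  induction n as [|n IH].
  - unfold lorentz_sum; cbn [sum_f_R0 INR]; rewrite !Rplus_0_r.
    generalize (Hstep (1 / 4) ltac:(lra)).
    replace (1 + 1 / 4) with (5 / 4) by field.
    replace (/ (1 / 4) ^ 2) with 16 by field.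
    replace (/ (0 + 3 / 4)) with (4 / 3) by field. lra.
  - unfold lorentz_sum; rewrite tech5; fold (lorentz_sum tau n).
    rewrite S_INR; assert (Hn := pos_INR n).
    generalize (Hstep (5 / 4 + INR n) ltac:(lra)).
    replace (1 + (5 / 4 + INR n)) with (5 / 4 + (INR n + 1)) by ring.
    replace (1 / 4 + (INR n + 1)) with (5 / 4 + INR n) by field.
    set (q := 5 / 4 + INR n) in *.
    assert (/ q ^ 2 <= / (INR n + 3 / 4) - / (INR n + 1 + 3 / 4)); [|lra].
    replace (INR n + 3 / 4) with (q - 1 / 2) by (unfold q; field).
    replace (INR n + 1 + 3 / 4) with (q + 1 / 2) by (unfold q; field).
    assert (1 < q) by (unfold q; lra).
    replace (/ (q - 1 / 2) - / (q + 1 / 2)) with (/ (q ^ 2 - 1 / 4)) by (field; nra).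
    apply Rinv_le_contravar; nra.
Qed.

Lemma sum_f_R0_Rabs_le (f g : nat -> R) (n : nat) :
  (forall j, Rabs (f j) <= g j) -> Rabs (sum_f_R0 f n) <= sum_f_R0 g n.
Proof.
  intros H; eapply Rle_trans; [apply Rsum_abs|]; apply sum_Rle; intros; apply H.
Qed.

Lemma cpoly_sum (f : nat -> R -> R) (n : nat) :
  (forall j, cpoly (fun x => RtoC (f j x))) -> cpoly (fun x => RtoC (sum_f_R0 (fun j => f j x) n)).
Proof.
  intros H; induction n as [|n IH]; [apply H|].
  apply cpoly_ext with (fun x => RtoC (sum_f_R0 (fun j => f j x) n) + RtoC (f (S n) x))%C.
  - intros x; cbn [sum_f_R0]; now rewrite RtoC_plus.
  - apply cpoly_plus; trivial.
Qed.

(** Here [om] is the derivative of [gauss_theta n] at t, and [q] collects the degrees 2 to m + 1. In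
    both bounds for [om] the two occurrences of log n cancel, so they are uniform in n; this matters
    because n will be a large power of T. The lower bound only uses [lorentz_sum_le]. *)
Lemma gauss_theta_taylor (n m : nat) (t : R) : (1 <= n)%nat -> 2 <= t ->
  exists (om : R) (q : R -> R),
    - (5 + ln PI) / 2 <= om <= ln (t / 2) / 2 + 12 /\
    cpoly (fun x => RtoC (q x)) /\ q 0 = 0 /\
    (forall x, Rabs (q x) <= INR m * (5 + ln (INR n)) * (1 + Rabs x) ^ S m / (t / 2)) /\
    (forall x, Rabs (gauss_theta n (t + x) - gauss_theta n t - om * x - q x)
      <= (5 + ln (INR n)) * (1 + Rabs x) ^ S (S m) / (t / 2) ^ S m).
Proof.
  intros Hn Ht; set (tau := t / 2); assert (Htau : 1 <= tau) by (unfold tau; lra).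
  assert (HL := inv_sum_le n Hn); set (Lam := 5 + ln (INR n)) in *.
  assert (Hn1 : 1 <= INR n) by (apply (le_INR 1); trivial).
  assert (Hq : forall j, 0 < 1 / 4 + INR j) by (intros j; generalize (pos_INR j); lra).
  exists ((ln (INR n) - ln PI) / 2 - lorentz_sum tau n / 2),
    (fun x => - sum_f_R0 (fun j => atan_poly (1 / 4 + INR j) tau m (/ 2 * x)) n).
  assert (Hhalf : forall x, Rabs (/ 2 * x) <= Rabs x).
  { intros x; rewrite Rabs_mult, Rabs_pos_eq by lra; generalize (Rabs_pos x); lra. }
  assert (Hhp : forall k x, (1 + Rabs (/ 2 * x)) ^ k <= (1 + Rabs x) ^ k).
  { intros k x; apply pow_incr; generalize (Rabs_pos (/ 2 * x)) (Hhalf x); lra. }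
  assert (Hx0 : forall k x, 0 <= (1 + Rabs x) ^ k) by (intros k x; apply pow_le; generalize (Rabs_pos x); lra).
  split; [|split; [|split; [|split]]].
  - split.
    + assert (H := lorentz_sum_le tau n); unfold Lam in HL; lra.
    + assert (H := lorentz_sum_ge tau n).
      assert (H1 : ln (INR n) <= ln ((5 / 4 + INR n) ^ 2 + tau ^ 2) / 2).
      { replace (ln (INR n)) with (ln (INR n ^ 2) / 2).
        - assert (ln (INR n ^ 2) <= ln ((5 / 4 + INR n) ^ 2 + tau ^ 2)); [|lra].
          apply ln_le; [apply pow_lt; lra | generalize (pow2_ge_0 tau); nra].
        - rewrite ln_pow by lra; simpl; field. }
      assert (H2 : ln ((1 / 4) ^ 2 + tau ^ 2) / 2 <= ln tau + 1 / 2).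
      { assert (ln ((1 / 4) ^ 2 + tau ^ 2) <= ln (2 * tau ^ 2)) by (apply ln_le; nra).
        rewrite ln_mult, ln_pow in H0 by (try apply pow_lt; lra); simpl INR in H0.
        generalize ln_lt_2; intros.
        assert (ln 2 <= 1); [|lra].
        rewrite <- (ln_exp 1); apply ln_le; [lra | generalize (exp_ineq1_le 1); lra]. }
      assert (H3 : 0 < / (INR n + 3 / 4)) by (apply Rinv_0_lt_compat; lra).
      assert (H4 : 0 <= ln PI) by (apply ln_ge_0; generalize PI2_1; lra).
      assert (H5 : 0 <= ln tau) by (apply ln_ge_0; trivial).
      lra.
  - apply cpoly_ext with (fun x => - (1) * RtoC (sum_f_R0 (fun j => atan_poly (1 / 4 + INR j) tau m (/ 2 * x)) n))%C.
    + intros x; rewrite RtoC_opp; ring.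
    + apply cpoly_mult; [apply cpoly_const | apply cpoly_sum; intros; apply cpoly_atan_poly].
  - transitivity (- 0); [f_equal | ring].
    rewrite (sum_eq _ (fun _ => 0)).
    + rewrite sum_cte; ring.
    + intros j _; cbv beta; rewrite Rmult_0_r; apply atan_poly_0.
  - intros x; rewrite Rabs_Ropp.
    eapply Rle_trans.
    + apply sum_f_R0_Rabs_le with (g := fun j => / (1 / 4 + INR j) * (INR m * (1 + Rabs x) ^ S m / tau)).
      intros j; eapply Rle_trans; [apply atan_poly_le; trivial|].
      replace (/ (1 / 4 + INR j) * (INR m * (1 + Rabs x) ^ S m / tau)) with (INR m * (1 + Rabs x) ^ S m / ((1 / 4 + INR j) * tau))
        by (field; split; [lra | generalize (Hq j); lra]).
      unfold Rdiv at 1 3; apply Rmult_le_compat_r.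
      * left; apply Rinv_0_lt_compat, Rmult_lt_0_compat; trivial; lra.
      * apply Rmult_le_compat_l; [apply pos_INR | apply Hhp].
    + rewrite <- scal_sum; fold (inv_sum n).
      replace (INR m * Lam * (1 + Rabs x) ^ S m / tau) with (INR m * (1 + Rabs x) ^ S m / tau * Lam) by (unfold Rdiv; ring).
      apply Rmult_le_compat_l; trivial.
      apply Rdiv_le_0_compat; [apply Rmult_le_pos; [apply pos_INR | apply Hx0] | lra].
  - intros x.
    replace (_ - _ - _ - _) with (- sum_f_R0 (fun j => atan ((tau + / 2 * x) / (1 / 4 + INR j)) - atan (tau / (1 / 4 + INR j))
      - (1 / 4 + INR j) / ((1 / 4 + INR j) ^ 2 + tau ^ 2) * (/ 2 * x) - atan_poly (1 / 4 + INR j) tau m (/ 2 * x)) n).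
    + rewrite Rabs_Ropp; eapply Rle_trans.
      * apply sum_f_R0_Rabs_le with (g := fun j => / (1 / 4 + INR j) * ((1 + Rabs x) ^ S (S m) / tau ^ S m)).
        intros j; eapply Rle_trans; [apply atan_taylor; trivial|].
        assert (Hp : 0 < tau ^ S m) by (apply pow_lt; lra).
        replace (/ (1 / 4 + INR j) * ((1 + Rabs x) ^ S (S m) / tau ^ S m)) with ((1 + Rabs x) ^ S (S m) / ((1 / 4 + INR j) * tau ^ S m))
          by (field; split; [lra | generalize (Hq j); lra]).
        unfold Rdiv at 1 3; apply Rmult_le_compat_r; [|apply Hhp].
        left; apply Rinv_0_lt_compat, Rmult_lt_0_compat; trivial; lra.
      * rewrite <- scal_sum; fold (inv_sum n).
        replace (Lam * (1 + Rabs x) ^ S (S m) / tau ^ S m) with ((1 + Rabs x) ^ S (S m) / tau ^ S m * Lam) by (unfold Rdiv; ring).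
        apply Rmult_le_compat_l; trivial.
        apply Rdiv_le_0_compat; [apply Hx0 | apply pow_lt; lra].
    + rewrite !minus_sum, <- scal_sum; fold (lorentz_sum tau n).
      unfold gauss_theta; replace ((t + x) / 2) with (tau + / 2 * x) by (unfold tau; field).
      fold tau; field.
Qed.

Lemma nat_between (x : R) : 1 <= x -> exists m : nat, x <= INR m <= 2 * x.
Proof.
  intros Hx; destruct (nfloor_ex x ltac:(lra)) as [k [H1 H2]].
  exists (S k); rewrite S_INR; lra.
Qed.

Lemma ln_le_sub_1 (x : R) : 0 < x -> ln x <= x - 1.
Proof. intros Hx; generalize (exp_ineq1_le (ln x)); rewrite exp_ln by trivial; lra. Qed.

(** Used to trade the square of a logarithm for one power of T in [theta_expansion]. *)
Lemma ln_sqr_le (T : R) : 1 <= T -> (1 + ln T) ^ 2 <= 4 * T.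
Proof.
  intros HT; assert (Hs : 1 <= sqrt T) by (rewrite <- sqrt_1; apply sqrt_le_1; lra).
  assert (E : ln T = 2 * ln (sqrt T)).
  { rewrite <- (sqrt_def T) at 1 by lra; rewrite ln_mult by lra; ring. }
  assert (H := ln_le_sub_1 (sqrt T) ltac:(lra)).
  assert (H0 := ln_ge_0 T HT).
  assert (H1 : 1 + ln T <= 2 * sqrt T) by lra.
  replace (4 * T) with ((2 * sqrt T) ^ 2) by (simpl; rewrite <- (sqrt_def T) at 3 by lra; ring).
  apply pow_incr; lra.
Qed.

Lemma theta_expansion (lG : C -> C) (N : nat) : is_logGamma lG ->
  exists (K : R) (D : nat), 0 <= K /\ forall T t : R, 4 <= T -> T / 2 <= t <= 2 * T ->
    exists (om : R) (p : R -> C), cpoly p /\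
      - (5 + ln PI) / 2 <= om <= ln T / 2 + 12 /\
      forall x, Cmod (Cexp (0, theta lG (t + x)) - p x * Cexp (0, (om * x)%R)) <= K / T ^ N * (1 + Rabs x) ^ D.
Proof.
  intros HlG.
  (* For n = m0^2 with m0 <= 2 T^{N+1} this gives 5 + log n <= 7 + 2(N + 1) log T <= A (1 + log
     T). *)
  set (A := 9 + 2 * INR N).
  set (D := ((S N * 2) * N + N + 3)%nat).
  (* The summands bound, in this order, the errors from Gauss' product ([B1]), from the Taylor
     expansion of its phase ([B2]) and from the exponential series ([B3]); D exceeds the powers of 1
     + |x| in all three. *)
  exists (96 + 2 * A * 4 ^ S N + (256 * INR N ^ 2 * A ^ 2) ^ N), D.
  assert (HN := pos_INR N).
  assert (HA : 9 <= A) by (unfold A; lra).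
  assert (K2 : 0 <= 2 * A * 4 ^ S N) by (apply Rmult_le_pos; [lra | apply pow_le; lra]).
  assert (K3 : 0 <= (256 * INR N ^ 2 * A ^ 2) ^ N).
  { apply pow_le; apply Rmult_le_pos; [|apply pow2_ge_0]; apply Rmult_le_pos; [lra | apply pow2_ge_0]. }
  split; [lra|]; intros T t HT Ht.
  assert (HTN : 1 <= T ^ S N) by (apply pow_R1_Rle; lra).
  (* The power beyond N pays for the factor 1 + |t + x| in [theta_approx]. *)
  destruct (nat_between (T ^ S N) HTN) as [m0 [Hm1 Hm2]].
  assert (Hm0 : (1 <= m0)%nat) by (apply INR_le; simpl; lra).
  set (n := (m0 * m0)%nat).
  assert (Hn : (1 <= n)%nat) by (unfold n; nia).
  destruct (gauss_theta_taylor n N t Hn ltac:(lra)) as [om [q [Hom [Hq [Hq0 [Hqb Hr]]]]]].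
  set (Lam := 5 + ln (INR n)) in *.
  assert (HlT := ln_ge_0 T ltac:(lra)).
  assert (HLam : 0 <= Lam <= A * (1 + ln T)).
  { unfold Lam, n; rewrite mult_INR, ln_mult by lra.
    assert (0 <= ln (INR m0)) by (apply ln_ge_0; lra).
    assert (H1 : ln (INR m0) <= 1 + INR (S N) * ln T).
    { apply Rle_trans with (ln (2 * T ^ S N)); [apply ln_le; lra|].
      rewrite ln_mult, ln_pow by lra.
      assert (ln 2 <= 1); [|lra]. generalize (ln_le_sub_1 2 ltac:(lra)); lra. }
    rewrite S_INR in H1; split; [lra|]; unfold A; nra. }
  assert (HLT : Lam <= A * T).
  { eapply Rle_trans; [apply HLam|]; apply Rmult_le_compat_l; [lra | generalize (ln_le_sub_1 T ltac:(lra)); lra]. }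
  assert (HL2 : Lam ^ 2 <= A ^ 2 * (4 * T)).
  { eapply Rle_trans; [apply pow_incr, HLam|]; rewrite Rpow_mult_distr.
    apply Rmult_le_compat_l; [apply pow2_ge_0 | apply ln_sqr_le; lra]. }
  (* Apart from powers of 1 + |x|, q is O(log T / T). By [HL2] two factors of it gain one full power
     of 1/T, so 2N factors give T^{-N}. *)
  set (J := (2 * N)%nat).
  set (p := fun x => (Cexp (0, gauss_theta n t) * exp_poly J (Ci * RtoC (q x)))%C).
  exists om, p; split; [|split].
  - apply cpoly_mult; [apply cpoly_const | apply cpoly_exp_poly, cpoly_mult; [apply cpoly_const | exact Hq]].
  - split; [apply Hom|]. eapply Rle_trans; [apply Hom|].
    assert (ln (t / 2) <= ln T) by (apply ln_le; lra). lra.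
  - intros x.
    assert (Hax := Rabs_pos x). assert (HTp : 0 < T ^ N) by (apply pow_lt; lra).
    assert (HD : forall k, (k <= D)%nat -> 0 <= (1 + Rabs x) ^ k <= (1 + Rabs x) ^ D).
    { intros k Hk; split; [apply pow_le; lra | apply Rle_pow; [lra | trivial]]. }
    assert (B1 : Cmod (Cexp (0, theta lG (t + x)) - Cexp (0, gauss_theta n (t + x))) <= 96 / T ^ N * (1 + Rabs x) ^ D).
    { eapply Rle_trans; [apply theta_approx; trivial|].
      apply Rle_trans with (96 / T ^ N * (1 + Rabs x) ^ 1).
      2:{ apply Rmult_le_compat_l; [apply Rdiv_le_0_compat; lra|]. apply HD; unfold D; lia. }
      rewrite pow_1.
      apply Rle_trans with (32 * (1 + Rabs (t + x)) / T ^ S N).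
      { apply Rmult_le_compat_l; [generalize (Rabs_pos (t + x)); lra | apply Rinv_le_contravar; lra]. }
      apply Rmult_le_reg_r with (T ^ S N); [lra|].
      replace (32 * (1 + Rabs (t + x)) / T ^ S N * T ^ S N) with (32 * (1 + Rabs (t + x))) by (field; lra).
      replace (96 / T ^ N * (1 + Rabs x) * T ^ S N) with (96 * T * (1 + Rabs x)) by (simpl; field; lra).
      generalize (Rabs_triang t x); rewrite (Rabs_pos_eq t) by lra; intros; nra. }
    set (a := gauss_theta n t + om * x + q x).
    assert (B2 : Cmod (Cexp (0, gauss_theta n (t + x)) - Cexp (0, a)) <= 2 * A * 4 ^ S N / T ^ N * (1 + Rabs x) ^ D).
    { eapply Rle_trans; [apply cis_lipschitz|].
      replace (gauss_theta n (t + x) - a) with (gauss_theta n (t + x) - gauss_theta n t - om * x - q x) by (unfold a; ring).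
      apply Rle_trans with (2 * A * 4 ^ S N / T ^ N * (1 + Rabs x) ^ S (S N)).
      2:{ apply Rmult_le_compat_l; [apply Rdiv_le_0_compat; lra|]. apply HD; unfold D; lia. }
      eapply Rle_trans; [apply Rmult_le_compat_l; [lra | apply Hr]|].
      assert (Ht4 : (T / 4) ^ S N <= (t / 2) ^ S N) by (apply pow_incr; lra).
      assert (Ht5 : 0 < (T / 4) ^ S N) by (apply pow_lt; lra).
      assert (E : (T / 4) ^ S N * 4 ^ S N = T ^ S N) by (rewrite <- Rpow_mult_distr; f_equal; field).
      assert (H4 : 0 < 4 ^ S N) by (apply pow_lt; lra).
      assert (HY := HD (S (S N)) ltac:(unfold D; lia)); set (Y := (1 + Rabs x) ^ S (S N)) in *.
      apply Rle_trans with (2 * (A * T * Y / (T / 4) ^ S N)).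
      { apply Rmult_le_compat_l; [lra|]; apply Rmult_le_compat.
        - apply Rmult_le_pos; lra.
        - left; apply Rinv_0_lt_compat; lra.
        - apply Rmult_le_compat_r; lra.
        - apply Rinv_le_contravar; lra. }
      right; replace ((T / 4) ^ S N) with (T ^ S N / 4 ^ S N) by (rewrite <- E; field; lra).
      simpl; simpl in H4; field; split; [lra|split; [|lra]]; apply pow_nonzero; lra. }
    assert (B3 : Cmod (Cexp (0, a) - p x * Cexp (0, (om * x)%R)) <= (256 * INR N ^ 2 * A ^ 2) ^ N / T ^ N * (1 + Rabs x) ^ D).
    { unfold p, a; rewrite 2!cis_plus.
      replace (Cexp (0, gauss_theta n t) * Cexp (0, (om * x)%R) * Cexp (0, q x)
        - Cexp (0, gauss_theta n t) * exp_poly J (Ci * RtoC (q x)) * Cexp (0, (om * x)%R))%C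
        with (Cexp (0, gauss_theta n t) * Cexp (0, (om * x)%R) * (Cexp (0, q x) - exp_poly J (Ci * RtoC (q x))))%C by ring.
      rewrite 2!Cmod_mult, 2!Cmod_cis, 2!Rmult_1_l.
      replace (Ci * RtoC (q x))%C with ((0, q x) : C) by (unfold Ci, RtoC, Cmult; simpl; f_equal; ring).
      eapply Rle_trans; [apply Cexp_sub_poly|].
      unfold J; rewrite pow_mult.
      apply Rle_trans with ((256 * INR N ^ 2 * A ^ 2) ^ N / T ^ N * (1 + Rabs x) ^ (S N * 2 * N)).
      2:{ apply Rmult_le_compat_l; [apply Rdiv_le_0_compat; lra|]. apply HD; unfold D; lia. }
      rewrite pow_mult; unfold Rdiv; rewrite <- pow_inv, <- 2!Rpow_mult_distr.
      apply pow_incr; split; [apply pow2_ge_0|].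
      rewrite pow_mult; set (Z := (1 + Rabs x) ^ S N).
      assert (HZ : 0 <= Z) by (apply pow_le; lra).
      assert (Hqx : Rabs (q x) <= INR N * Lam * Z * (4 / T)).
      { eapply Rle_trans; [apply Hqb|]; unfold Rdiv at 1; apply Rmult_le_compat_l.
        - apply Rmult_le_pos; [apply Rmult_le_pos|]; lra.
        - replace (4 / T) with (/ (T / 4)) by (field; lra); apply Rinv_le_contravar; lra. }
      apply Rle_trans with ((2 * (INR N * Lam * Z * (4 / T))) ^ 2).
      { apply pow_incr; generalize (Rabs_pos (q x)); lra. }
      replace ((2 * (INR N * Lam * Z * (4 / T))) ^ 2) with (64 * INR N ^ 2 * Lam ^ 2 * / T ^ 2 * Z ^ 2) by (field; lra).
      apply Rmult_le_compat_r; [apply pow2_ge_0|].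
      apply Rle_trans with (64 * INR N ^ 2 * (A ^ 2 * (4 * T)) * / T ^ 2).
      - apply Rmult_le_compat_r; [left; apply Rinv_0_lt_compat, pow_lt; lra|].
        apply Rmult_le_compat_l; [apply Rmult_le_pos; [lra | apply pow2_ge_0] | exact HL2].
      - right; field; lra. }
    replace (Cexp (0, theta lG (t + x)) - p x * Cexp (0, (om * x)%R))%C
      with ((Cexp (0, theta lG (t + x)) - Cexp (0, gauss_theta n (t + x)))
        + ((Cexp (0, gauss_theta n (t + x)) - Cexp (0, a)) + (Cexp (0, a) - p x * Cexp (0, (om * x)%R))))%C by ring.
    eapply Rle_trans; [apply Cmod_triangle|].
    eapply Rle_trans; [apply Rplus_le_compat_l, Cmod_triangle|].
    replace ((96 + 2 * A * 4 ^ S N + (256 * INR N ^ 2 * A ^ 2) ^ N) / T ^ N * (1 + Rabs x) ^ D)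
      with (96 / T ^ N * (1 + Rabs x) ^ D + (2 * A * 4 ^ S N / T ^ N * (1 + Rabs x) ^ D
        + (256 * INR N ^ 2 * A ^ 2) ^ N / T ^ N * (1 + Rabs x) ^ D)) by (field; lra).
    lra.
Qed.

(** * Euler-Maclaurin summation for zeta *)

(* Antiderivatives replacing the periodic Bernoulli functions: each vanishes at
   0 and 1 (from the second on), so the boundary terms of the repeated
   integration by parts telescope. *)
Fixpoint em_fun (j : nat) (y : R) : R :=
  match j with O => y | S j => RInt (em_fun j) 0 y - y * RInt (em_fun j) 0 1 end.

Definition em_mean (j : nat) : R := RInt (em_fun j) 0 1.

Lemma em_fun_continuous (j : nat) (y : R) : continuous (em_fun j) y.
Proof.
  revert y; induction j as [|j IH]; intros y; [apply continuous_id|].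
  apply (continuous_minus (V := R_NormedModule)).
  - apply (ex_derive_continuous (fun y => RInt (em_fun j) 0 y)); exists (em_fun j y).
    apply (is_derive_RInt (V := R_CompleteNormedModule) (em_fun j) _ 0); [|apply IH].
    apply filter_forall; intros x; apply (RInt_correct (V := R_CompleteNormedModule)), (ex_RInt_continuous (V := R_CompleteNormedModule)); intros; apply IH.
  - apply (continuous_mult (K := R_AbsRing)); [apply continuous_id | apply continuous_const].
Qed.

Lemma em_fun_ex_RInt (j : nat) (a b : R) : ex_RInt (em_fun j) a b.
Proof. apply (ex_RInt_continuous (V := R_CompleteNormedModule)); intros; apply em_fun_continuous. Qed.

Lemma em_fun_deriv (j : nat) (y : R) : is_derive (em_fun (S j)) y (em_fun j y - em_mean j).
Proof.
  apply (is_derive_minus (fun y => RInt (em_fun j) 0 y) (fun y => y * RInt (em_fun j) 0 1)).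
  - apply (is_derive_RInt (V := R_CompleteNormedModule) (em_fun j) _ 0); [|apply em_fun_continuous].
    apply filter_forall; intros x; apply (RInt_correct (V := R_CompleteNormedModule)), em_fun_ex_RInt.
  - fold (em_mean j); generalize (em_mean j); intros c; auto_derive; trivial; ring.
Qed.

Lemma em_fun_0 (j : nat) : em_fun (S j) 0 = 0.
Proof.
  cbn [em_fun]; rewrite (RInt_point (V := R_CompleteNormedModule)).
  change (0 - 0 * RInt (em_fun j) 0 1 = 0); ring.
Qed.

Lemma em_fun_1 (j : nat) : em_fun (S j) 1 = 0.
Proof. cbn [em_fun]; ring. Qed.

Lemma em_fun_le (j : nat) (y : R) : 0 <= y <= 1 -> Rabs (em_fun j y) <= 2 ^ j.
Proof.
  revert y; induction j as [|j IH]; intros y Hy.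
  - simpl; rewrite Rabs_pos_eq; lra.
  - assert (HB : forall u, 0 <= u <= 1 -> Rabs (RInt (em_fun j) 0 u) <= u * 2 ^ j).
    { intros u Hu; eapply Rle_trans; [apply abs_RInt_le_const with (M := 2 ^ j)|].
      - lra.
      - apply em_fun_ex_RInt.
      - intros v Hv; apply IH; lra.
      - lra. }
    assert (H2 : 0 < 2 ^ j) by (apply pow_lt; lra).
    cbn [em_fun]; unfold Rminus; eapply Rle_trans; [apply Rabs_triang|].
    rewrite Rabs_Ropp, Rabs_mult, (Rabs_pos_eq y) by lra.
    assert (H3 := HB y Hy); assert (H4 := HB 1 ltac:(lra)); simpl pow.
    assert (y * Rabs (RInt (em_fun j) 0 1) <= y * (1 * 2 ^ j)) by (apply Rmult_le_compat_l; lra). nra.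
Qed.

(* Each step adds a boundary term and a telescoping term so that the derivative
   in x stays a single product (em_prim_deriv), of size x^{-Re s - k - 1}. *)
Fixpoint em_prim (n : R) (s : C) (k : nat) (x : R) : C :=
  match k with
  | O => phis n s x
  | S k => em_prim n s k x
     + (rising s (S k) * (RtoC (em_fun (S k) (x - n)) * Rcpow x (- s - RtoC (INR (S k))))
        - RtoC (em_mean k) * rising s k * Rcpow x (- s - RtoC (INR k)))
  end%C.

Lemma em_prim_deriv (n : R) (s : C) (k : nat) (x : R) : 0 < x -> s <> 1 ->
  cderiv (em_prim n s k) x
    (- rising s (S k) * (RtoC (em_fun k (x - n)) * Rcpow x (- s - RtoC (INR (S k)))))%C.
Proof.
  intros Hx Hs.
  assert (Hx0 : RtoC x <> 0) by (apply RtoC_neq; lra).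
  assert (HX : forall k, Rcpow x (- s - RtoC (INR (S k))) = (Rcpow x (- s - RtoC (INR k)) / RtoC x)%C).
  { intros j; replace (- s - RtoC (INR j))%C with ((- s - RtoC (INR (S j))) + 1)%C by (rewrite S_INR, RtoC_plus; ring).
    rewrite Rcpow_plus, Rcpow_1 by trivial; field; trivial. }
  induction k as [|k IH].
  - eapply cderiv_eq; [apply phis_deriv; trivial|].
    rewrite HX; cbn [rising em_fun]; change (INR 0) with 0.
    replace (- s - RtoC 0)%C with (- s)%C by ring; field; trivial.
  - assert (HD : cderiv (fun x => RtoC (em_fun (S k) (x - n))) x (RtoC (em_fun k (x - n) - em_mean k))).
    { apply cderiv_RtoC.
      evar_last.
      - apply (is_derive_comp (em_fun (S k)) (fun x => x - n)); [apply em_fun_deriv|].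
        auto_derive; trivial.
      - unfold scal; simpl; unfold mult; simpl; ring. }
    assert (H := cderiv_plus _ _ _ _ _ IH (cderiv_plus _ _ _ _ _
      (cderiv_mult _ _ _ _ _ (cderiv_const (rising s (S k)) x) (cderiv_mult _ _ _ _ _ HD (cderiv_Rcpow (- s - RtoC (INR (S k))) x Hx)))
      (cderiv_mult _ _ _ _ _ (cderiv_const (- (RtoC (em_mean k) * rising s k))%C x) (cderiv_Rcpow (- s - RtoC (INR k)) x Hx)))).
    assert (E : forall y, em_prim n s (S k) y = (em_prim n s k y
     + (rising s (S k) * (RtoC (em_fun (S k) (y - n)) * Rcpow y (- s - RtoC (INR (S k))))
        + - (RtoC (em_mean k) * rising s k) * Rcpow y (- s - RtoC (INR k))))%C).
    { intros y; cbn [em_prim]; ring. }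
    eapply cderiv_eq with (a := _).
    + destruct H as [H1 H2]; split; [apply is_derive_ext with (2 := H1) | apply is_derive_ext with (2 := H2)];
        intros y; now rewrite E.
    + rewrite (HX (S k)), (HX k); cbv beta.
      change (rising s (S (S k))) with (rising s (S k) * (s + RtoC (INR (S k))))%C.
      change (rising s (S k)) with (rising s k * (s + RtoC (INR k)))%C.
      rewrite RtoC_minus; field; trivial.
Qed.

(** The Euler-Maclaurin sum of length N + 1 with k correction terms: what is left of [em_prim] at
    integers, where the [em_fun] of positive index vanish. *)
Fixpoint em_seq (s : C) (k : nat) (N : nat) : C :=
  match k with
  | O => zeta_seq s N
  | S k => em_seq s k N - RtoC (em_mean k) * rising s k * Rcpow (INR (S N)) (- s - RtoC (INR k))
  end%C.

Lemma em_seq_incr (s : C) (k N : nat) :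
  (em_seq s k (S N) - em_seq s k N)%C
  = (em_prim (INR (S N)) s k (INR (S (S N))) - em_prim (INR (S N)) s k (INR (S N)))%C.
Proof.
  induction k as [|k IH]; [apply zeta_seq_incr|].
  cbn [em_seq em_prim].
  replace (INR (S (S N)) - INR (S N)) with 1 by (rewrite (S_INR (S N)); ring).
  replace (INR (S N) - INR (S N)) with 0 by ring.
  rewrite em_fun_0, em_fun_1.
  transitivity ((em_seq s k (S N) - em_seq s k N) - RtoC (em_mean k) * rising s k * Rcpow (INR (S (S N))) (- s - RtoC (INR k))
    + RtoC (em_mean k) * rising s k * Rcpow (INR (S N)) (- s - RtoC (INR k)))%C; [ring|].
  rewrite IH; ring.
Qed.

Lemma em_seq_lim (s : C) (k : nat) : 0 < Re s -> s <> 1 -> is_clim (em_seq s k) (zeta s).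
Proof.
  intros Hs H1; induction k as [|k IH]; [apply zeta_lim; trivial|].
  replace (zeta s) with (zeta s - 0)%C by ring.
  apply is_clim_minus; trivial; intros e.
  destruct (exp_ln_small (Re s + INR k) (Cmod (RtoC (em_mean k) * rising s k)) ltac:(generalize (pos_INR k); lra) (Cmod_ge_0 _) e) as [N0 HN].
  exists N0; intros n Hn; generalize (HN n Hn).
  unfold Cminus at 1; rewrite Copp_0, Cplus_0_r, (Cmod_mult _ (Rcpow _ _)), Cmod_Rcpow.
  replace (Re (- s - RtoC (INR k))) with (- (Re s + INR k)) by (destruct s; simpl; ring); trivial.
Qed.

Lemma is_clim_shift (u : nat -> C) (l : C) (N : nat) : is_clim u l -> is_clim (fun n => u (N + n)%nat) l.
Proof. intros H e; destruct (H e) as [M HM]; exists M; intros n Hn; apply HM; lia. Qed.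

Lemma is_clim_const (c : C) : is_clim (fun _ => c) c.
Proof.
  intros e; exists O; intros; replace (c - c)%C with (RtoC 0) by ring; rewrite Cmod_0; apply cond_pos.
Qed.

(** The corrections tend to 0, so [em_seq s k] still converges to zeta(s), and its increments
    telescope against x^{-Re s - k}. For N well above |s| every further correction term improves the
    bound by a factor of about |s|/N. *)
Lemma euler_maclaurin (s : C) (k N : nat) : 0 < Re s -> s <> 1 ->
  Cmod (zeta s - em_seq s k N)
  <= 2 * (Cmod (rising s (S k)) * 2 ^ k) / (Re s + INR k) * exp (- (Re s + INR k) * ln (INR (S N))).
Proof.
  intros Hs H1; assert (Hk := pos_INR k).
  set (B := Cmod (rising s (S k)) * 2 ^ k).
  assert (HB : 0 <= B) by (apply Rmult_le_pos; [apply Cmod_ge_0 | apply pow_le; lra]).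
  apply (is_clim_bound (fun n => em_seq s k (N + n)%nat - em_seq s k N)%C).
  - apply is_clim_minus; [apply is_clim_shift, em_seq_lim; trivial | apply is_clim_const].
  - intros n; apply telescope; trivial; [lra|]; clear n N; intros N; rewrite em_seq_incr.
    assert (HN : 1 <= INR (S N)) by (apply (le_INR 1); lia).
    rewrite (S_INR (S N)).
    apply (cincr_le _ (fun x => - rising s (S k) * (RtoC (em_fun k (x - INR (S N))) * Rcpow x (- s - RtoC (INR (S k)))))%C
      (fun x => B * Vt (Re s + INR k) x) (fun x => B * exp (- (1 + (Re s + INR k)) * ln x))); [lra|..].
    + intros x Hx; apply em_prim_deriv; trivial; lra.
    + intros x Hx; apply Vt_deriv; lra.
    + intros x Hx; rewrite 2!Cmod_mult, Cmod_opp, Cmod_R, Cmod_Rcpow.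
      replace (Re (- s - RtoC (INR (S k)))) with (- (1 + (Re s + INR k))) by (rewrite S_INR; destruct s; simpl; ring).
      unfold B; rewrite <- Rmult_assoc; apply Rmult_le_compat_r; [left; apply exp_pos|].
      apply Rmult_le_compat_l; [apply Cmod_ge_0|]; apply em_fun_le; lra.
Qed.

Lemma Cmod_rising_le (s : C) (k : nat) : Cmod (rising s (S k)) <= (Cmod s + INR k) ^ S k.
Proof.
  assert (Hc := Cmod_ge_0 s).
  induction k as [|k IH].
  - cbn [rising pow]; change (INR 0) with 0; rewrite Cmult_1_l, Cplus_0_r; lra.
  - change (rising s (S (S k))) with (rising s (S k) * (s + RtoC (INR (S k))))%C; rewrite Cmod_mult.
    assert (H1 : INR k <= INR (S k)) by (rewrite S_INR; lra). assert (H0 := pos_INR k).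
    replace ((Cmod s + INR (S k)) ^ S (S k)) with ((Cmod s + INR (S k)) ^ S k * (Cmod s + INR (S k))) by (cbn [pow]; ring).
    apply Rmult_le_compat; try apply Cmod_ge_0.
    + eapply Rle_trans; [exact IH|]; apply pow_incr; lra.
    + eapply Rle_trans; [apply Cmod_triangle|]; rewrite Cmod_RtoC_pos by apply pos_INR; lra.
Qed.

(* Finite sums of p(x) e^{i om x}, p a polynomial and om in [lo, hi]. *)
Inductive expoly (lo hi : R) : (R -> C) -> Prop :=
| expoly_mono (om : R) (p : R -> C) : lo <= om <= hi -> cpoly p -> expoly lo hi (fun x => p x * Cexp (0, (om * x)%R))%C
| expoly_plus (f g : R -> C) : expoly lo hi f -> expoly lo hi g -> expoly lo hi (fun x => f x + g x)%C
| expoly_ext (f g : R -> C) : (forall x, f x = g x) -> expoly lo hi f -> expoly lo hi g.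

Lemma expoly_shift (lo hi om : R) (p g : R -> C) : cpoly p -> expoly lo hi g ->
  expoly (om + lo) (om + hi) (fun x => p x * Cexp (0, (om * x)%R) * g x)%C.
Proof.
  intros Hp Hg; induction Hg as [om' p' Hom Hp'|f g _ IHf _ IHg|f g E _ IH].
  - apply expoly_ext with (fun x => (p x * p' x) * Cexp (0, ((om + om') * x)%R))%C.
    + intros x; rewrite Rmult_plus_distr_r, cis_plus; ring.
    + apply expoly_mono; [lra | apply cpoly_mult; trivial].
  - apply expoly_ext with (fun x => p x * Cexp (0, (om * x)%R) * f x + p x * Cexp (0, (om * x)%R) * g x)%C.
    + intros x; ring.
    + apply expoly_plus; trivial.
  - apply expoly_ext with (2 := IH); intros x; now rewrite E.
Qed.

Lemma Rcpow_line (M t x : R) (z : C) : 0 < M ->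
  Rcpow M (z - (0, (t + x)%R)) = (Rcpow M (z - (0, t)) * Cexp (0, (- ln M * x)%R))%C.
Proof.
  intros HM; replace (z - (0, (t + x)%R))%C with ((z - (0, t)) + (0, (- x)%R))%C.
  - rewrite Rcpow_plus; f_equal; unfold Rcpow; f_equal; unfold Cmult, RtoC; simpl; f_equal; ring.
  - destruct z; unfold Cminus, Cplus, Copp; simpl; f_equal; ring.
Qed.

Lemma cpoly_rising (s0 : C) (k : nat) : cpoly (fun x => rising (s0 + Ci * RtoC x) k).
Proof.
  induction k as [|k IH]; [apply (cpoly_const 1)|].
  apply (cpoly_mult _ (fun x => s0 + Ci * RtoC x + RtoC (INR k))%C IH).
  apply cpoly_plus; [|apply cpoly_const].
  apply cpoly_plus; [apply cpoly_const | apply cpoly_mult; [apply cpoly_const | apply cpoly_id]].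
Qed.

(** The pole term N^{1-s}/(s - 1) is not an exponential polynomial in x; its denominator w + ix is
    replaced by this truncated geometric series. *)
Fixpoint geom_poly (w : C) (L : nat) (x : R) : C :=
  match L with O => 0 | S L => geom_poly w L x + Cpow (- Ci / w * RtoC x) L / w end%C.

Lemma cpoly_geom (w : C) (L : nat) : cpoly (geom_poly w L).
Proof.
  induction L as [|L IH]; [apply (cpoly_const 0)|].
  apply cpoly_plus; trivial.
  apply cpoly_mult; [apply cpoly_pow, cpoly_mult; [apply cpoly_const | apply cpoly_id] | apply cpoly_const].
Qed.

Lemma geom_poly_spec (w : C) (L : nat) (x : R) : w <> 0 -> (w + Ci * RtoC x)%C <> 0 ->
  (/ (w + Ci * RtoC x) - geom_poly w L x)%C = (Cpow (- Ci / w * RtoC x) L / (w + Ci * RtoC x))%C.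
Proof.
  intros H1 H2; induction L as [|L IH].
  - simpl; field; trivial.
  - cbn [geom_poly].
    transitivity (Cpow (- Ci / w * RtoC x) L / (w + Ci * RtoC x) - Cpow (- Ci / w * RtoC x) L / w)%C; [rewrite <- IH; ring|].
    rewrite Cpow_S; set (P := Cpow _ _); field; split; trivial.
Qed.

Lemma expoly_of_mono_ext (lo hi om : R) (p f : R -> C) : lo <= om <= hi -> cpoly p ->
  (forall x, f x = (p x * Cexp (0, (om * x)%R))%C) -> expoly lo hi f.
Proof.
  intros H1 H2 E; apply expoly_ext with (fun x => p x * Cexp (0, (om * x)%R))%C; [intros; symmetry; apply E|].
  apply expoly_mono; trivial.
Qed.

Lemma exp_minus_le_inv_pow (T a : R) (N : nat) : 1 <= T -> INR N <= a -> exp (- a * ln T) <= / T ^ N.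
Proof.
  intros HT Ha; assert (Hl := ln_ge_0 T HT).
  rewrite <- (exp_ln (T ^ N)), ln_pow, <- exp_Ropp by (try apply pow_lt; lra).
  apply exp_le; nra.
Qed.

(** With length about T^{1+eta}, each Euler-Maclaurin step gains T^{-eta} and loses at most a factor
    of order 1 + |x|. The lengths and corrections depend on T and t alone, never on x, so the result
    is an exponential polynomial in x. *)
Lemma zeta_expansion (N : nat) (eta : R) : 0 < eta <= 1 ->
  exists (K : R) (D : nat), 0 <= K /\ forall T t : R, 4 <= T -> T / 2 <= t <= 2 * T ->
    exists B : R -> C, expoly (- (1 + (1 + eta) * ln T)) 0 B /\
      forall x, Cmod (zeta ((1 / 2)%R, (t + x)%R) - B x) <= K / T ^ N * (1 + Rabs x) ^ D.
Proof.
  intros Heta.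
  (* [rising s (S k)] has k + 1 factors of size T against k powers of the length; the unmatched one
     accounts for N + 1 in place of N. *)
  destruct (nat_above ((INR N + 1) / eta)) as [k Hk].
  assert (Hke : INR N + 1 <= INR k * eta).
  { apply (Rmult_le_compat_r eta) in Hk; [|lra].
    replace ((INR N + 1) / eta * eta) with (INR N + 1) in Hk by (field; lra); exact Hk. }
  assert (Hk0 := pos_INR k). assert (HN0 := pos_INR N).
  (* The two extra powers of 1/T absorb the factor M^{1/2} <= 2 T^2 of the pole term. *)
  set (L := (N + 2)%nat).
  set (K1 := 4 * 2 ^ k * (3 + INR k) ^ S k). set (K2 := 4 * 2 ^ L).
  assert (HK1 : 0 <= K1).
  { unfold K1; repeat apply Rmult_le_pos; try (apply pow_le; lra); lra. }
  assert (HK2 : 0 <= K2) by (unfold K2; apply Rmult_le_pos; [lra | apply pow_le; lra]).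
  exists (K1 + K2), (k + 1 + L)%nat; split; [lra|]; intros T t HT Ht.
  assert (HlT := ln_ge_0 T ltac:(lra)).
  set (X := exp ((1 + eta) * ln T)).
  assert (HX : T <= X <= T ^ 2).
  { unfold X; split.
    - rewrite <- (exp_ln T) at 1 by lra; apply exp_le; nra.
    - rewrite <- (exp_ln (T ^ 2)), ln_pow by (try apply pow_lt; lra); apply exp_le; simpl INR; nra. }
  destruct (nat_between X ltac:(lra)) as [M' [HM1 HM2]].
  (* [zeta_seq s N0] has N0 + 1 terms, so the length M is [INR (S N0)]. *)
  destruct M' as [|N0]; [simpl in HM1; lra|].
  set (M := INR (S N0)) in *.
  assert (HM : 1 <= M) by lra.
  assert (HlM : 0 <= ln M <= 1 + (1 + eta) * ln T).
  { split; [apply ln_ge_0; trivial|].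
    apply Rle_trans with (ln (2 * X)); [apply ln_le; lra|].
    rewrite ln_mult by lra; unfold X; rewrite ln_exp; generalize (ln_le_sub_1 2 ltac:(lra)); lra. }
  assert (HlM2 : (1 + eta) * ln T <= ln M) by (rewrite <- (ln_exp ((1 + eta) * ln T)); apply ln_le; [apply exp_pos | exact HM1]).
  set (s0 := ((1 / 2)%R, t) : C). set (w := (- (1 / 2), t)%R : C).
  assert (Es : forall x, ((1 / 2)%R, (t + x)%R) = (s0 + Ci * RtoC x)%C).
  { intros x; unfold s0, Ci, RtoC, Cplus, Cmult; simpl; f_equal; ring. }
  assert (Ew : forall x, (((1 / 2)%R, (t + x)%R) - 1)%C = (w + Ci * RtoC x)%C).
  { intros x; unfold w, Ci, RtoC, Cminus, Copp, Cplus, Cmult; simpl; f_equal; field. }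
  assert (Hwx : forall x, 1 / 2 <= Cmod (w + Ci * RtoC x)).
  { intros x; rewrite <- Ew; generalize (re_le_Cmod (((1 / 2)%R, (t + x)%R) - 1)); simpl.
    rewrite Rabs_left by lra; lra. }
  assert (Hwx0 : forall x, (w + Ci * RtoC x)%C <> 0).
  { intros x E; generalize (Hwx x); rewrite E, Cmod_0; lra. }
  assert (Hw : t <= Cmod w) by (generalize (im_le_Cmod w) (Rle_abs t); simpl; lra).
  assert (Hw0 : w <> 0) by (apply Cmod_gt_0; lra).
  set (A := fun x => sum_n (fun n => Rcpow (INR (S n)) (- ((1 / 2)%R, (t + x)%R))) N0).
  assert (HA : forall n, (n <= N0)%nat -> expoly (- (1 + (1 + eta) * ln T)) 0 (fun x => sum_n (fun n => Rcpow (INR (S n)) (- ((1 / 2)%R, (t + x)%R))) n)).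
  { assert (H1 : forall n, (n <= N0)%nat -> expoly (- (1 + (1 + eta) * ln T)) 0 (fun x => Rcpow (INR (S n)) (- ((1 / 2)%R, (t + x)%R)))).
    { intros n Hn; assert (Hp : 1 <= INR (S n)) by (apply (le_INR 1); lia).
      assert (Hp2 : ln (INR (S n)) <= ln M) by (apply ln_le; [lra | apply le_INR; lia]).
      apply expoly_of_mono_ext with (om := - ln (INR (S n))) (p := fun _ => Rcpow (INR (S n)) (RtoC (- (1 / 2)) - (0, t))).
      - generalize (ln_ge_0 _ Hp); lra.
      - apply cpoly_const.
      - intros x; rewrite <- Rcpow_line by lra; f_equal.
        unfold Copp, Cminus, Cplus, RtoC; simpl; f_equal; ring. }
    intros n; induction n as [|n IH]; intros Hn.
    - apply expoly_ext with (2 := H1 0%nat Hn); intros x; now rewrite sum_O.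
    - apply expoly_ext with (fun x => sum_n (fun n => Rcpow (INR (S n)) (- ((1 / 2)%R, (t + x)%R))) n + Rcpow (INR (S (S n))) (- ((1 / 2)%R, (t + x)%R)))%C.
      + intros x; rewrite sum_Sn; reflexivity.
      + apply expoly_plus; [apply IH; lia | apply H1; trivial]. }
  set (Z0 := fun x => (A x + Rcpow M (1 - ((1 / 2)%R, (t + x)%R)) * geom_poly w L x)%C).
  (* The recursion of [em_seq] started from [Z0], where the pole term is already truncated; so by
     [ED] the difference from [em_seq] is the same for every j. *)
  set (B := fix B (j : nat) : R -> C := match j with O => Z0
    | S j => fun x => (B j x - RtoC (em_mean j) * rising ((1 / 2)%R, (t + x)%R) j * Rcpow M (- ((1 / 2)%R, (t + x)%R) - RtoC (INR j)))%C end).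
  assert (HB : forall j, expoly (- (1 + (1 + eta) * ln T)) 0 (B j)).
  { induction j as [|j IH].
    - apply expoly_plus; [apply HA; lia|].
      apply expoly_of_mono_ext with (om := - ln M) (p := fun x => (Rcpow M (RtoC (1 / 2) - (0, t)) * geom_poly w L x)%C); [lra|..].
      + apply cpoly_mult; [apply cpoly_const | apply cpoly_geom].
      + intros x; replace (1 - ((1 / 2)%R, (t + x)%R))%C with (RtoC (1 / 2) - (0, (t + x)%R))%C.
        * rewrite Rcpow_line by lra; ring.
        * unfold Copp, Cminus, Cplus, RtoC; simpl; f_equal; field.
    - apply expoly_ext with (fun x => B j x + - (1) * RtoC (em_mean j) * rising ((1 / 2)%R, (t + x)%R) j * Rcpow M (- ((1 / 2)%R, (t + x)%R) - RtoC (INR j)))%C.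
      + intros x; change (B (S j) x) with (B j x - RtoC (em_mean j) * rising ((1 / 2)%R, (t + x)%R) j * Rcpow M (- ((1 / 2)%R, (t + x)%R) - RtoC (INR j)))%C; ring.
      + apply expoly_plus; trivial.
        apply expoly_of_mono_ext with (om := - ln M)
          (p := fun x => (- (1) * RtoC (em_mean j) * Rcpow M (RtoC (- (1 / 2) - INR j) - (0, t)) * rising (s0 + Ci * RtoC x) j)%C); [lra|..].
        * apply cpoly_mult; [apply cpoly_const | apply cpoly_rising].
        * intros x; replace (- ((1 / 2)%R, (t + x)%R) - RtoC (INR j))%C with (RtoC (- (1 / 2) - INR j) - (0, (t + x)%R))%C.
          { rewrite Rcpow_line, Es by lra; ring. }
          unfold Copp, Cminus, Cplus, RtoC; simpl; f_equal; ring. }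
  exists (B k); split; [apply HB|]; intros x.
  set (s := ((1 / 2)%R, (t + x)%R) : C).
  assert (Hs1 : s <> 1) by (intros E; apply (f_equal fst) in E; simpl in E; lra).
  assert (Hx := Rabs_pos x).
  assert (HTN : 0 < T ^ N) by (apply pow_lt; lra).
  assert (HD : forall j, (j <= k + 1 + L)%nat -> 0 <= (1 + Rabs x) ^ j <= (1 + Rabs x) ^ (k + 1 + L)).
  { intros j Hj; split; [apply pow_le; lra | apply Rle_pow; [lra | trivial]]. }
  assert (ED : forall j, (em_seq s j N0 - B j x)%C = (zeta_seq s N0 - Z0 x)%C).
  { induction j as [|j IH]; [reflexivity|].
    rewrite <- IH; cbn [em_seq]; change (B (S j) x) with (B j x - RtoC (em_mean j) * rising s j * Rcpow M (- s - RtoC (INR j)))%C.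
    fold M; ring. }
  assert (E1 : Cmod (zeta s - em_seq s k N0) <= K1 / T ^ N * (1 + Rabs x) ^ (k + 1 + L)).
  { eapply Rle_trans; [apply euler_maclaurin; trivial; simpl; lra|].
    fold M; change (Re s) with (1 / 2).
    assert (Hsm : Cmod s + INR k <= (3 + INR k) * T * (1 + Rabs x)).
    { assert (Cmod s <= 1 / 2 + (t + Rabs x)).
      { replace s with (RtoC (1 / 2) + Ci * RtoC (t + x))%C by (unfold s, Ci, RtoC, Cplus, Cmult; simpl; f_equal; ring).
        eapply Rle_trans; [apply Cmod_triangle|]; rewrite Cmod_mult, Cmod_Ci, !Cmod_R, Rmult_1_l, Rabs_pos_eq by lra.
        generalize (Rabs_triang t x); rewrite (Rabs_pos_eq t) by lra; lra. }
      assert (1 <= T * (1 + Rabs x)) by nra.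
      assert (INR k * 1 <= INR k * (T * (1 + Rabs x))) by (apply Rmult_le_compat_l; lra). nra. }
    assert (Hris : Cmod (rising s (S k)) <= (3 + INR k) ^ S k * T ^ S k * (1 + Rabs x) ^ S k).
    { eapply Rle_trans; [apply Cmod_rising_le|]; rewrite <- !Rpow_mult_distr.
      apply pow_incr; split; [generalize (Cmod_ge_0 s); lra | exact Hsm]. }
    assert (Hexp : exp (- (1 / 2 + INR k) * ln M) <= / T ^ k * / T ^ (N + 1)).
    { rewrite <- Rinv_mult, <- pow_add.
      apply Rle_trans with (exp (- (INR k + INR k * eta) * ln T)).
      - apply exp_le; nra.
      - apply exp_minus_le_inv_pow; [lra|]; rewrite 2!plus_INR; simpl; lra. }
    apply Rle_trans with (K1 / T ^ N * (1 + Rabs x) ^ S k).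
    2:{ apply Rmult_le_compat_l; [apply Rdiv_le_0_compat; lra | apply HD; lia]. }
    assert (H2k : 0 < 2 ^ k) by (apply pow_lt; lra).
    set (Q := (3 + INR k) ^ S k * T ^ S k * (1 + Rabs x) ^ S k) in *.
    assert (HQ : 0 <= Q) by (unfold Q; apply Rmult_le_pos; [apply Rmult_le_pos|]; apply pow_le; lra).
    apply Rle_trans with (4 * (Q * 2 ^ k) * (/ T ^ k * / T ^ (N + 1))).
    - apply Rmult_le_compat; trivial.
      + apply Rdiv_le_0_compat; [|lra]. repeat apply Rmult_le_pos; try lra; apply Cmod_ge_0.
      + left; apply exp_pos.
      + apply Rmult_le_reg_r with (1 / 2 + INR k); [lra|].
        replace (2 * (Cmod (rising s (S k)) * 2 ^ k) / (1 / 2 + INR k) * (1 / 2 + INR k)) with (2 * (Cmod (rising s (S k)) * 2 ^ k)) by (field; lra).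
        assert (Cmod (rising s (S k)) * 2 ^ k <= Q * 2 ^ k) by (apply Rmult_le_compat_r; lra).
        assert (0 <= Q * 2 ^ k) by (apply Rmult_le_pos; lra). nra.
    - right; unfold Q, K1; rewrite pow_add; cbn [pow]; field; repeat split; try apply pow_nonzero; lra. }
  assert (E2 : Cmod (zeta_seq s N0 - Z0 x) <= K2 / T ^ N * (1 + Rabs x) ^ (k + 1 + L)).
  { apply Rle_trans with (K2 / T ^ N * (1 + Rabs x) ^ L).
    2:{ apply Rmult_le_compat_l; [apply Rdiv_le_0_compat; lra | apply HD; lia]. }
    unfold zeta_seq, Z0, A; fold s M.
    replace (_ - _)%C with (Rcpow M (1 - s) * (/ (w + Ci * RtoC x) - geom_poly w L x))%C.
    2:{ rewrite <- (Ew x); fold s; unfold Cdiv; ring. }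
    rewrite geom_poly_spec by trivial.
    rewrite Cmod_mult, Cmod_div, Cmod_pow, Cmod_mult, Cmod_div, Cmod_opp, Cmod_Ci, Cmod_R, Cmod_Rcpow by trivial.
    replace (Re (1 - s)) with (1 / 2) by (simpl; field).
    assert (HMe : exp (1 / 2 * ln M) <= 2 * T ^ 2).
    { apply Rle_trans with M; [|lra]. rewrite <- (exp_ln M) at 2 by lra; apply exp_le; lra. }
    assert (HwL : (1 / Cmod w * Rabs x) ^ L <= (2 / T) ^ L * (1 + Rabs x) ^ L).
    { rewrite <- Rpow_mult_distr; apply pow_incr.
      assert (0 < / Cmod w) by (apply Rinv_0_lt_compat; lra).
      assert (/ Cmod w <= 2 / T).
      { replace (2 / T) with (/ (T / 2)) by (field; lra); apply Rinv_le_contravar; lra. }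
      unfold Rdiv in *; rewrite Rmult_1_l; split; [apply Rmult_le_pos; lra|].
      apply Rmult_le_compat; lra. }
    assert (HwL0 : 0 <= (1 / Cmod w * Rabs x) ^ L).
    { apply pow_le, Rmult_le_pos; trivial; apply Rdiv_le_0_compat; lra. }
    assert (Hi : 0 < / Cmod (w + Ci * RtoC x) <= 2).
    { split; [apply Rinv_0_lt_compat; generalize (Hwx x); lra|].
      replace 2 with (/ (1 / 2)) by field; apply Rinv_le_contravar; [lra | apply Hwx]. }
    apply Rle_trans with (2 * T ^ 2 * ((2 / T) ^ L * (1 + Rabs x) ^ L * 2)).
    - apply Rmult_le_compat; trivial; [left; apply exp_pos | |].
      + apply Rmult_le_pos; lra.
      + apply Rmult_le_compat; lra.
    - right; unfold K2, Rdiv; rewrite Rpow_mult_distr, pow_inv; unfold L; rewrite (pow_add T).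
      field; repeat split; try apply pow_nonzero; lra. }
  replace (zeta s - B k x)%C with ((zeta s - em_seq s k N0) + (em_seq s k N0 - B k x))%C by ring.
  eapply Rle_trans; [apply Cmod_triangle|]; rewrite ED.
  replace ((K1 + K2) / T ^ N * (1 + Rabs x) ^ (k + 1 + L))
    with (K1 / T ^ N * (1 + Rabs x) ^ (k + 1 + L) + K2 / T ^ N * (1 + Rabs x) ^ (k + 1 + L)) by (field; lra).
  lra.
Qed.

(** * Fourier inversion for smooth functions of compact support *)

Definition bump (c : R) (g : R -> R) : Prop :=
  (forall n x, ex_derive_n g n x) /\ forall x, c < Rabs x -> g x = 0.

Lemma bump_ex_derive c g x : bump c g -> ex_derive g x.
Proof. intros [H _]; apply (H 1%nat x). Qed.

Lemma bump_continuous c g x : bump c g -> continuous g x.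
Proof. intros H; apply (ex_derive_continuous g), (bump_ex_derive c); trivial. Qed.

Lemma Rabs_gt_locally (c x : R) : c < Rabs x -> locally x (fun y => c < Rabs y).
Proof.
  intros H; assert (Hd : 0 < Rabs x - c) by lra.
  exists (mkposreal _ Hd); intros y Hy.
  unfold ball in Hy; simpl in Hy; unfold AbsRing_ball, abs, minus, plus, opp in Hy; simpl in Hy.
  generalize (Rabs_triang_inv x y); rewrite (Rabs_minus_sym x y); unfold Rminus; lra.
Qed.

Lemma Rabs_lt_locally (c x : R) : Rabs x < c -> locally x (fun y => Rabs y < c).
Proof.
  intros H; assert (Hd : 0 < c - Rabs x) by lra.
  exists (mkposreal _ Hd); intros y Hy.
  unfold ball in Hy; simpl in Hy; unfold AbsRing_ball, abs, minus, plus, opp in Hy; simpl in Hy.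
  generalize (Rabs_triang_inv y x); unfold Rminus; lra.
Qed.

Lemma bump_Derive c g : bump c g -> bump c (Derive g).
Proof.
  intros [H1 H2]; split.
  - intros [|n] x; [exact I|].
    assert (H := H1 (S (S n)) x); simpl in *.
    apply ex_derive_ext with (2 := H); intros y.
    change (Derive (Derive_n g n) y) with (Derive_n g (S n) y).
    replace (S n) with (n + 1)%nat by lia; symmetry; apply (Derive_n_comp g n 1 y).
  - intros x Hx; rewrite (Derive_ext_loc g (fun _ => 0) x); [apply Derive_const|].
    generalize (Rabs_gt_locally c x Hx); apply filter_imp; exact H2.
Qed.

Lemma bump_Derive_n c g k : bump c g -> bump c (Derive_n g k).
Proof. intros H; induction k as [|k IH]; [exact H | apply (bump_Derive c (Derive_n g k)); trivial]. Qed.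

Lemma bump_bounded c g (d : R) : 0 < d -> bump c g -> exists M, 0 <= M /\ forall x, - d <= x <= d -> Rabs (g x) <= M.
Proof.
  intros Hd Hg.
  destruct (continuity_ab_maj (fun x => Rabs (g x)) (- d) d ltac:(lra)) as [m [Hm _]].
  - intros x _; apply continuity_pt_filterlim.
    apply (continuous_comp g Rabs); [apply (bump_continuous c); trivial | apply continuous_Rabs].
  - exists (Rabs (g m)); split; [apply Rabs_pos | exact Hm].
Qed.

Lemma cderiv_of_quadratic (F : R -> C) (y : R) (l : C) (K : R) :
  (forall h, Rabs h <= 1 -> Cmod (F (y + h)%R - F y - RtoC h * l) <= K * h ^ 2) -> cderiv F y l.
Proof.
  intros H.
  assert (HK : 0 <= K).
  { generalize (H 1 ltac:(rewrite Rabs_R1; lra)) (Cmod_ge_0 (F (y + 1)%R - F y - RtoC 1 * l)); lra. }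
  assert (E : forall f l', (forall h, Rabs h <= 1 -> Rabs (f (y + h) - f y - h * l') <= K * h ^ 2) -> is_derive f y l').
  { intros f l' Hf; apply is_derive_Reals; intros e He.
    assert (Hd : 0 < Rmin 1 (e / (K + 1))) by (apply Rmin_glb_lt; [lra | apply Rdiv_lt_0_compat; lra]).
    exists (mkposreal _ Hd); intros h Hh0 Hh; simpl in Hh.
    assert (H1 := Rmin_l 1 (e / (K + 1))); assert (H2 := Rmin_r 1 (e / (K + 1))).
    assert (Hp : 0 < Rabs h) by (apply Rabs_pos_lt; trivial).
    replace ((f (y + h) - f y) / h - l') with ((f (y + h) - f y - h * l') / h) by (field; trivial).
    unfold Rdiv; rewrite Rabs_mult, Rabs_inv.
    apply Rle_lt_trans with (K * Rabs h).
    - apply Rmult_le_reg_r with (Rabs h); trivial.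
      rewrite Rmult_assoc, Rinv_l, Rmult_1_r by lra.
      eapply Rle_trans; [apply Hf; lra|]; rewrite <- (pow2_abs h); right; ring.
    - apply Rle_lt_trans with ((K + 1) * Rabs h); [nra|].
      replace e with ((K + 1) * (e / (K + 1))) by (field; lra).
      apply Rmult_lt_compat_l; lra. }
  split; apply E; intros h Hh; (eapply Rle_trans; [|apply H; exact Hh]).
  - replace (Re (F (y + h)) - Re (F y) - h * Re l) with (Re (F (y + h)%R - F y - RtoC h * l)).
    + apply re_le_Cmod.
    + destruct l; simpl; unfold Re; ring.
  - replace (Im (F (y + h)) - Im (F y) - h * Im l) with (Im (F (y + h)%R - F y - RtoC h * l)).
    + apply im_le_Cmod.
    + destruct l; simpl; unfold Im; ring.
Qed.

Definition CInt (f : R -> C) (a b : R) : C := RInt (V := C_R_CompleteNormedModule) f a b.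

Lemma CInt_correct (f : R -> C) (a b : R) : (forall x, ccont f x) -> is_CInt f a b (CInt f a b).
Proof.
  intros H; apply (RInt_correct (V := C_R_CompleteNormedModule)), (ex_RInt_continuous (V := C_R_CompleteNormedModule)).
  intros; apply ccont_continuous, H.
Qed.

Lemma CInt_unique (f : R -> C) (a b : R) (l : C) : is_CInt f a b l -> CInt f a b = l.
Proof. apply (is_RInt_unique (V := C_R_CompleteNormedModule)). Qed.

Lemma CInt_le (f : R -> C) (a b M : R) (l : C) : a <= b ->
  (forall x, a <= x <= b -> Cmod (f x) <= M) -> is_CInt f a b l -> Cmod l <= (b - a) * M.
Proof.
  intros Hab Hf Hl; rewrite <- norm_Cmod.
  apply (norm_RInt_le (V := C_R_NormedModule) f (fun _ => M) a b); trivial.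
  - intros x Hx; rewrite norm_Cmod; apply Hf, Hx.
  - apply (is_RInt_const (V := R_NormedModule)).
Qed.

Lemma is_CInt_plus f g a b (l m : C) : is_CInt f a b l -> is_CInt g a b m -> is_CInt (fun x => f x + g x)%C a b (l + m)%C.
Proof. apply (is_RInt_plus (V := C_R_NormedModule)). Qed.

Lemma is_CInt_ext f g a b (l : C) : (forall x, f x = g x) -> is_CInt f a b l -> is_CInt g a b l.
Proof. intros H; apply (is_RInt_ext (V := C_R_NormedModule)); intros; apply H. Qed.

Lemma is_CInt_eq f a b (l l' : C) : l = l' -> is_CInt f a b l -> is_CInt f a b l'.
Proof. now intros <-. Qed.

(** Differentiation under the integral sign: an explicit quadratic remainder, uniform in u, survives
    integration. *)
Lemma cderiv_CInt_param (h h' : R -> R -> C) (a b y K : R) : a <= b ->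
  (forall y u, ccont (h y) u) -> (forall u, ccont (h' y) u) ->
  (forall d u, Rabs d <= 1 -> a <= u <= b -> Cmod (h (y + d) u - h y u - RtoC d * h' y u) <= K * d ^ 2) ->
  cderiv (fun y => CInt (h y) a b) y (CInt (h' y) a b).
Proof.
  intros Hab Hc Hc' HK; apply cderiv_of_quadratic with ((b - a) * K); intros d Hd.
  assert (HI := is_CInt_plus _ _ _ _ _ _
    (is_CInt_plus _ _ _ _ _ _ (CInt_correct (h (y + d)) a b (Hc _)) (is_CInt_scal _ _ _ (- (1)) _ (CInt_correct (h y) a b (Hc _))))
    (is_CInt_scal _ _ _ (- RtoC d) _ (CInt_correct (h' y) a b Hc'))).
  replace (_ - _ - _)%C with (CInt (h (y + d)%R) a b + - (1) * CInt (h y) a b + - RtoC d * CInt (h' y) a b)%C by ring.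
  rewrite Rmult_assoc.
  apply (CInt_le _ a b) with (3 := HI); trivial.
  intros u Hu; cbv beta; replace (_ + _)%C with (h (y + d)%R u - h y u - RtoC d * h' y u)%C by ring.
  apply HK; trivial.
Qed.

Lemma cis_cderiv (s u : R) : cderiv (fun u => Cexp (0, (s * u)%R)) u (Ci * RtoC s * Cexp (0, (s * u)%R))%C.
Proof.
  split; unfold Cexp, Ci, RtoC, Cmult, Re, Im; simpl; auto_derive; trivial; rewrite exp_0; ring.
Qed.

Lemma cis_ccont (s u : R) : ccont (fun u => Cexp (0, (s * u)%R)) u.
Proof. eapply cderiv_ccont, cis_cderiv. Qed.

(** Agrees with [fourier] when the support lies inside (-d, d), see [fourier_cft]. Over a compact
    interval the integral is proper, and with d beyond the support the boundary terms of
    integrations by parts vanish. *)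
Definition cft (d : R) (g : R -> R) (x : R) : C :=
  CInt (fun u => RtoC (g u) * Cexp (0, (- (2 * PI * x) * u)%R))%C (- d) d.

Lemma cft_integrand_ccont c g x u : bump c g -> ccont (fun u => RtoC (g u) * Cexp (0, (- (2 * PI * x) * u)%R))%C u.
Proof.
  intros Hg; apply (ccont_mult (fun u => RtoC (g u))); [apply (ccont_RtoC g), (bump_continuous c); trivial | apply cis_ccont].
Qed.

Lemma cft_correct c d g x : bump c g ->
  is_CInt (fun u => RtoC (g u) * Cexp (0, (- (2 * PI * x) * u)%R))%C (- d) d (cft d g x).
Proof. intros Hg; apply CInt_correct; intros u; apply (cft_integrand_ccont c); trivial. Qed.

Lemma cft_Derive c d g x : bump c g -> 0 < d -> c < d ->
  cft d (Derive g) x = (RtoC (2 * PI * x) * Ci * cft d g x)%C.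
Proof.
  intros Hg Hd Hcd.
  assert (H0 : forall u, Rabs u = d -> g u = 0) by (intros u Hu; apply Hg; lra).
  assert (H := cFTC (fun u => RtoC (g u) * Cexp (0, (- (2 * PI * x) * u)%R))%C
    (fun u => RtoC (Derive g u) * Cexp (0, (- (2 * PI * x) * u)%R) + RtoC (g u) * (Ci * RtoC (- (2 * PI * x)) * Cexp (0, (- (2 * PI * x) * u)%R)))%C (- d) d).
  assert (H1 := H ltac:(intros u _; split;
    [apply (cderiv_mult (fun u => RtoC (g u))); [apply (cderiv_RtoC g), Derive_correct, (bump_ex_derive c); trivial | apply cis_cderiv]
    |apply ccont_plus; [apply (cft_integrand_ccont c (Derive g)), bump_Derive; trivial
      |apply (ccont_mult (fun u => RtoC (g u))); [apply (ccont_RtoC g), (bump_continuous c); trivial | apply ccont_mult; [apply ccont_const | apply cis_ccont]]]])).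
  assert (H2 := is_CInt_plus _ _ _ _ _ _ H1 (is_CInt_scal _ _ _ (RtoC (2 * PI * x) * Ci)%C _ (cft_correct c d g x Hg))).
  cbv beta in H2; rewrite (H0 d), (H0 (- d)) in H2 by (rewrite ?Rabs_Ropp; apply Rabs_pos_eq; lra).
  unfold cft at 1; apply CInt_unique.
  revert H2; match goal with |- is_RInt _ _ _ ?z -> _ => intros H2; apply is_CInt_eq with z end.
  - match goal with |- @eq _ ?y ?z => change (@eq C y z) end; ring.
  - revert H2; apply is_CInt_ext; intros u.
    match goal with |- @eq _ ?y ?z => change (@eq C y z) end; rewrite RtoC_opp; ring.
Qed.

(** One integration by parts for each power of x, each giving a factor 2 pi x with 2 pi >= 1. *)
Lemma cft_decay c d g (k : nat) : bump c g -> 0 < d -> c < d ->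
  exists K, 0 <= K /\ forall x, Rabs x ^ k * Cmod (cft d g x) <= K.
Proof.
  intros Hg Hd Hcd; revert g Hg; induction k as [|k IH]; intros g Hg.
  - destruct (bump_bounded c g d Hd Hg) as [M [HM0 HM]].
    exists ((d - - d) * M); split; [apply Rmult_le_pos; lra|]; intros x; rewrite pow_O, Rmult_1_l.
    apply (CInt_le _ (- d) d _ _ ltac:(lra)) with (2 := cft_correct c d g x Hg).
    intros u Hu; rewrite Cmod_mult, Cmod_cis, Cmod_R, Rmult_1_r; apply HM, Hu.
  - destruct (IH _ (bump_Derive c g Hg)) as [K [HK0 HK]].
    exists K; split; trivial; intros x; eapply Rle_trans; [|apply (HK x)].
    rewrite (cft_Derive c d g x Hg Hd Hcd), !Cmod_mult, Cmod_Ci, Cmod_R, Rmult_1_r, !Rabs_mult, (Rabs_pos_eq 2), (Rabs_pos_eq PI) by (generalize PI_RGT_0; lra).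
    assert (H := PI2_3_2); assert (H1 : 0 <= Rabs x ^ k * (Rabs x * Cmod (cft d g x))).
    { apply Rmult_le_pos; [apply pow_le, Rabs_pos | apply Rmult_le_pos; [apply Rabs_pos | apply Cmod_ge_0]]. }
    simpl; nra.
Qed.

Lemma cft_decay_1 c d g (k : nat) : bump c g -> 0 < d -> c < d ->
  exists K, 0 <= K /\ forall x, (1 + Rabs x) ^ k * Cmod (cft d g x) <= K.
Proof.
  intros Hg Hd Hcd.
  destruct (cft_decay c d g 0 Hg Hd Hcd) as [K0 [H0 HK0]]; destruct (cft_decay c d g k Hg Hd Hcd) as [K1 [H1 HK1]].
  exists (2 ^ k * (K0 + K1)); split; [apply Rmult_le_pos; [apply pow_le; lra | lra]|]; intros x.
  assert (Hp := Rabs_pos x); assert (Hc := Cmod_ge_0 (cft d g x)).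
  assert (Hx : (1 + Rabs x) ^ k <= 2 ^ k * (1 + Rabs x ^ k)).
  { destruct (Rle_dec (Rabs x) 1) as [Hx|Hx].
    - apply Rle_trans with (2 ^ k); [apply pow_incr; lra|].
      assert (0 < 2 ^ k) by (apply pow_lt; lra). assert (0 <= Rabs x ^ k) by (apply pow_le; lra). nra.
    - apply Rle_trans with ((2 * Rabs x) ^ k); [apply pow_incr; lra|].
      rewrite Rpow_mult_distr; apply Rmult_le_compat_l; [apply pow_le; lra | lra]. }
  apply Rle_trans with (2 ^ k * (1 + Rabs x ^ k) * Cmod (cft d g x)); [apply Rmult_le_compat_r; trivial|].
  rewrite Rmult_assoc; apply Rmult_le_compat_l; [apply pow_le; lra|].
  generalize (HK0 x) (HK1 x); rewrite pow_O; lra.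
Qed.

Lemma lipschitz_ccont (F : R -> C) (K : R) : 0 <= K -> (forall x y, Cmod (F x - F y) <= K * Rabs (x - y)) ->
  forall x, ccont F x.
Proof.
  intros HK H x; apply continuous_ccont, filterlim_Cmod; [apply locally_filter|]; intros e.
  assert (He : 0 < e / (K + 1)) by (apply Rdiv_lt_0_compat; [apply cond_pos | lra]).
  exists (mkposreal _ He); intros y Hy; change (Rabs (y - x) < e / (K + 1)) in Hy.
  eapply Rle_lt_trans; [apply H|].
  apply Rle_lt_trans with ((K + 1) * Rabs (y - x)); [generalize (Rabs_pos (y - x)); nra|].
  replace (pos e) with ((K + 1) * (e / (K + 1))) by (field; lra).
  apply Rmult_lt_compat_l; lra.
Qed.

Lemma cft_ccont c d g x : bump c g -> 0 < d -> ccont (cft d g) x.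
Proof.
  intros Hg Hd; destruct (bump_bounded c g d Hd Hg) as [M [HM0 HM]].
  assert (HPI := PI_RGT_0).
  assert (H0 : 0 <= M * (2 * (2 * PI * d))).
  { apply Rmult_le_pos; trivial; assert (0 <= PI * d) by (apply Rmult_le_pos; lra); lra. }
  apply lipschitz_ccont with ((d - - d) * (M * (2 * (2 * PI * d)))); [apply Rmult_le_pos; lra|].
  clear x; intros x y.
  assert (HI := is_CInt_plus _ _ _ _ _ _ (cft_correct c d g x Hg) (is_CInt_scal _ _ _ (- (1)) _ (cft_correct c d g y Hg))).
  replace (_ - _)%C with (cft d g x + - (1) * cft d g y)%C by ring.
  rewrite Rmult_assoc; apply (CInt_le _ (- d) d _ _ ltac:(lra)) with (2 := HI).
  intros u Hu; cbv beta; set (ex := Cexp (0, (- (2 * PI * x) * u)%R)); set (ey := Cexp (0, (- (2 * PI * y) * u)%R)).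
  replace (_ + _)%C with (RtoC (g u) * (ex - ey))%C by ring.
  rewrite Cmod_mult, Cmod_R, Rmult_assoc.
  apply Rmult_le_compat; [apply Rabs_pos | apply Cmod_ge_0 | apply HM; lra|].
  eapply Rle_trans; [apply cis_lipschitz|].
  replace (2 * (2 * PI * d) * Rabs (x - y)) with (2 * ((2 * PI * d) * Rabs (x - y))) by ring; apply Rmult_le_compat_l; [lra|].
  replace (- (2 * PI * x) * u - - (2 * PI * y) * u) with (2 * PI * (- u) * (x - y)) by ring.
  rewrite Rabs_mult; apply Rmult_le_compat_r; [apply Rabs_pos|].
  rewrite Rabs_mult, (Rabs_pos_eq (2 * PI)) by lra; apply Rmult_le_compat_l; [lra|]; apply Rabs_le; lra.
Qed.

Lemma at_point_filterlim {V : UniformSpace} (F : R -> V) (a : R) : filterlim F (at_point a) (locally (F a)).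
Proof. intros P HP; exact (locally_singleton (F a) P HP). Qed.

Lemma lorentz_dom_half (h : R -> C) (K : R) : 0 <= K ->
  (forall x, ccont h x) -> (forall x, 0 <= x -> Cmod (h x) <= K / (1 + x ^ 2)) ->
  exists l, is_CInt_gen h (at_point 0) p_inf l /\ Cmod l <= K * (PI / 2).
Proof.
  intros HK Hc Hb.
  destruct (cRInt_gen_dom (fun x => 0 <= x) (at_point 0) p_inf h (fun x => K / (1 + x ^ 2)) (fun x => K * atan x)
    (K * atan 0) (K * (PI / 2))) as [l [H1 H2]].
  - apply dom_filters_half.
  - intros x Hx; split; [apply atan_scal_deriv | split; [apply lorentz_continuous | apply Hb, Hx]].
  - intros; apply Hc.
  - apply (at_point_filterlim (fun x => K * atan x)).
  - apply atan_p_inf, HK.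
  - exists l; split; trivial; rewrite atan_0 in H2; lra.
Qed.

Lemma is_CInt_reflect (h : R -> C) (a b : R) (l : C) :
  is_CInt h (- b) (- a) l -> is_CInt (fun y => h (- y)) a b l.
Proof.
  intros H.
  apply (is_RInt_swap (V := C_R_NormedModule)), (is_RInt_comp_opp (V := C_R_NormedModule)), (is_RInt_opp (V := C_R_NormedModule)) in H.
  rewrite (opp_opp (G := C_R_NormedModule)) in H.
  revert H; apply (is_RInt_ext (V := C_R_NormedModule)); intros x _; apply (opp_opp (G := C_R_NormedModule)).
Qed.

Lemma is_CInt_gen_reflect (h : R -> C) (l : C) :
  is_CInt_gen h (at_point 0) p_inf l -> is_CInt_gen (fun y => h (- y)) m_inf (at_point 0) l.
Proof.
  intros H P HP; destruct (H P HP) as [Q1 Q2 H1 [M H2] H3].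
  exists (fun x => Q2 (- x)) (fun x => Q1 (- x)).
  - exists (- M); intros x Hx; apply H2; lra.
  - unfold at_point in *; rewrite Ropp_0; exact H1.
  - intros x y Hx Hy; destruct (H3 _ _ Hy Hx) as [z [Hz Pz]].
    exists z; split; trivial; apply is_CInt_reflect; exact Hz.
Qed.

Lemma is_CInt_gen_scale (h : R -> C) (G : R) (l : C) : 0 < G ->
  is_CInt_gen h m_inf p_inf l -> is_CInt_gen (fun x => h (x / G)) m_inf p_inf (RtoC G * l)%C.
Proof.
  intros HG H.
  assert (HG' : 0 < / G) by (apply Rinv_0_lt_compat; trivial).
  assert (K : is_CInt_gen (fun x => RtoC (/ G) * h (x / G)%R)%C m_inf p_inf l).
  { intros P HP; destruct (H P HP) as [Q1 Q2 [M1 H1] [M2 H2] H3].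
    exists (fun x => Q1 (x / G)) (fun x => Q2 (x / G)).
    - exists (M1 * G); intros x Hx; apply H1.
      apply Rmult_lt_reg_r with G; trivial; replace (x / G * G) with x by (field; lra); trivial.
    - exists (M2 * G); intros x Hx; apply H2.
      apply Rmult_lt_reg_r with G; trivial; replace (x / G * G) with x by (field; lra); trivial.
    - intros x y Hx Hy; destruct (H3 _ _ Hx Hy) as [z [Hz Pz]]; simpl in *.
      exists z; split; trivial; simpl.
      assert (Hz' : is_CInt h (/ G * x + 0) (/ G * y + 0) z).
      { replace (/ G * x + 0) with (x / G) by (unfold Rdiv; ring).
        replace (/ G * y + 0) with (y / G) by (unfold Rdiv; ring). exact Hz. }
      apply (is_RInt_comp_lin (V := C_R_NormedModule)) in Hz'.
      revert Hz'; apply (is_RInt_ext (V := C_R_NormedModule)); intros u _.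
      replace (/ G * u + 0) with (u / G) by (unfold Rdiv; ring).
      generalize (h (u / G)); intros [p q].
      apply injective_projections; cbv -[Rplus Rmult Rminus Ropp Rinv Rdiv R0 R1 IZR]; ring. }
  apply (is_CInt_gen_scal _ _ _ (RtoC G)) in K.
  revert K; apply is_CInt_gen_ext; try typeclasses eauto; trivial.
  intros x; rewrite RtoC_inv by lra; field; apply RtoC_neq; lra.
Qed.

(** * Half-line Fourier integrals by Abel summation *)

Section Inversion.
Variables (c d : R) (Hd : 0 < d) (Hcd : c < d).

(* abel_prim g v e is an antiderivative of cft g y e^{2 pi i v y} e^{-e y};
   the Abel factor e^{-e y} makes it vanish at +oo. *)
Definition abel_freq (v e u : R) : C := (- e, 2 * PI * (v - u)).

Definition abel_prim (g : R -> R) (v e y : R) : C :=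
  CInt (fun u => RtoC (g u) * (Cexp (abel_freq v e u * RtoC y) / abel_freq v e u))%C (- d) d.

Lemma abel_freq_ge v e u : 0 < e -> e <= Cmod (abel_freq v e u).
Proof.
  intros He; generalize (re_le_Cmod (abel_freq v e u)); simpl; rewrite Rabs_Ropp, Rabs_pos_eq; lra.
Qed.

Lemma abel_freq_neq v e u : 0 < e -> abel_freq v e u <> 0.
Proof. intros He; apply Cmod_gt_0; generalize (abel_freq_ge v e u He); lra. Qed.

Lemma abel_exp v e u y :
  Cexp (abel_freq v e u * RtoC y) = (RtoC (exp (- e * y)) * Cexp (0, (2 * PI * v * y)%R) * Cexp (0, (- (2 * PI * y) * u)%R))%C.
Proof.
  rewrite <- Cmult_assoc, <- cis_plus; unfold abel_freq, Cexp, RtoC, Cmult; simpl.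
  rewrite exp_0; replace (- e * 0 + 2 * PI * (v - u) * y) with (2 * PI * v * y + - (2 * PI * y) * u) by ring.
  replace (- e * y - 2 * PI * (v - u) * 0) with (- e * y) by ring.
  f_equal; ring.
Qed.

Lemma abel_exp_ccont v e y u : ccont (fun u => Cexp (abel_freq v e u * RtoC y)) u.
Proof.
  apply ccont_ext with (2 := ccont_mult _ _ _ (ccont_const (RtoC (exp (- e * y)) * Cexp (0, (2 * PI * v * y)%R))%C u) (cis_ccont (- (2 * PI * y)) u)).
  intros x; symmetry; apply abel_exp.
Qed.

Lemma abel_inv_ccont v e u : 0 < e -> ccont (fun u => / abel_freq v e u)%C u.
Proof.
  intros He; assert (H : forall u, 0 < e ^ 2 + (2 * PI * (v - u)) ^ 2).
  { intros x; assert (0 < e ^ 2) by (apply pow_lt; trivial); generalize (pow2_ge_0 (2 * PI * (v - x))); lra. }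
  unfold abel_freq, Cinv; split; simpl.
  - apply (ex_derive_continuous (fun y => - e / (- e * (- e * 1) + 2 * PI * (v - y) * (2 * PI * (v - y) * 1)))).
    auto_derive; generalize (H u); simpl; intros; repeat split; lra.
  - apply (ex_derive_continuous (fun y => - (2 * PI * (v - y)) / (- e * (- e * 1) + 2 * PI * (v - y) * (2 * PI * (v - y) * 1)))).
    auto_derive; generalize (H u); simpl; intros; repeat split; lra.
Qed.

Lemma abel_integrand_ccont g v e y u : bump c g -> 0 < e ->
  ccont (fun u => RtoC (g u) * (Cexp (abel_freq v e u * RtoC y) / abel_freq v e u))%C u.
Proof.
  intros Hg He; apply (ccont_mult (fun u => RtoC (g u))); [apply (ccont_RtoC g), (bump_continuous c); trivial|].
  apply ccont_mult; [apply abel_exp_ccont | apply abel_inv_ccont; trivial].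
Qed.

Lemma abel_prim_deriv g v e y : bump c g -> 0 < e ->
  cderiv (abel_prim g v e) y (cft d g y * Cexp (0, (2 * PI * v * y)%R) * RtoC (exp (- e * y)))%C.
Proof.
  intros Hg He.
  assert (HPI := PI_RGT_0).
  destruct (bump_bounded c g d Hd Hg) as [M [HM0 HM]].
  (* A bound for the frequency w on [-d, d]. The remainder e^{wh} - 1 - wh carries the factor w^2,
     so it is O(h^2) uniformly in u even after division by w. *)
  set (W := e + 2 * PI * (Rabs v + d)).
  assert (HW : forall u, - d <= u <= d -> Cmod (abel_freq v e u) <= W).
  { intros u Hu; replace (abel_freq v e u) with (RtoC (- e) + Ci * RtoC (2 * PI * (v - u)))%C
      by (unfold abel_freq, Ci, RtoC, Cplus, Cmult; simpl; f_equal; ring).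
    eapply Rle_trans; [apply Cmod_triangle|]; rewrite Cmod_mult, Cmod_Ci, !Cmod_R, Rmult_1_l, Rabs_Ropp, (Rabs_pos_eq e) by lra.
    unfold W; apply Rplus_le_compat_l; rewrite Rabs_mult, (Rabs_pos_eq (2 * PI)) by lra.
    apply Rmult_le_compat_l; [lra|]; eapply Rle_trans; [apply Rabs_triang|]; rewrite Rabs_Ropp.
    apply Rplus_le_compat_l, Rabs_le; lra. }
  assert (HW0 : 0 <= W) by (unfold W; generalize (Rabs_pos v); intros; assert (0 <= 2 * PI * (Rabs v + d)) by (apply Rmult_le_pos; lra); lra).
  set (h' := fun y u => (RtoC (g u) * Cexp (abel_freq v e u * RtoC y))%C).
  eapply cderiv_eq.
  - apply (cderiv_CInt_param (fun y u => RtoC (g u) * (Cexp (abel_freq v e u * RtoC y) / abel_freq v e u))%C h' (- d) d y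
      (M * (exp (- e * y) * (4 * W * exp W)))); [lra|..].
    + intros; apply abel_integrand_ccont; trivial.
    + intros u; apply (ccont_mult (fun u => RtoC (g u))); [apply (ccont_RtoC g), (bump_continuous c); trivial | apply abel_exp_ccont].
    + intros dl u Hdl Hu; unfold h'.
      assert (Hw0 := abel_freq_neq v e u He); assert (HwW := HW u Hu); assert (Hwe := abel_freq_ge v e u He).
      assert (HE : Cmod (Cexp (abel_freq v e u * RtoC y)) = exp (- e * y)).
      { rewrite Cmod_Cexp; f_equal; simpl; ring. }
      set (w := abel_freq v e u) in *.
      replace (RtoC (y + dl)) with (RtoC y + RtoC dl)%C by (now rewrite RtoC_plus).
      rewrite Cmult_plus_distr_l, Cexp_plus.
      replace (_ - _ - _)%C with (RtoC (g u) * (Cexp (w * RtoC y) * ((Cexp (w * RtoC dl) - 1 - w * RtoC dl) / w)))%C by (field; trivial).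
      rewrite 2!Cmod_mult, HE, Cmod_R, Cmod_div by trivial.
      rewrite !Rmult_assoc; apply Rmult_le_compat; [apply Rabs_pos | | apply HM, Hu |].
      { apply Rmult_le_pos; [left; apply exp_pos | apply Rdiv_le_0_compat; [apply Cmod_ge_0 | lra]]. }
      apply Rmult_le_compat_l; [left; apply exp_pos|].
      apply Rmult_le_reg_r with (Cmod w); [lra|].
      unfold Rdiv; rewrite Rmult_assoc, Rinv_l, Rmult_1_r by lra.
      eapply Rle_trans; [apply Cexp_bound2|]; rewrite Cmod_mult, Cmod_R.
      assert (Hc1 : Cmod w * Rabs dl <= W) by (generalize (Rabs_pos dl); nra).
      assert (He1 : exp (Cmod w * Rabs dl) <= exp W) by (apply exp_le; trivial).
      rewrite Rpow_mult_distr, pow2_abs.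
      assert (Hd2 := pow2_ge_0 dl); assert (Hp := exp_pos (Cmod w * Rabs dl)).
      apply Rle_trans with (4 * (Cmod w ^ 2 * dl ^ 2 * exp W)).
      { apply Rmult_le_compat_l; [lra|]; apply Rmult_le_compat_l; trivial; apply Rmult_le_pos; trivial; apply pow2_ge_0. }
      replace (4 * (Cmod w ^ 2 * dl ^ 2 * exp W)) with (4 * Cmod w * (exp W * dl ^ 2) * Cmod w) by ring.
      replace (4 * (W * (exp W * dl ^ 2)) * Cmod w) with (4 * W * (exp W * dl ^ 2) * Cmod w) by ring.
      apply Rmult_le_compat_r; [lra|]; apply Rmult_le_compat_r; [|lra].
      apply Rmult_le_pos; trivial; left; apply exp_pos.
  - apply CInt_unique.
    assert (H := is_CInt_scal _ _ _ (RtoC (exp (- e * y)) * Cexp (0, (2 * PI * v * y)%R))%C _ (cft_correct c d g y Hg)).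
    revert H; match goal with |- is_RInt _ _ _ ?z -> _ => intros H; apply is_CInt_eq with z end.
    + match goal with |- @eq _ ?p ?q => change (@eq C p q) end; ring.
    + revert H; apply is_CInt_ext; intros u.
      match goal with |- @eq _ ?p ?q => change (@eq C p q) end; unfold h'; rewrite abel_exp; ring.
Qed.

Lemma cft_lorentz g (k : nat) : bump c g ->
  exists K, 0 <= K /\ forall x, Rabs x ^ k * Cmod (cft d g x) <= K / (1 + x ^ 2).
Proof.
  intros Hg; destruct (cft_decay_1 c d g (k + 2) Hg Hd Hcd) as [K [HK0 HK]].
  exists K; split; trivial; intros x.
  assert (H1 : 0 < 1 + x ^ 2) by (generalize (pow2_ge_0 x); lra).
  assert (H2 : 1 + x ^ 2 <= (1 + Rabs x) ^ 2) by (rewrite <- (pow2_abs x); generalize (Rabs_pos x); intros; simpl; nra).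
  assert (H3 : 0 <= Rabs x ^ k <= (1 + Rabs x) ^ k).
  { split; [apply pow_le, Rabs_pos | apply pow_incr; generalize (Rabs_pos x); lra]. }
  apply Rmult_le_reg_r with (1 + x ^ 2); trivial.
  replace (K / (1 + x ^ 2) * (1 + x ^ 2)) with K by (field; lra).
  eapply Rle_trans; [|apply (HK x)]; rewrite pow_add.
  assert (Hc := Cmod_ge_0 (cft d g x)).
  replace (Rabs x ^ k * Cmod (cft d g x) * (1 + x ^ 2)) with (Rabs x ^ k * (1 + x ^ 2) * Cmod (cft d g x)) by ring.
  apply Rmult_le_compat_r; trivial; apply Rmult_le_compat; lra.
Qed.

(** With the factor e^{-ey} the integral is explicit, since the primitive vanishes at infinity.
    Removing the factor costs at most e times the integral of y |cft g y|, by 1 - e^{-ey} <= ey. *)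
Lemma half_line_abel g v : bump c g ->
  exists (I : C) (K : R), 0 <= K /\ is_CInt_gen (fun y => cft d g y * Cexp (0, (2 * PI * v * y)%R))%C (at_point 0) p_inf I /\
    forall e, 0 < e -> Cmod (I + abel_prim g v e 0) <= K * e.
Proof.
  intros Hg.
  destruct (cft_lorentz g 0 Hg) as [K0 [HK0 H0]]; destruct (cft_lorentz g 1 Hg) as [K1 [HK1 H1]].
  destruct (bump_bounded c g d Hd Hg) as [M [HM0 HM]].
  assert (Hcc : forall x, ccont (fun y => cft d g y * Cexp (0, (2 * PI * v * y)%R))%C x).
  { intros x; apply ccont_mult; [apply (cft_ccont c); trivial | apply cis_ccont]. }
  destruct (lorentz_dom_half (fun y => cft d g y * Cexp (0, (2 * PI * v * y)%R))%C K0 HK0 Hcc) as [I [HI _]].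
  { intros x _; rewrite Cmod_mult, Cmod_cis, Rmult_1_r; generalize (H0 x); simpl; lra. }
  exists I, (K1 * (PI / 2)); split; [apply Rmult_le_pos; [trivial | generalize PI_RGT_0; lra]|]; split; trivial; intros e He.
  assert (HQ : is_CInt_gen (fun y => cft d g y * Cexp (0, (2 * PI * v * y)%R) * RtoC (exp (- e * y)))%C (at_point 0) p_inf (0 - abel_prim g v e 0)%C).
  { apply (cFTC_gen (fun x => 0 <= x) _ _ (abel_prim g v e)).
    - apply dom_filters_half.
    - intros x _; split; [apply abel_prim_deriv; trivial|].
      apply (ccont_mult (fun y => cft d g y * Cexp (0, (2 * PI * v * y)%R))%C); [apply Hcc|].
      apply (ccont_RtoC (fun y => exp (- e * y))), (ex_derive_continuous (fun y => exp (- e * y))); auto_derive; trivial.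
    - apply (at_point_filterlim (V := C_R_NormedModule)).
    - apply (filterlim_p_inf_Cmod _ _ ((d - - d) * (M / e / e))); intros x Hx.
      unfold Cminus; rewrite Copp_0, Cplus_0_r.
      replace ((d - - d) * (M / e / e) / x) with ((d - - d) * (M * (/ (e * x) * / e))) by (field; lra).
      apply (CInt_le (fun u => RtoC (g u) * (Cexp (abel_freq v e u * RtoC x) / abel_freq v e u))%C (- d) d _ _ ltac:(lra)).
      2:{ apply CInt_correct; intros; apply abel_integrand_ccont; trivial. }
      intros u Hu; rewrite Cmod_mult, Cmod_R, Cmod_div, Cmod_Cexp by (apply abel_freq_neq; trivial).
      assert (Hwe := abel_freq_ge v e u He).
      apply Rmult_le_compat; [apply Rabs_pos | | apply HM, Hu|].
      + apply Rdiv_le_0_compat; [left; apply exp_pos | lra].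
      + apply Rmult_le_compat; [left; apply exp_pos | left; apply Rinv_0_lt_compat; lra | | apply Rinv_le_contravar; lra].
        replace (Re (abel_freq v e u * RtoC x)) with (- (e * x)) by (simpl; ring).
        assert (0 < e * x) by (apply Rmult_lt_0_compat; lra).
        rewrite exp_Ropp; apply Rinv_le_contravar; trivial; generalize (exp_ineq1_le (e * x)); lra. }
  assert (HD := is_CInt_gen_plus _ _ _ _ _ _ HI (is_CInt_gen_scal _ _ _ (- (1)) _ HQ)).
  destruct (lorentz_dom_half (fun y => cft d g y * Cexp (0, (2 * PI * v * y)%R) * RtoC (1 - exp (- e * y)))%C (K1 * e)) as [l [Hl1 Hl2]].
  - apply Rmult_le_pos; lra.
  - intros x; apply (ccont_mult (fun y => cft d g y * Cexp (0, (2 * PI * v * y)%R))%C); [apply Hcc|].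
    apply (ccont_RtoC (fun y => 1 - exp (- e * y))), (ex_derive_continuous (fun y => 1 - exp (- e * y))); auto_derive; trivial.
  - intros x Hx; rewrite 2!Cmod_mult, Cmod_cis, Rmult_1_r, Cmod_R.
    assert (Hex : 0 <= e * x) by (apply Rmult_le_pos; lra).
    assert (Hee : exp (- e * x) <= 1) by (rewrite <- exp_0; apply exp_le; lra).
    rewrite Rabs_pos_eq by lra.
    assert (Hee2 : 1 - exp (- e * x) <= e * x) by (generalize (exp_ineq1_le (- e * x)); lra).
    generalize (H1 x); rewrite pow_1, Rabs_pos_eq by trivial; intros HH.
    assert (Hcp := Cmod_ge_0 (cft d g x)).
    apply Rle_trans with (Cmod (cft d g x) * (e * x)); [apply Rmult_le_compat_l; lra|].
    replace (Cmod (cft d g x) * (e * x)) with (x * Cmod (cft d g x) * e) by ring.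
    replace (K1 * e / (1 + x ^ 2)) with (K1 / (1 + x ^ 2) * e) by (unfold Rdiv; ring).
    apply Rmult_le_compat_r; lra.
  - assert (E : (I + abel_prim g v e 0)%C = l).
    { apply (is_CInt_gen_unique (fun y => cft d g y * Cexp (0, (2 * PI * v * y)%R) * RtoC (1 - exp (- e * y)))%C (at_point 0) p_inf); trivial.
      revert HD; apply is_CInt_gen_ext; try typeclasses eauto; [|ring].
      intros x; rewrite RtoC_minus; ring. }
    rewrite E; lra.
Qed.

End Inversion.

Lemma bump_reflect c g : bump c g -> bump c (fun u => g (- u)).
Proof.
  intros [H1 H2]; split.
  - intros n x; apply ex_derive_n_comp_opp, filter_forall; intros y k _; apply H1.
  - intros x Hx; apply H2; rewrite Rabs_Ropp; exact Hx.
Qed.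

Lemma CInt_reflect (f : R -> C) (d : R) : (forall x, ccont f x) -> CInt (fun u => f (- u)) (- d) d = CInt f (- d) d.
Proof.
  intros H; apply CInt_unique, is_CInt_reflect; rewrite Ropp_involutive; apply CInt_correct, H.
Qed.

Lemma CInt_ext (f g : R -> C) (a b : R) : (forall x, f x = g x) -> CInt f a b = CInt g a b.
Proof. intros H; apply (RInt_ext (V := C_R_CompleteNormedModule)); intros; apply H. Qed.

Lemma cft_reflect c d g y : bump c g -> cft d (fun u => g (- u)) y = cft d g (- y).
Proof.
  intros Hg; unfold cft at 2; rewrite <- CInt_reflect by (intros; apply (cft_integrand_ccont c); trivial).
  apply CInt_ext; intros u; f_equal; f_equal; f_equal; ring.
Qed.

Lemma lorentz_kernel_deriv (v e u : R) : 0 < e ->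
  is_derive (fun u => / PI * atan (2 * PI * (u - v) / e)) u (2 * e / (e ^ 2 + (2 * PI * (v - u)) ^ 2)).
Proof.
  intros He; assert (HPI := PI_RGT_0).
  assert (H : 0 < e ^ 2) by (apply pow_lt; trivial). assert (H1 := pow2_ge_0 (2 * PI * (v - u))).
  assert (H2 := pow2_ge_0 (2 * PI * (u - v) / e)).
  auto_derive; [trivial|].
  field; repeat split; try lra.
Qed.

Lemma atan_near_1 (v e d : R) : 0 < e -> 0 < d ->
  Rabs (/ PI * atan (2 * PI * d / e) - 1 / 2) <= e / d.
Proof.
  intros He Hd; assert (HPI := PI2_3_2).
  assert (Hp : 0 < 2 * PI * d / e).
  { apply Rdiv_lt_0_compat; trivial; apply Rmult_lt_0_compat; lra. }
  assert (H1 := atan_ge_sub_inv _ Hp). assert (H2 := atan_bound (2 * PI * d / e)).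
  replace (/ PI * atan (2 * PI * d / e) - 1 / 2) with (/ PI * (atan (2 * PI * d / e) - PI / 2)) by (field; lra).
  assert (Hi : 0 < / PI <= 1).
  { split; [apply Rinv_0_lt_compat; lra | rewrite <- Rinv_1; apply Rinv_le_contravar; lra]. }
  rewrite Rabs_mult, Rabs_pos_eq by lra.
  assert (Hq : / (2 * PI * d / e) <= e / d).
  { replace (/ (2 * PI * d / e)) with (e / d * / (2 * PI)) by (field; lra).
    assert (0 < e / d) by (apply Rdiv_lt_0_compat; lra).
    assert (/ (2 * PI) <= 1) by (rewrite <- Rinv_1; apply Rinv_le_contravar; lra). nra. }
  assert (Ha : Rabs (atan (2 * PI * d / e) - PI / 2) <= e / d) by (apply Rabs_le; lra).
  generalize (Rabs_pos (atan (2 * PI * d / e) - PI / 2)); nra.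
Qed.

(** The Abel boundary terms of the two half-lines add up to minus the integral of g against a
    Poisson kernel of width e centred at v. Near v, g is the constant gam; away from v the kernel is
    O(e), and its mass outside [-d, d] is O(e) too. All errors are thus O(e), with no modulus of
    continuity involved, and e tends to 0. *)
Lemma fourier_inversion_const c d g v r (gam : R) : bump c g -> 0 < d -> c < d -> Rabs v < d -> 0 < r ->
  (forall u, Rabs (u - v) < r -> g u = gam) ->
  is_CInt_gen (fun y => cft d g y * Cexp (0, (2 * PI * v * y)%R))%C m_inf p_inf (RtoC gam).
Proof.
  intros Hg Hd Hcd Hv Hr Hgam; assert (HPI := PI_RGT_0).
  apply Rabs_def2 in Hv.
  destruct (half_line_abel c d Hd Hcd g v Hg) as [Ip [Kp [HKp [HIp HAp]]]].
  (* The negative half-line is the positive one for the reflected function at the reflected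
     point. *)
  destruct (half_line_abel c d Hd Hcd (fun u => g (- u)) (- v) (bump_reflect c g Hg)) as [Im' [Km [HKm [HIm HAm]]]].
  apply is_CInt_gen_reflect in HIm.
  assert (HIm' : is_CInt_gen (fun y => cft d g y * Cexp (0, (2 * PI * v * y)%R))%C m_inf (at_point 0) Im').
  { revert HIm; apply is_CInt_gen_ext; trivial; try typeclasses eauto.
    intros y; rewrite (cft_reflect c), Ropp_involutive by trivial; f_equal; f_equal; f_equal; ring. }
  assert (HI := is_RInt_gen_Chasles (V := C_R_NormedModule) _ _ _ _ HIm' HIp).
  change (is_CInt_gen (fun y => cft d g y * Cexp (0, (2 * PI * v * y)%R))%C m_inf p_inf (Im' + Ip)%C) in HI.
  assert (E : (Im' + Ip)%C = RtoC gam); [|rewrite <- E; exact HI].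
  destruct (bump_bounded c g d Hd Hg) as [M [HM0 HM]].
  (* In order: the two Abel errors, the part of [-d, d] at distance at least r from v, and the
     kernel mass missing on either side. *)
  set (K := Kp + Km + (d - - d) * ((M + Rabs gam) * (2 / (4 * r ^ 2))) + Rabs gam * (/ (d - v) + / (d + v))).
  assert (HK : forall e, 0 < e -> Cmod (Im' + Ip - RtoC gam) <= K * e).
  { intros e He.
    set (ker := fun u => 2 * e / (e ^ 2 + (2 * PI * (v - u)) ^ 2)).
    assert (He2 : 0 < e ^ 2) by (apply pow_lt; trivial).
    assert (Hden : forall u, 0 < e ^ 2 + (2 * PI * (v - u)) ^ 2) by (intros u; generalize (pow2_ge_0 (2 * PI * (v - u))); lra).
    assert (Hker : forall u, continuous ker u).
    { intros u; apply (ex_derive_continuous ker); unfold ker; auto_derive; generalize (Hden u); simpl; lra. }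
    assert (EA : (abel_prim d g v e 0 + abel_prim d (fun u => g (- u)%R) (- v)%R e 0)%C = CInt (fun u => RtoC (- (g u * ker u))) (- d) d).
    { assert (E1 : abel_prim d (fun u => g (- u)) (- v) e 0 = CInt (fun u => RtoC (g u) * (Cexp (abel_freq v e u * RtoC 0) / (- RtoC (2 * e) - abel_freq v e u)))%C (- d) d).
      { unfold abel_prim; rewrite <- CInt_reflect.
        - apply CInt_ext; intros u; cbv beta; rewrite Ropp_involutive, !Cmult_0_r; f_equal; f_equal.
          unfold abel_freq, RtoC, Cminus, Cplus, Copp; simpl; f_equal; ring.
        - intros u; apply (abel_integrand_ccont c (fun u => g (- u))); trivial; apply bump_reflect; trivial. }
      rewrite E1.
      assert (Hn : forall u, (- RtoC (2 * e) - abel_freq v e u)%C <> 0).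
      { intros u H; apply (f_equal fst) in H; simpl in H; lra. }
      assert (H1 : is_CInt (fun u => RtoC (g u) * (Cexp (abel_freq v e u * RtoC 0) / abel_freq v e u))%C (- d) d (abel_prim d g v e 0)).
      { apply CInt_correct; intros; apply (abel_integrand_ccont c); trivial. }
      assert (HS : is_CInt (fun u => RtoC (- (g u * ker u))) (- d) d (CInt (fun u => RtoC (- (g u * ker u))) (- d) d)).
      { apply CInt_correct; intros u; apply (ccont_RtoC (fun u => - (g u * ker u))).
        apply (continuous_opp (V := R_NormedModule)), (continuous_mult (K := R_AbsRing)); [apply (bump_continuous c); trivial | apply Hker]. }
      assert (H2 := is_CInt_plus _ _ _ _ _ _ HS (is_CInt_scal _ _ _ (- (1)) _ H1)).
      assert (H3 : CInt (fun u => RtoC (g u) * (Cexp (abel_freq v e u * RtoC 0) / (- RtoC (2 * e) - abel_freq v e u)))%C (- d) d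
        = (CInt (fun u => RtoC (- (g u * ker u))) (- d) d + - (1) * abel_prim d g v e 0)%C).
      { apply CInt_unique; revert H2; apply is_CInt_ext; intros u.
        match goal with |- @eq _ ?p ?q => change (@eq C p q) end.
        rewrite Cmult_0_r, Cexp_0.
        assert (EK : RtoC (ker u) = (- (/ (- RtoC (2 * e) - abel_freq v e u) + / abel_freq v e u))%C).
        { generalize (Hden u); unfold ker, abel_freq, RtoC, Cinv, Cminus, Cplus, Copp; simpl; intros HH.
          f_equal; field; nra. }
        rewrite RtoC_opp, RtoC_mult, EK; unfold Cdiv; ring. }
      rewrite H3; ring. }
    assert (HR : is_CInt (fun u => RtoC (gam * ker u)) (- d) d (RtoC (gam * (/ PI * atan (2 * PI * (d - v) / e) - / PI * atan (2 * PI * (- d - v) / e))))).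
    { assert (H := cFTC (fun u => RtoC gam * RtoC (/ PI * atan (2 * PI * (u - v) / e)))%C (fun u => RtoC gam * RtoC (ker u))%C (- d) d).
      cbv beta in H.
      assert (H1 := H ltac:(intros u _; split;
        [eapply cderiv_eq; [apply cderiv_mult; [apply cderiv_const | apply (cderiv_RtoC (fun u => / PI * atan (2 * PI * (u - v) / e))), (lorentz_kernel_deriv v e u He)]
          | unfold ker; ring]
        | apply ccont_mult; [apply ccont_const | apply ccont_RtoC, Hker]])).
      apply is_CInt_eq with (2 := is_CInt_ext _ _ _ _ _ (fun u => eq_sym (RtoC_mult gam (ker u))) H1).
      rewrite (RtoC_mult gam), RtoC_minus; cbv beta; match goal with |- @eq _ ?p ?q => change (@eq C p q) end; ring. }
    assert (HD : is_CInt (fun u => RtoC (- (g u * ker u)) + RtoC (gam * ker u))%C (- d) d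
      (CInt (fun u => RtoC (- (g u * ker u))) (- d) d + RtoC (gam * (/ PI * atan (2 * PI * (d - v) / e) - / PI * atan (2 * PI * (- d - v) / e))))%C).
    { apply is_CInt_plus; trivial.
      apply CInt_correct; intros u; apply (ccont_RtoC (fun u => - (g u * ker u))).
      apply (continuous_opp (V := R_NormedModule)), (continuous_mult (K := R_AbsRing)); [apply (bump_continuous c); trivial | apply Hker]. }
    apply (CInt_le _ (- d) d ((M + Rabs gam) * (2 / (4 * r ^ 2)) * e) _ ltac:(lra)) in HD.
    2:{ intros u Hu; rewrite <- RtoC_plus, Cmod_R.
        replace (- (g u * ker u) + gam * ker u) with ((gam - g u) * ker u) by ring.
        assert (Hr2 : 0 < 4 * r ^ 2) by (assert (0 < r ^ 2) by (apply pow_lt; trivial); lra).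
        assert (HKK : 0 <= (M + Rabs gam) * (2 / (4 * r ^ 2)) * e).
        { apply Rmult_le_pos; [apply Rmult_le_pos|lra]; [generalize (Rabs_pos gam); lra | apply Rdiv_le_0_compat; lra]. }
        destruct (Rlt_dec (Rabs (u - v)) r) as [Hlt|Hge].
        - rewrite (Hgam u Hlt); replace ((gam - gam) * ker u) with 0 by ring; rewrite Rabs_R0; exact HKK.
        - rewrite Rmult_assoc, Rabs_mult; apply Rmult_le_compat; try apply Rabs_pos.
          + generalize (Rabs_triang gam (- g u)) (HM u Hu); rewrite Rabs_Ropp; unfold Rminus; lra.
          + unfold ker; rewrite Rabs_pos_eq by (apply Rdiv_le_0_compat; [lra | apply Hden]).
            replace (2 / (4 * r ^ 2) * e) with (2 * e / (4 * r ^ 2)) by (unfold Rdiv; ring).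
            apply Rmult_le_compat_l; [lra|]; apply Rinv_le_contravar; trivial.
            assert (r ^ 2 <= (v - u) ^ 2) by (rewrite <- (pow2_abs (v - u)), Rabs_minus_sym; apply pow_incr; lra).
            assert (1 <= PI ^ 2) by (generalize PI2_3_2; intros; nra).
            replace ((2 * PI * (v - u)) ^ 2) with (4 * (PI ^ 2 * (v - u) ^ 2)) by ring.
            assert (1 * r ^ 2 <= PI ^ 2 * (v - u) ^ 2) by (apply Rmult_le_compat; try lra; apply pow2_ge_0). lra. }
    set (A1 := / PI * atan (2 * PI * (d - v) / e)) in *.
    assert (EA2 : / PI * atan (2 * PI * (- d - v) / e) = - (/ PI * atan (2 * PI * (d + v) / e))).
    { replace (2 * PI * (- d - v) / e) with (- (2 * PI * (d + v) / e)) by (field; lra); rewrite atan_opp; ring. }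
    rewrite EA2 in HD; set (A2 := / PI * atan (2 * PI * (d + v) / e)) in *.
    assert (B1 := atan_near_1 v e (d - v) He ltac:(lra)); fold A1 in B1.
    assert (B2 := atan_near_1 v e (d + v) He ltac:(lra)); fold A2 in B2.
    assert (B3 : Rabs (A1 - - A2 - 1) <= e / (d - v) + e / (d + v)).
    { replace (A1 - - A2 - 1) with ((A1 - 1 / 2) + (A2 - 1 / 2)) by field.
      eapply Rle_trans; [apply Rabs_triang|]; lra. }
    assert (B4 := HAp e He). assert (B5 := HAm e He).
    rewrite <- EA in HD.
    set (q1 := abel_prim d g v e 0) in *; set (q2 := abel_prim d (fun u => g (- u)) (- v) e 0) in *.
    replace (Im' + Ip - RtoC gam)%C with ((Ip + q1) + ((Im' + q2) + (- (q1 + q2 + RtoC (gam * (A1 - - A2))) + RtoC (gam * (A1 - - A2 - 1)))))%C.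
    2:{ rewrite !RtoC_mult, !RtoC_minus, !RtoC_opp; ring. }
    eapply Rle_trans; [apply Cmod_triangle|].
    eapply Rle_trans; [apply Rplus_le_compat_l, Cmod_triangle|].
    eapply Rle_trans; [apply Rplus_le_compat_l, Rplus_le_compat_l, Cmod_triangle|].
    rewrite Cmod_opp, Cmod_R, Rabs_mult.
    assert (B6 : Rabs gam * Rabs (A1 - - A2 - 1) <= Rabs gam * (e / (d - v) + e / (d + v))) by (apply Rmult_le_compat_l; [apply Rabs_pos | trivial]).
    unfold K; unfold Rdiv in *; lra. }
  assert (Hz : Cmod (Im' + Ip - RtoC gam) <= 0).
  { apply Rnot_lt_le; intros Hlt.
    set (z := Cmod (Im' + Ip - RtoC gam)) in *.
    assert (HK0 : 0 < K) by (generalize (HK 1 Rlt_0_1); lra).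
    generalize (HK (z / (2 * K)) ltac:(apply Rdiv_lt_0_compat; lra)).
    replace (K * (z / (2 * K))) with (z / 2) by (field; lra). lra. }
  assert (Hz0 : Cmod (Im' + Ip - RtoC gam) = 0) by (generalize (Cmod_ge_0 (Im' + Ip - RtoC gam)); lra).
  apply Cmod_eq_0 in Hz0.
  replace (Im' + Ip)%C with ((Im' + Ip - RtoC gam) + RtoC gam)%C by ring; rewrite Hz0; ring.
Qed.

(** * The reproducing kernel *)

Lemma is_RInt_zero {V : NormedModule R_AbsRing} (h : R -> V) (a b : R) :
  (forall x, Rmin a b < x < Rmax a b -> h x = zero) -> is_RInt h a b zero.
Proof.
  intros H; apply is_RInt_ext with (fun _ => zero); [intros x Hx; symmetry; apply H, Hx|].
  assert (E : scal (b - a) (zero : V) = zero) by apply (scal_zero_r (V := V)).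
  exact (eq_rect _ (is_RInt (fun _ => zero) a b) (is_RInt_const a b (zero : V)) _ E).
Qed.

Lemma is_RInt_support {V : NormedModule R_AbsRing} (h : R -> V) (c A B : R) (l : V) :
  (forall x, c < Rabs x -> h x = zero) -> is_RInt h (- c) c l -> A <= - c -> c <= B -> is_RInt h A B l.
Proof.
  intros H Hl HA HB; rewrite <- (plus_zero_r l), <- (plus_zero_l l) at 1.
  apply is_RInt_Chasles with c; [apply is_RInt_Chasles with (- c); trivial|].
  - apply is_RInt_zero; intros x Hx; rewrite Rmin_left, Rmax_right in Hx by lra.
    apply H; generalize (Rle_abs (- x)); rewrite Rabs_Ropp; lra.
  - apply is_RInt_zero; intros x Hx; rewrite Rmin_left, Rmax_right in Hx by lra.
    apply H; generalize (Rle_abs x); lra.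
Qed.

Lemma is_RInt_gen_support {V : NormedModule R_AbsRing} (h : R -> V) (c : R) (l : V) :
  (forall x, c < Rabs x -> h x = zero) -> is_RInt h (- c) c l -> is_RInt_gen h m_inf p_inf l.
Proof.
  intros H Hl; apply (is_RInt_gen_lim h (fun _ _ => l) m_inf p_inf).
  - exists (fun x => x < - c) (fun x => c < x); [exists (- c); trivial | exists c; trivial|].
    intros x y Hx Hy; apply (is_RInt_support h c); trivial; simpl; lra.
  - apply filterlim_const.
Qed.

Lemma fourier_cft c d g x : bump c g -> c < d -> fourier g x = cft d g x.
Proof.
  intros Hg Hcd; unfold fourier.
  apply (is_RInt_gen_unique (V := C_R_CompleteNormedModule)).
  apply (is_RInt_gen_support (V := C_R_NormedModule) _ d).
  - intros u Hu; destruct Hg as [_ Hg]; rewrite Hg by lra; apply (Cmult_0_l _).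
  - generalize (cft_correct c d g x Hg); apply is_CInt_ext; intros u; f_equal; f_equal; f_equal; ring.
Qed.

(** * The window is smooth, has compact support and is 1 near 0 *)

Section Window.
Variables (phi : R -> R) (a b : R).
Hypotheses (Hsm : forall n x, ex_derive_n phi n x) (Ha : 0 < a) (Hab : a < b)
  (Hsupp : forall x, a <= Rabs x -> phi x = 0) (Hint : is_RInt_gen phi m_inf p_inf 1).

Lemma phi_continuous x : continuous phi x.
Proof. apply (ex_derive_continuous phi), (Hsm 1 x). Qed.

Lemma phi_is_RInt u v : is_RInt phi u v (RInt phi u v).
Proof.
  apply (RInt_correct (V := R_CompleteNormedModule)), (ex_RInt_continuous (V := R_CompleteNormedModule)).
  intros; apply phi_continuous.
Qed.

Lemma window_deriv x : is_derive (window phi b) x (phi (x + b) - phi (x - b)).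
Proof.
  evar_last.
  - apply (is_derive_RInt_bound_comp (V := R_NormedModule) phi (fun u v => RInt phi u v) (fun x => x - b) (fun x => x + b) 1 1 x).
    + apply filter_forall; intros [u v]; apply phi_is_RInt.
    + apply phi_continuous.
    + apply phi_continuous.
    + auto_derive; trivial.
    + auto_derive; trivial.
  - unfold minus, plus, opp, scal; simpl; unfold mult; simpl; ring.
Qed.

(** Smoothness is inherited from phi through the derivative phi(x + b) - phi(x - b). For |x| > a + b
    the interval of integration misses the support of phi. *)
Lemma window_bump : bump (a + b) (window phi b).
Proof.
  split.
  - assert (HS : forall n x, ex_derive_n (Derive (window phi b)) n x).
    { intros n x; apply ex_derive_n_ext with (fun x => phi (x + b) - phi (x + - b)).
      - intros y; symmetry; apply is_derive_unique, window_deriv.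
      - apply (ex_derive_n_minus (fun x => phi (x + b)) (fun x => phi (x + - b)));
          apply filter_forall; intros y k _; apply ex_derive_n_comp_trans, Hsm. }
    intros [|n] x; [exact I|]; destruct n as [|n].
    + exists (phi (x + b) - phi (x - b)); apply window_deriv.
    + assert (H := HS (S n) x); simpl in *.
      apply ex_derive_ext with (2 := H); intros y.
      change (Derive (Derive_n (window phi b) n) y) with (Derive_n (window phi b) (S n) y).
      replace (S n) with (n + 1)%nat by lia; apply (Derive_n_comp (window phi b) n 1 y).
  - intros x Hx; unfold window; apply (is_RInt_unique (V := R_CompleteNormedModule)).
    apply (is_RInt_zero (V := R_NormedModule)); intros u Hu; rewrite Rmin_left, Rmax_right in Hu by lra.
    apply Hsupp; revert Hx; unfold Rabs; repeat destruct Rcase_abs; lra.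
Qed.

(** For such x the interval [x - b, x + b] contains [-a, a], hence the whole mass of phi. *)
Lemma window_flat x : Rabs x < b - a -> window phi b x = 1.
Proof.
  intros Hx; apply Rabs_def2 in Hx.
  assert (H0 : forall u, a < Rabs u -> phi u = zero) by (intros u Hu; apply Hsupp; lra).
  assert (E1 : RInt phi (- a) a = 1).
  { rewrite <- (is_RInt_gen_unique (V := R_CompleteNormedModule) phi 1 Hint); symmetry.
    apply (is_RInt_gen_unique (V := R_CompleteNormedModule)).
    apply (is_RInt_gen_support (V := R_NormedModule) phi a); [exact H0 | apply phi_is_RInt]. }
  rewrite <- E1; apply (is_RInt_unique (V := R_CompleteNormedModule)).
  apply (is_RInt_support (V := R_NormedModule) phi a); try lra; [exact H0 | apply phi_is_RInt].
Qed.

End Window.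

(** * Moments of the kernel and the reproducing property *)

Section Reproducing.
Variables (c d rho : R) (g : R -> R).
Hypotheses (Hg : bump c g) (Hd : 0 < d) (Hcd : c < d) (Hrd : rho <= d)
  (Hflat : forall u, Rabs u < rho -> g u = 1).

Lemma Derive_n_flat k u : Rabs u < rho -> Derive_n g k u = 0 ^ k.
Proof.
  revert u; induction k as [|k IH]; intros u Hu; [apply Hflat, Hu|].
  rewrite pow_ne_zero by lia.
  change (Derive_n g (S k) u) with (Derive (Derive_n g k) u).
  rewrite (Derive_ext_loc _ (fun _ => 0 ^ k)); [apply Derive_const|].
  generalize (Rabs_lt_locally rho u Hu); apply filter_imp; exact IH.
Qed.

Lemma cft_Derive_n k y : cft d (Derive_n g k) y = (Cpow (RtoC (2 * PI) * Ci) k * (RtoC (y ^ k) * cft d g y))%C.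
Proof.
  induction k as [|k IH]; [change (Derive_n g 0) with g; simpl; ring|].
  transitivity (RtoC (2 * PI * y) * Ci * cft d (Derive_n g k) y)%C.
  - apply (cft_Derive c d (Derive_n g k) y); trivial; apply bump_Derive_n; trivial.
  - rewrite IH, Cpow_S; cbn [pow]; rewrite !RtoC_mult; ring.
Qed.

(** Up to (2 pi i)^k, the factor y^k turns the transform of g into that of its k-th derivative,
    which equals 0^k on the plateau; inversion is applied at v, where that derivative is locally
    constant. *)
Lemma moment_integral v k : Rabs v < rho ->
  is_CInt_gen (fun y => RtoC (y ^ k) * (cft d g y * Cexp (0, (2 * PI * v * y)%R)))%C m_inf p_inf (RtoC (0 ^ k)).
Proof.
  intros Hv; assert (HPI := PI_RGT_0).
  assert (H := fourier_inversion_const c d (Derive_n g k) v (rho - Rabs v) (0 ^ k) (bump_Derive_n c g k Hg) Hd Hcd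
    ltac:(lra) ltac:(lra) ltac:(intros u Hu; apply Derive_n_flat; generalize (Rabs_triang_inv u v); lra)).
  set (z := Cpow (RtoC (2 * PI) * Ci) k).
  assert (Hz : z <> 0).
  { apply Cpow_nz, Cmult_neq_0; [apply RtoC_neq; lra|].
    intros E; apply (f_equal snd) in E; simpl in E; lra. }
  apply (is_CInt_gen_scal _ _ _ (/ z)) in H; revert H.
  apply is_CInt_gen_ext; try typeclasses eauto.
  - intros y; rewrite cft_Derive_n; fold z; field; trivial.
  - destruct k as [|k]; [|rewrite pow_ne_zero by lia; ring].
    unfold z; simpl; field.
Qed.

(* Quantifying over h makes the property multiplicative in p, so that induction
   on p reduces it to the moments of F. *)
Lemma cpoly_moments (F : R -> C) (p : R -> C) : cpoly p -> forall h : R -> C,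
  (forall k, is_CInt_gen (fun y => RtoC (y ^ k) * h y * F y)%C m_inf p_inf (RtoC (0 ^ k) * h 0)%C) ->
  (forall k, is_CInt_gen (fun y => RtoC (y ^ k) * (p y * h y) * F y)%C m_inf p_inf (RtoC (0 ^ k) * (p 0 * h 0))%C).
Proof.
  intros Hp; induction Hp as [z| |p q _ IHp _ IHq|p q _ IHp _ IHq|p q E _ IH]; intros h Hh k.
  - generalize (is_CInt_gen_scal _ _ _ z _ (Hh k)); apply is_CInt_gen_ext; try typeclasses eauto; intros; ring.
  - generalize (Hh (S k)); apply is_CInt_gen_ext; try typeclasses eauto; intros; cbn [pow]; rewrite RtoC_mult; ring.
  - generalize (is_CInt_gen_plus _ _ _ _ _ _ (IHp h Hh k) (IHq h Hh k)); apply is_CInt_gen_ext; try typeclasses eauto; intros; ring.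
  - generalize (IHp (fun y => q y * h y)%C (IHq h Hh) k); apply is_CInt_gen_ext; try typeclasses eauto; intros; ring.
  - generalize (IH h Hh k); apply is_CInt_gen_ext; try typeclasses eauto; intros; now rewrite !E.
Qed.

Lemma expoly_reproducing lo hi A : - (2 * PI * rho) < lo -> hi < 2 * PI * rho -> expoly lo hi A ->
  is_CInt_gen (fun y => A y * cft d g y)%C m_inf p_inf (A 0).
Proof.
  intros Hlo Hhi HA; assert (HPI := PI_RGT_0).
  induction HA as [om p Hom Hp|A1 A2 _ IH1 _ IH2|A1 A2 E _ IH].
  - assert (Hv : Rabs (om / (2 * PI)) < rho).
    { apply Rabs_def1; apply Rmult_lt_reg_r with (2 * PI); try lra;
      replace (om / (2 * PI) * (2 * PI)) with om by (field; lra); lra. }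
    assert (H := cpoly_moments (fun y => cft d g y * Cexp (0, (2 * PI * (om / (2 * PI)) * y)%R))%C p Hp (fun _ => 1)
      ltac:(intros k; generalize (moment_integral _ k Hv); apply is_CInt_gen_ext; try typeclasses eauto; intros; ring) 0%nat).
    revert H; apply is_CInt_gen_ext; try typeclasses eauto.
    + intros y; rewrite pow_O; replace (2 * PI * (om / (2 * PI)) * y) with (om * y) by (field; lra); ring.
    + rewrite pow_O, Rmult_0_r; change (0, 0) with (RtoC 0); rewrite Cexp_0; ring.
  - generalize (is_CInt_gen_plus _ _ _ _ _ _ IH1 IH2); apply is_CInt_gen_ext; try typeclasses eauto; intros; ring.
  - revert IH; apply is_CInt_gen_ext; try typeclasses eauto; intros; now rewrite !E.
Qed.

Lemma cpoly_scale p (G : R) : cpoly p -> cpoly (fun y => p (G * y)).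
Proof.
  intros Hp; induction Hp as [z| |p q _ IHp _ IHq|p q _ IHp _ IHq|p q E _ IH].
  - apply cpoly_const.
  - apply cpoly_ext with (fun y => RtoC G * RtoC y)%C; [intros; now rewrite RtoC_mult|].
    apply cpoly_mult; [apply cpoly_const | apply cpoly_id].
  - apply (cpoly_plus _ _ IHp IHq).
  - apply (cpoly_mult _ _ IHp IHq).
  - apply cpoly_ext with (2 := IH); intros; apply E.
Qed.

Lemma expoly_scale lo hi A (G : R) : 0 < G -> expoly lo hi A -> expoly (G * lo) (G * hi) (fun y => A (G * y)).
Proof.
  intros HG HA; induction HA as [om p Hom Hp|A1 A2 _ IH1 _ IH2|A1 A2 E _ IH].
  - apply expoly_of_mono_ext with (om := G * om) (p := fun y => p (G * y)).
    + split; apply Rmult_le_compat_l; lra.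
    + apply cpoly_scale, Hp.
    + intros x; f_equal; f_equal; f_equal; ring.
  - apply (expoly_plus _ _ _ _ IH1 IH2).
  - apply expoly_ext with (2 := IH); intros; apply E.
Qed.

Lemma expoly_reproducing_scale lo hi A (G : R) : 0 < G -> - (2 * PI * rho) < G * lo -> G * hi < 2 * PI * rho ->
  expoly lo hi A -> is_CInt_gen (fun x => A x * cft d g (x / G)%R)%C m_inf p_inf (RtoC G * A 0)%C.
Proof.
  intros HG Hlo Hhi HA.
  assert (H := is_CInt_gen_scale _ G _ HG (expoly_reproducing _ _ _ Hlo Hhi (expoly_scale _ _ _ G HG HA))).
  revert H; apply is_CInt_gen_ext; try typeclasses eauto.
  - intros x; cbv beta; replace (G * (x / G)) with x by (field; lra); trivial.
  - rewrite Rmult_0_r; trivial.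
Qed.

End Reproducing.

(** * Continuity, growth and approximation of Hardy's function on the real line *)

Lemma ccont_comp (F : R -> C) (f : R -> R) (x : R) : ccont F (f x) -> continuous f x -> ccont (fun y => F (f y)) x.
Proof.
  intros [H1 H2] Hf; split;
    [apply (continuous_comp f (fun y => Re (F y))) | apply (continuous_comp f (fun y => Im (F y)))]; trivial.
Qed.

Lemma cpoly_ccont p x : cpoly p -> ccont p x.
Proof.
  intros Hp; induction Hp as [z| |p q _ IHp _ IHq|p q _ IHp _ IHq|p q E _ IH].
  - apply ccont_const.
  - apply (ccont_RtoC (fun x => x)), continuous_id.
  - apply ccont_plus; trivial.
  - apply ccont_mult; trivial.
  - apply ccont_ext with p; trivial.
Qed.

Lemma expoly_ccont lo hi A x : expoly lo hi A -> ccont A x.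
Proof.
  intros HA; induction HA as [om p Hom Hp|A1 A2 _ IH1 _ IH2|A1 A2 E _ IH].
  - apply ccont_mult; [apply cpoly_ccont; trivial | apply cis_ccont].
  - apply ccont_plus; trivial.
  - apply ccont_ext with A1; trivial.
Qed.

Lemma expoly_weaken lo hi lo' hi' A : lo' <= lo -> hi <= hi' -> expoly lo hi A -> expoly lo' hi' A.
Proof.
  intros H1 H2 HA; induction HA as [om p Hom Hp|A1 A2 _ IH1 _ IH2|A1 A2 E _ IH].
  - apply expoly_mono; [lra | trivial].
  - apply expoly_plus; trivial.
  - apply expoly_ext with A1; trivial.
Qed.

Lemma zeta_line_ccont (t : R) : ccont (fun t => zeta ((1 / 2)%R, t)) t.
Proof.
  set (s := ((1 / 2)%R, t) : C).
  assert (Hs : s <> 1) by (intros E; apply (f_equal fst) in E; simpl in E; lra).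
  assert (H := zeta_holomorphic s ltac:(simpl; lra) Hs).
  apply (ex_derive_continuous (K := C_AbsRing) (V := C_NormedModule)) in H.
  apply continuous_ccont, filterlim_Cmod; [apply locally_filter|]; intros e.
  assert (HP := proj1 (filterlim_locally_ball_norm (U := C_NormedModule) zeta (zeta s)) H e).
  destruct HP as [dl HP]; exists dl; intros u Hu.
  assert (Hb : @ball (AbsRing_UniformSpace C_AbsRing) s dl ((1 / 2)%R, u)).
  { change (Cmod (((1 / 2)%R, u) - s) < dl).
    replace (((1 / 2)%R, u) - s)%C with (Ci * RtoC (u - t))%C by (unfold s, Ci, RtoC, Cminus, Cplus, Copp, Cmult; simpl; f_equal; ring).
    rewrite Cmod_mult, Cmod_Ci, Cmod_R, Rmult_1_l; exact Hu. }
  exact (HP _ Hb).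
Qed.

Lemma HardyZ_ccont lG t : is_logGamma lG -> ccont (HardyZ lG) t.
Proof.
  intros [HlG _]; unfold HardyZ; apply (ccont_mult (fun t => Cexp (0, theta lG t))); [|apply zeta_line_ccont].
  apply (ccont_comp (fun u => Cexp (0, u)) (theta lG)).
  - apply ccont_ext with (2 := cis_ccont 1 (theta lG t)); intros u; now rewrite Rmult_1_l.
  - unfold theta; apply (continuous_minus (V := R_NormedModule)).
    + apply (continuous_comp (fun t => lG ((1 / 4)%R, (t / 2)%R)) (fun z : C => snd z)); [|apply continuous_snd].
      apply (continuous_comp (fun t => ((1 / 4)%R, (t / 2)%R)) lG); [|apply HlG; simpl; lra].
      apply (ccont_continuous (fun t => ((1 / 4)%R, (t / 2)%R))); split; simpl; [apply continuous_const|].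
      apply (ex_derive_continuous (fun y => y / 2)); auto_derive; trivial.
    + apply (ex_derive_continuous (fun y => y / 2 * ln PI)); auto_derive; trivial.
Qed.

(** Euler-Maclaurin with no correction and a single term: 1 + 1/(s - 1) is at most 3 in modulus, and
    the remainder is at most 4 |s|. Any polynomial bound would serve, since the kernel decays faster
    than every power. *)
Lemma zeta_line_le (t : R) : Cmod (zeta ((1 / 2)%R, t)) <= 5 + 4 * Rabs t.
Proof.
  set (s := ((1 / 2)%R, t) : C).
  assert (Hs : s <> 1) by (intros E; apply (f_equal fst) in E; simpl in E; lra).
  assert (H := euler_maclaurin s 0 0 ltac:(simpl; lra) Hs).
  assert (Hms : Cmod s <= 1 / 2 + Rabs t).
  { replace s with (RtoC (1 / 2) + Ci * RtoC t)%C by (unfold s, Ci, RtoC, Cplus, Cmult; simpl; f_equal; ring).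
    eapply Rle_trans; [apply Cmod_triangle|]; rewrite Cmod_mult, Cmod_Ci, !Cmod_R, Rmult_1_l, Rabs_pos_eq by lra; lra. }
  assert (Hms1 : 1 / 2 <= Cmod (s - 1)).
  { generalize (re_le_Cmod (s - 1)); simpl; rewrite Rabs_left by lra; lra. }
  assert (Hr : Cmod (rising s 1) <= Cmod s) by (cbn [rising]; change (INR 0) with 0; rewrite Cmult_1_l, Cplus_0_r; lra).
  assert (H1 : Cmod (em_seq s 0 0) <= 3).
  { unfold em_seq, zeta_seq; rewrite sum_O.
    assert (HR : forall w, Rcpow (INR 1) w = 1).
    { intros w; unfold Rcpow; simpl INR; rewrite ln_1, Cmult_0_r; apply Cexp_0. }
    rewrite !HR; eapply Rle_trans; [apply Cmod_triangle|].
    rewrite Cmod_div, Cmod_1 by (apply Cmod_gt_0; lra).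
    assert (1 / Cmod (s - 1) <= / (1 / 2)) by (unfold Rdiv at 1; rewrite Rmult_1_l; apply Rinv_le_contravar; lra).
    lra. }
  replace (zeta s) with ((zeta s - em_seq s 0 0) + em_seq s 0 0)%C by ring.
  eapply Rle_trans; [apply Cmod_triangle|].
  change (INR 0) with 0 in H; change (INR 1) with 1 in H; rewrite ln_1, Rmult_0_r, exp_0 in H; change (Re s) with (1 / 2) in H; simpl pow in H.
  lra.
Qed.

(** The product of the two expansions. The phase is expanded to order N + 1 because its error is
    multiplied by zeta, which is O(T (1 + |x|)); the error for zeta only meets a factor bounded in
    T. The frequencies of the two factors add. *)
Lemma hardy_expansion (lG : C -> C) (N : nat) (eta : R) : is_logGamma lG -> 0 < eta <= 1 ->
  exists (K : R) (D : nat), 0 <= K /\ forall T t : R, 4 <= T -> T / 2 <= t <= 2 * T ->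
    exists A : R -> C, expoly (- ((5 + ln PI) / 2 + 1 + (1 + eta) * ln T)) (ln T / 2 + 12) A /\
      forall x, Cmod (HardyZ lG (t + x) - A x) <= K / T ^ N * (1 + Rabs x) ^ D.
Proof.
  intros HlG Heta.
  destruct (theta_expansion lG (S N) HlG) as [K1 [D1 [HK1 H1]]].
  destruct (zeta_expansion N eta Heta) as [K2 [D2 [HK2 H2]]].
  exists (13 * K1 + (1 + K1) * K2), (D1 + D2 + 1)%nat; split.
  { assert (0 <= (1 + K1) * K2) by (apply Rmult_le_pos; lra); lra. }
  intros T t HT Ht.
  destruct (H1 T t HT Ht) as [om [p [Hp [Hom Hu]]]]; destruct (H2 T t HT Ht) as [B [HB Hz]].
  exists (fun x => p x * Cexp (0, (om * x)%R) * B x)%C; split.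
  - apply expoly_weaken with (om + - (1 + (1 + eta) * ln T)) (om + 0); [lra | lra | apply expoly_shift; trivial].
  - intros x; unfold HardyZ.
    set (u := Cexp (0, theta lG (t + x))) in *; set (u' := (p x * Cexp (0, (om * x)%R))%C) in *.
    assert (Hx := Rabs_pos x).
    assert (HTN : 1 <= T ^ N) by (apply pow_R1_Rle; lra).
    assert (HTS : T ^ S N = T * T ^ N) by reflexivity.
    specialize (Hu x); specialize (Hz x); fold u u' in Hu.
    set (z := zeta ((1 / 2)%R, (t + x)%R)) in *.
    assert (Hzb : Cmod z <= 13 * T * (1 + Rabs x)).
    { eapply Rle_trans; [apply zeta_line_le|].
      generalize (Rabs_triang t x); rewrite (Rabs_pos_eq t) by lra; intros; nra. }
    assert (HY1 : 1 <= (1 + Rabs x) ^ D1) by (apply pow_R1_Rle; lra).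
    assert (HY2 : 1 <= (1 + Rabs x) ^ D2) by (apply pow_R1_Rle; lra).
    assert (Hu' : Cmod u' <= (1 + K1) * (1 + Rabs x) ^ D1).
    { replace u' with (u + - (u - u'))%C by ring.
      eapply Rle_trans; [apply Cmod_triangle|]; rewrite Cmod_opp; unfold u at 1; rewrite Cmod_cis.
      assert (K1 / T ^ S N <= K1).
      { rewrite HTS; apply Rmult_le_reg_r with (T * T ^ N); [nra|].
        replace (K1 / (T * T ^ N) * (T * T ^ N)) with K1 by (field; lra).
        assert (K1 * 1 <= K1 * (T * T ^ N)) by (apply Rmult_le_compat_l; nra). lra. }
      assert (K1 / T ^ S N * (1 + Rabs x) ^ D1 <= K1 * (1 + Rabs x) ^ D1) by (apply Rmult_le_compat_r; lra). lra. }
    replace (u * z - u' * B x)%C with ((u - u') * z + u' * (z - B x))%C by ring.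
    eapply Rle_trans; [apply Cmod_triangle|]; rewrite 2!Cmod_mult.
    assert (B1 : Cmod (u - u') * Cmod z <= K1 / T ^ S N * (1 + Rabs x) ^ D1 * (13 * T * (1 + Rabs x))).
    { apply Rmult_le_compat; trivial; apply Cmod_ge_0. }
    assert (B2 : Cmod u' * Cmod (z - B x) <= (1 + K1) * (1 + Rabs x) ^ D1 * (K2 / T ^ N * (1 + Rabs x) ^ D2)).
    { apply Rmult_le_compat; trivial; apply Cmod_ge_0. }
    rewrite 2!pow_add, pow_1.
    set (Y1 := (1 + Rabs x) ^ D1) in *; set (Y2 := (1 + Rabs x) ^ D2) in *; set (X := 1 + Rabs x) in *.
    assert (HX : 1 <= X) by (unfold X; lra).
    rewrite HTS in B1.
    replace (K1 / (T * T ^ N) * Y1 * (13 * T * X)) with (13 * K1 / T ^ N * (Y1 * X)) in B1 by (field; lra).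
    replace ((1 + K1) * Y1 * (K2 / T ^ N * Y2)) with ((1 + K1) * K2 / T ^ N * (Y1 * Y2)) in B2 by (field; lra).
    replace ((13 * K1 + (1 + K1) * K2) / T ^ N * (Y1 * Y2 * X))
      with (13 * K1 / T ^ N * (Y1 * Y2 * X) + (1 + K1) * K2 / T ^ N * (Y1 * Y2 * X)) by (field; lra).
    assert (HYX : 0 <= Y1 * X) by (apply Rmult_le_pos; lra). assert (HYY : 0 <= Y1 * Y2) by (apply Rmult_le_pos; lra).
    assert (C1 : 13 * K1 / T ^ N * (Y1 * X) <= 13 * K1 / T ^ N * (Y1 * Y2 * X)).
    { apply Rmult_le_compat_l; [apply Rdiv_le_0_compat; lra|].
      replace (Y1 * Y2 * X) with (Y1 * X * Y2) by ring. nra. }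
    assert (C2 : (1 + K1) * K2 / T ^ N * (Y1 * Y2) <= (1 + K1) * K2 / T ^ N * (Y1 * Y2 * X)).
    { apply Rmult_le_compat_l; [apply Rdiv_le_0_compat; [apply Rmult_le_pos|]; lra|]. nra. }
    lra.
Qed.

(** * Choice of parameters and integration of the error *)

(** Keeps t between T/2 and 2T. With y = log T, V L is at most exp(y/4 + eps log y); as log y <= 2
    sqrt y, the hypothesis on y gives 4 eps <= sqrt y and hence eps log y <= y/2, while y >= 4
    leaves y/4 >= log 2. *)
Lemma shift_small (T V L eps : R) : 0 < eps -> 4 + 16 * eps ^ 2 <= ln T -> 0 < T ->
  L = Rpower (ln T) (1 / 2 + eps) -> V <= Rpower T (1 / 4) / ln T -> V * L <= T / 2.
Proof.
  intros He Hy HT HL HV; set (y := ln T) in *.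
  assert (He2 := pow2_ge_0 eps).
  assert (Hs : 0 < sqrt y) by (apply sqrt_lt_R0; lra).
  assert (Hsy : sqrt y * sqrt y = y) by (apply sqrt_def; lra).
  assert (Hln : ln y <= 2 * sqrt y).
  { rewrite <- Hsy at 1; rewrite ln_mult by trivial; generalize (ln_le_sub_1 (sqrt y) Hs); lra. }
  assert (Hl0 : 0 <= ln y) by (apply ln_ge_0; lra).
  assert (H4e : 4 * eps <= sqrt y).
  { apply Rnot_lt_le; intros Hlt; assert (sqrt y * sqrt y < 4 * eps * (4 * eps)) by (apply Rmult_le_0_lt_compat; lra); lra. }
  assert (HLp : 0 < L) by (rewrite HL; apply exp_pos).
  apply Rle_trans with (Rpower T (1 / 4) / y * L); [apply Rmult_le_compat_r; lra|].
  replace (Rpower T (1 / 4) / y * L) with (exp (1 / 4 * y + - ln y + (1 / 2 + eps) * ln y)).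
  2:{ rewrite HL; unfold Rpower, Rdiv; fold y; rewrite 2!exp_plus, exp_Ropp, exp_ln by lra; ring. }
  replace (T / 2) with (exp (y - ln 2)).
  2:{ unfold Rminus, y; rewrite exp_plus, exp_Ropp, !exp_ln by lra; reflexivity. }
  apply exp_le.
  assert (ln 2 <= 1) by (generalize (ln_le_sub_1 2 ltac:(lra)); lra).
  assert (eps * ln y <= eps * (2 * sqrt y)) by (apply Rmult_le_compat_l; lra).
  assert (eps * (2 * sqrt y) <= y / 2).
  { assert (4 * eps * sqrt y <= sqrt y * sqrt y) by (apply Rmult_le_compat_r; lra). lra. }
  lra.
Qed.

Theorem theorem1 :
  forall lG : C -> C, is_logGamma lG ->
  forall (alpha : R) (phi : R -> R) (a b eps delta N : R),
    1 < alpha ->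
    (forall x : R, 0 <= phi x) ->
    (exists x : R, phi x <> 0) ->
    (forall x : R, phi (- x) = phi x) ->
    gelfand_shilov 0 alpha phi ->
    0 < a ->
    (forall x : R, a <= Rabs x -> phi x = 0) ->
    is_RInt_gen phi (Rbar_locally m_infty) (Rbar_locally p_infty) 1 ->
    Rmax 1 a < b ->
    0 < eps ->
    0 < delta < 2 * PI * (b - a) ->
    1 <= N ->
    exists T0 K : R,
      forall T V t : R,
        T0 <= T ->
        let f := fourier (window phi b) in
        let G := delta / ln (T / (2 * PI)) in
        let L := Rpower (ln T) (1 / 2 + eps) in
        Rpower (ln T) eps <= V <= Rpower T (1 / 4) / ln T ->
        Rabs (t - T) <= V * L ->
        @ex_RInt_gen C_R_NormedModule (MZ_integrand lG f G t)
          (Rbar_locally m_infty) (Rbar_locally p_infty) /\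
        exists E : C,
          Cmod E <= K * Rpower T (- N) /\
          MZ lG f G t = (RtoC G * (HardyZ lG t + E))%C.
Proof.
  intros lG HlG alpha phi a b eps delta N _ _ _ _ [Hsm _] Ha Hsupp Hint Hb Heps Hdelta HN.
  assert (HPI := PI_RGT_0). assert (HPI2 := PI2_3_2).
  assert (Hab : a < b) by (generalize (Rmax_r 1 a); lra).
  set (Phi := window phi b). set (c := a + b). set (d := c + 1). set (rho := b - a).
  assert (HPhi : bump c Phi) by (apply window_bump; trivial).
  assert (Hd : 0 < d) by (unfold d, c; lra).
  assert (Hcd : c < d) by (unfold d; lra).
  assert (Hflat : forall u, Rabs u < rho -> Phi u = 1) by (intros u Hu; apply (window_flat phi a b); trivial).
  destruct (nat_above N) as [n0 Hn0].
  (* The kernel reproduces frequencies below 2 pi rho / G = kap log(T/2pi); the hypothesis on delta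
     says that kap > 1. *)
  set (kap := 2 * PI * rho / delta).
  assert (Hkap : 1 < kap).
  { unfold kap; apply Rmult_lt_reg_r with delta; [lra|].
    replace (2 * PI * rho / delta * delta) with (2 * PI * rho) by (field; lra); unfold rho; lra. }
  (* At most half of the room kap - 1 goes to the length of the zeta sum; the other half absorbs the
     bounded parts of the frequencies for large T. *)
  set (eta := Rmin 1 ((kap - 1) / 2)).
  assert (Heta : 0 < eta <= 1) by (split; [apply Rmin_glb_lt; lra | apply Rmin_l]).
  assert (Heta2 : eta <= (kap - 1) / 2) by apply Rmin_r.
  (* The extra power of T pays for the division of the error integral by G, as 1/G <= T/delta. *)
  destruct (hardy_expansion lG (S n0) eta HlG Heta) as [K [D [HK HE]]].
  (* D powers cancel the growth of the error; two more leave the integrable 1/(1 + x^2). *)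
  destruct (cft_decay_1 c d Phi (D + 2) HPhi Hd Hcd) as [Kf [HKf Hf]].
  set (l2 := ln (2 * PI)).
  assert (Hl2 : 0 <= l2) by (apply ln_ge_0; lra).
  assert (HlPI : 0 <= ln PI) by (apply ln_ge_0; lra).
  set (C0 := 13 + (5 + ln PI) / 2).
  assert (HC0 : 13 <= C0) by (unfold C0; lra).
  assert (Hkl : 0 <= kap * l2) by (apply Rmult_le_pos; lra).
  (* Beyond this value of log T, the half (kap - 1)/2 log T of the room exceeds the additive
     constants, including the loss from log(T/2pi) in place of log T. *)
  set (Y2 := 2 * (C0 + kap * l2) / (kap - 1)).
  assert (HY2 : 0 <= Y2) by (unfold Y2; apply Rdiv_le_0_compat; lra).
  (* A lower bound for log T: [4 + 16 * eps ^ 2] serves [shift_small], [Y2] the frequency range, and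
     [delta + l2] the inequality G <= 1. *)
  set (Y := 4 + 16 * eps ^ 2 + Y2 + delta + l2).
  assert (He2 := pow2_ge_0 eps).
  exists (exp Y), (K * Kf * PI / delta + K); intros T V t HT f G L HV Ht.
  assert (HTe : 1 + Y <= exp Y) by apply exp_ineq1_le.
  assert (HTp : 4 <= T) by (unfold Y in *; lra).
  assert (HY : Y <= ln T).
  { rewrite <- (ln_exp Y); apply ln_le; [apply exp_pos | exact HT]. }
  set (y := ln T) in *.
  assert (Hlog : ln (T / (2 * PI)) = y - l2) by (unfold y, l2; apply ln_div; lra).
  assert (Hlog1 : delta + 4 <= y - l2) by (unfold Y in HY; lra).
  assert (HG : 0 < G <= 1).
  { unfold G; rewrite Hlog; split; [apply Rdiv_lt_0_compat; lra|].
    apply Rmult_le_reg_r with (y - l2); [lra|].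
    replace (delta / (y - l2) * (y - l2)) with delta by (field; lra); lra. }
  assert (Ht2 : T / 2 <= t <= 2 * T).
  { assert (V * L <= T / 2) by (apply (shift_small T V L eps); trivial; [unfold y, Y in *; lra | lra | apply HV]).
    apply Rabs_le_between in Ht; lra. }
  destruct (HE T t HTp Ht2) as [A [HA HAb]].
  assert (HR : (1 + eta) * y + C0 < kap * (y - l2)).
  { assert (H : (kap - 1) / 2 * Y2 = C0 + kap * l2) by (unfold Y2; field; lra).
    assert ((kap - 1) / 2 * (4 + Y2) <= (kap - 1) / 2 * y) by (apply Rmult_le_compat_l; unfold Y in HY; lra).
    assert (eta * y <= (kap - 1) / 2 * y) by (apply Rmult_le_compat_r; lra). lra. }
  assert (HGk : G * (kap * (y - l2)) = 2 * PI * rho).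
  { unfold G, kap; rewrite Hlog; field; split; lra. }
  assert (Hey : 0 <= eta * y) by (apply Rmult_le_pos; lra).
  assert (Hlo : - (2 * PI * rho) < G * - ((5 + ln PI) / 2 + 1 + (1 + eta) * y)).
  { rewrite <- HGk, Ropp_mult_distr_r; apply Rmult_lt_compat_l; [lra|]; unfold C0 in HR; lra. }
  assert (Hhi : G * (y / 2 + 12) < 2 * PI * rho).
  { rewrite <- HGk; apply Rmult_lt_compat_l; lra. }
  assert (HJ := expoly_reproducing_scale c d rho Phi HPhi Hd Hcd ltac:(unfold rho, d, c; lra) Hflat _ _ A G (proj1 HG) Hlo Hhi HA).
  set (err := fun x => ((HardyZ lG (t + x)%R - A x) * cft d Phi (x / G)%R)%C).
  assert (HTS : 1 <= T ^ S n0) by (apply pow_R1_Rle; lra).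
  destruct (lorentz_dom_line err (K / T ^ S n0 * Kf)) as [l [Hl Hlb]].
  { apply Rmult_le_pos; trivial; apply Rdiv_le_0_compat; lra. }
  { intros x; apply ccont_mult.
    - apply ccont_ext with (fun x => HardyZ lG (t + x)%R + - (1) * A x)%C; [intros; ring|].
      apply ccont_plus.
      + apply (ccont_comp (HardyZ lG) (fun x => t + x)); [apply HardyZ_ccont; trivial|].
        apply (ex_derive_continuous (fun x => t + x)); auto_derive; trivial.
      + apply ccont_mult; [apply ccont_const | apply (expoly_ccont _ _ _ _ HA)].
    - apply (ccont_comp (cft d Phi) (fun x => x / G)); [apply (cft_ccont c); trivial|].
      apply (ex_derive_continuous (fun x => x / G)); auto_derive; trivial. }
  { intros x; unfold err; rewrite Cmod_mult.
    assert (Hx := Rabs_pos x). assert (Hq : 0 < 1 + x ^ 2) by (generalize (pow2_ge_0 x); lra).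
    (* Since G <= 1, decay of the kernel in x/G is at least as strong as decay in x, with constants
       independent of T. *)
    assert (Hxg : Rabs x <= Rabs (x / G)).
    { unfold Rdiv; rewrite Rabs_mult, Rabs_inv, (Rabs_pos_eq G) by lra.
      assert (1 <= / G) by (rewrite <- Rinv_1; apply Rinv_le_contravar; lra). nra. }
    assert (Hcf := Cmod_ge_0 (cft d Phi (x / G))).
    assert (H1 : (1 + Rabs x) ^ D * (1 + x ^ 2) <= (1 + Rabs (x / G)) ^ (D + 2)).
    { rewrite pow_add; apply Rmult_le_compat; [apply pow_le; lra | lra | apply pow_incr; lra|].
      rewrite <- (pow2_abs x); simpl; nra. }
    apply Rmult_le_reg_r with (1 + x ^ 2); trivial.
    replace (K / T ^ S n0 * Kf / (1 + x ^ 2) * (1 + x ^ 2)) with (K / T ^ S n0 * Kf) by (field; lra).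
    apply Rle_trans with (K / T ^ S n0 * (1 + Rabs x) ^ D * Cmod (cft d Phi (x / G)) * (1 + x ^ 2)).
    - apply Rmult_le_compat_r; [lra|]; apply Rmult_le_compat_r; [trivial | apply HAb].
    - replace (K / T ^ S n0 * (1 + Rabs x) ^ D * Cmod (cft d Phi (x / G)) * (1 + x ^ 2))
        with (K / T ^ S n0 * ((1 + Rabs x) ^ D * (1 + x ^ 2) * Cmod (cft d Phi (x / G)))) by ring.
      apply Rmult_le_compat_l; [apply Rdiv_le_0_compat; lra|].
      apply Rle_trans with ((1 + Rabs (x / G)) ^ (D + 2) * Cmod (cft d Phi (x / G))); [apply Rmult_le_compat_r; trivial | apply Hf]. }
  assert (HM : is_CInt_gen (MZ_integrand lG f G t) m_inf p_inf (l + RtoC G * A 0)%C).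
  { generalize (is_CInt_gen_plus _ _ _ _ _ _ Hl HJ); apply is_CInt_gen_ext; try typeclasses eauto; trivial.
    intros x; unfold MZ_integrand, err, f; rewrite (fourier_cft c d) by trivial; ring. }
  split; [eexists; exact HM|].
  (* The kernel returns G A(0) instead of G Z(t), so E is the integrated error divided by G plus the
     pointwise error at x = 0. *)
  exists (l / RtoC G + (A 0 - HardyZ lG t))%C; split.
  - assert (HA0 : Cmod (A 0 - HardyZ lG t) <= K / T ^ S n0).
    { generalize (HAb 0); rewrite Rabs_R0, 2!Rplus_0_r, pow1, Rmult_1_r.
      rewrite <- Cmod_opp; intros H; eapply Rle_trans; [|exact H]; right; f_equal; ring. }
    assert (HlG' : Cmod (l / RtoC G) <= K * Kf * PI / delta * / T ^ n0).
    { rewrite Cmod_div, Cmod_RtoC_pos by (try apply RtoC_neq; lra).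
      apply Rle_trans with (K / T ^ S n0 * Kf * PI * (T / delta)).
      - unfold Rdiv at 1; apply Rmult_le_compat; [apply Cmod_ge_0 | left; apply Rinv_0_lt_compat; lra | exact Hlb|].
        unfold G; rewrite Hlog.
        replace (/ (delta / (y - l2))) with ((y - l2) / delta) by (field; lra).
        unfold Rdiv; apply Rmult_le_compat_r; [left; apply Rinv_0_lt_compat; lra|].
        generalize (ln_le_sub_1 T ltac:(lra)); fold y; lra.
      - right; cbn [pow]; field; repeat split; try apply pow_nonzero; lra. }
    assert (HTn : 0 < T ^ n0) by (apply pow_lt; lra).
    assert (HRp : / T ^ n0 <= Rpower T (- N)).
    { unfold Rpower; rewrite <- (exp_ln (T ^ n0)), ln_pow, <- exp_Ropp by lra.
      apply exp_le; fold y; nra. }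
    assert (HTT : K / T ^ S n0 <= K * / T ^ n0).
    { apply Rmult_le_compat_l; [lra|]; apply Rinv_le_contravar; trivial; apply Rle_pow; [lra | lia]. }
    assert (HKK : 0 <= K * Kf * PI / delta) by (apply Rdiv_le_0_compat; [apply Rmult_le_pos; [apply Rmult_le_pos|]; lra | lra]).
    eapply Rle_trans; [apply Cmod_triangle|].
    apply Rle_trans with ((K * Kf * PI / delta + K) * / T ^ n0); [lra|].
    apply Rmult_le_compat_l; lra.
  - transitivity (l + RtoC G * A 0)%C.
    + unfold MZ; apply (is_RInt_gen_unique (V := C_R_CompleteNormedModule)); exact HM.
    + field; apply RtoC_neq; lra.
Qed.
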